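(* Let $0<\theta<1$ and consider the continuous-time duplication–deletion random graph with parameter $\theta$. Let $d_i(t)$ denote the degree of vertex $i$ at time $t$, and let $\gamma=\frac{1-\theta}{\theta}$. For every $i=1,2,\dots$ we have $$\lim_{t\to\infty}P\big(d_i(t)=k\big)=q_k,\qquad k=0,1,\dots,$$ where $$q_0=\gamma(1-c_0),\qquad q_k=c_{k-1}-\gamma c_k,\quad k=1,2,\dots,$$ and $(c_k)_{k\ge 0}$ is the sequence specified in the context. Moreover, $q_k>0$ for all $k=0,1,\dots$, and $\sum_{k=0}^\infty q_k=1$.
   Context: Continuous-time duplication–deletion graph with parameter $0<\theta<1$: the process starts at time $0$ from a single vertex without edges. Every vertex is given two clocks at its birth, which ring according to independent homogeneous Poisson processes with rates $\theta$ and $1-\theta$ respectively (clocks of different vertices are independent). When the first clock of a vertex $v$ rings, $v$ is duplicated: a new vertex is added to the graph and connected by single edges to $v$ and to all neighbours of $v$. When the second clock of $v$ rings, $v$ is deleted, meaning that all edges of $v$ are deleted, but the vertex $v$ itself stays in the graph (and may get new edges later). Vertices are labelled $1,2,\dots$ in the order of birth. Vertex $i$ is born at an almost surely finite random time, and the event $\{d_i(t)=k\}$ means that vertex $i$ is present at time $t$ and has degree $k$. The sequence $(c_k)_{k\ge0}$ (known to be the almost sure limiting proportion of vertices of degree $k$ in the graph) is defined as follows. Let $\gamma=\frac{1-\theta}{\theta}$ and, for $\theta\ne 1/2$, $\beta=\frac{\theta}{2\theta-1}$. For $k\ge0$: if $0<\theta<1/2$ (subcritical case), $c_k=\gamma^{-k-1}\int_0^1\frac{t^{k+1}(1-t)^{-1-\beta}}{(1-\gamma^{-1}t)^{1-\beta}}\,dt$;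 if $\theta=1/2$ (critical case), $c_k=(k+1)\int_0^\infty\frac{t^k e^{-t}}{(1+t)^{k+2}}\,dt$; if $1/2<\theta<1$ (supercritical case), $c_k=\gamma\int_0^1\frac{t^{k+1}(1-t)^{\beta-1}}{(1-\gamma t)^{1+\beta}}\,dt$. It is known that these numbers are positive, satisfy $\sum_{k\ge 0}c_k=1$, and satisfy $c_0=\frac{1-\theta}{1+\theta}(1+c_1)$ and $c_k=\frac{k+1}{k+1+\theta}\big(\theta c_{k-1}+(1-\theta)c_{k+1}\big)$ for $k\ge1$. *)

(* Defs.v *)
From HB Require Import structures.
From mathcomp Require Import all_boot all_order all_algebra.
From mathcomp Require Import all_classical all_reals all_analysis.

Set Implicit Arguments.
Unset Strict Implicit.
Unset Printing Implicit Defensive.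

Import Order.TTheory GRing.Theory Num.Theory.
Import numFieldNormedType.Exports.

Local Open Scope classical_set_scope.
Local Open Scope ring_scope.

(* Vertices are labelled 0, 1, 2, ... in the order of birth, so label i is the
   (i+1)-st vertex of the usual numbering 1, 2, .... *)

Notation duplication := true (only parsing).
Notation deletion := false (only parsing).

(* In [waits R], [w v c j] is the waiting time between the j-th and the
   (j+1)-st ring of clock c of vertex v; the 0-th "ring" is the birth of v. *)
Definition waits (R : realType) := nat -> bool -> nat -> R.

(* The situation just after some ring (or at the start). The vertices present
   are 0, ..., [newest]; [birth], [rings] (number of past rings of each clock)
   and [adj] are meaningful on these labels only. *)
Record state (R : realType) := State {
  time : R;
  newest : nat;
  birth : nat -> R;
  rings : nat -> bool -> nat;
  adj : rel nat
}.

Definition init (R : realType) : state R :=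
  State 0 0%N (fun _ => 0) (fun _ _ => 0%N) (fun _ _ => false).

Definition degree (R : realType) (s : state R) (i : nat) : nat :=
  #|[set y : 'I_(newest s).+1 | adj s i y]%SET|.

Definition duplicate_adj (new v : nat) (e : rel nat) : rel nat := fun x y =>
  [|| e x y,
      (x == new) && ((y == v) || e v y) |
      (y == new) && ((x == v) || e v x)].

Definition delete_adj (v : nat) (e : rel nat) : rel nat := fun x y =>
  [&& x != v, y != v & e x y].

Definition next_ring (R : realType) (w : waits R) (s : state R)
    (v : nat) (c : bool) : R :=
  birth s v + \sum_(0 <= j < (rings s v c).+1) w v c j.

(* The clock that rings next; ties, which have probability zero, are broken
   arbitrarily. *)
Definition next_clock (R : realType) (w : waits R) (s : state R) :
    'I_(newest s).+1 * bool :=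
  [arg min_(p < (ord0, duplication)) next_ring w s p.1 p.2]%O.

Definition step (R : realType) (w : waits R) (s : state R) : state R :=
  let v := nat_of_ord (next_clock w s).1 in
  let c := (next_clock w s).2 in
  let t := next_ring w s v c in
  let rings' := fun x b =>
    if (x == v) && (b == c) then (rings s x b).+1 else rings s x b in
  if c == duplication then
    let new := (newest s).+1 in
    State t new (fun x => if x == new then t else birth s x) rings'
      (duplicate_adj new v (adj s))
  else
    State t (newest s) (birth s) rings' (delete_adj v (adj s)).

Definition chain (R : realType) (w : waits R) (m : nat) : state R :=
  iter m (step w) (init R).

(* [s] is the state of the process at time [t]; almost surely the ring times
   tend to infinity, and then there is exactly one such [s] for every t >= 0. *)
Definition state_at (R : realType) (w : waits R) (t : R) (s : state R) : Prop :=
  exists m : nat,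
    s = chain w m /\ time (chain w m) <= t < time (chain w m.+1).

Definition mutually_independent d (T : measurableType d) (R : realType)
    (P : probability T R) (I : eqType) (X : I -> {RV P >-> R}) : Prop :=
  forall (J : seq I) (B : I -> set R), uniq J ->
    (forall i, measurable (B i)) ->
    P (\bigcap_(i in [set` J]) X i @^-1` B i)
      = (\prod_(i <- J) P (X i @^-1` B i))%E.

(* Independent homogeneous Poisson clocks, of rate theta for duplication and
   1 - theta for deletion; a Poisson process of rate r is given by its
   independent waiting times with exponential distribution of rate r. *)
Definition poisson_clocks d (T : measurableType d) (R : realType)
    (P : probability T R) (theta : R)
    (X : nat -> bool -> nat -> {RV P >-> R}) : Prop :=
  (forall v c j (B : set R), measurable B ->
     distribution P (X v c j) B
       = exponential_prob (if c == duplication then theta else 1 - theta) B) /\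
  mutually_independent (fun p : nat * bool * nat => X p.1.1 p.1.2 p.2).

Definition degree_event d (T : measurableType d) (R : realType)
    (P : probability T R) (X : nat -> bool -> nat -> {RV P >-> R})
    (i : nat) (t : R) (k : nat) : set T :=
  [set x | exists s : state R,
     [/\ state_at (fun v c j => X v c j x) t s,
         (i <= newest s)%N & degree s i = k]].

Definition gamma (R : realType) (theta : R) : R := (1 - theta) / theta.

Definition beta (R : realType) (theta : R) : R := theta / (2 * theta - 1).

Definition c_ (R : realType) (theta : R) (k : nat) : R :=
  let g := gamma theta in
  let b := beta theta in
  if theta < 2^-1 then
    g ^- k.+1 * \int[lebesgue_measure]_(t in `[0, 1])
      (t ^+ k.+1 * (1 - t) `^ (- 1 - b) / (1 - g^-1 * t) `^ (1 - b))
  else if theta == 2^-1 then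
    k.+1%:R * \int[lebesgue_measure]_(t in `[0, +oo[)
      (t ^+ k * expR (- t) / (1 + t) ^+ k.+2)
  else
    g * \int[lebesgue_measure]_(t in `[0, 1])
      (t ^+ k.+1 * (1 - t) `^ (b - 1) / (1 - g * t) `^ (1 + b)).

Definition q_ (R : realType) (theta : R) (k : nat) : R :=
  if k is j.+1 then c_ theta j - gamma theta * c_ theta k
  else gamma theta * (1 - c_ theta 0).

(* Main.v *)
Require Import Defs.
From HB Require Import structures.
From mathcomp Require Import all_boot all_order all_algebra.
From mathcomp Require Import all_classical all_reals all_analysis.
From mathcomp Require Import measurable_realfun ring lra zify.

Set Implicit Arguments.
Unset Strict Implicit.
Unset Printing Implicit Defensive.

Import Order.TTheory GRing.Theory Num.Theory.
Import numFieldNormedType.Exports.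
Import HBNNSimple.

Local Open Scope classical_set_scope.
Local Open Scope ring_scope.

(* Put [w = 1 - theta] and follow the degree of a fixed vertex. When the graph
   has N vertices and the vertex has degree n, rings come at rate N, and the
   degree goes to n+1 at rate theta (n+1), to n-1 at rate w n and to 0 at rate
   w, whatever N is. Hence, for 0 <= z <= 1 and with d(t) the degree at time t,
   G(t, n) = E (z^d(t) | d(0) = n) should solve the backward equation
     G' = theta (n+1) (G(n+1) - G(n)) + w n (G(n-1) - G(n)) + w (G(0) - G(n)).
   It has an explicit solution: a birth-death process killed at rate w and then
   restarted from 0. It forgets n, and its limit is the generating function of
   a mixture of geometric distributions of parameter rho(a), where the age a
   since the last restart is exponential of rate w. A change of variables
   (t = gamma rho(a) if theta < 1/2, t = rho(a) if theta > 1/2, an integration by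
   parts if theta = 1/2) gives c_k = w int_0^oo exp(-theta a) rho(a)^(k+1) da,
   and 1 - gamma rho = exp(-(1 - 2 theta) a) (1 - rho) identifies the mixture
   with q_k.

   The passage from the clocks to the equation is a one-step analysis of the
   jump chain: given the rings that have occurred so far, the residual waiting
   times are again independent exponentials. The ring times T_m tend to
   infinity because E exp(-T_m) <= 1/(m+1), and the number V_m of vertices added
   by the m-th ring does because E 2^(-V_m) = (1 - theta/2)^m. *)

(** * Integration against exponential variables *)

(** Only finite joint laws of the clocks are given, on an arbitrary probability space, so
    conditioning is done by hand. There are finitely many histories of length m; for each one
    independence is phrased as a product formula for tail probabilities, and this formula is carried
    from a history to its extensions. The residual times along a history are defined on the whole
    sample space, whether or not the history occurs.

    The rates come from a count of the clocks that matter: the two of the vertex and those of its n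
    neighbours. A bound uniform in n spares any computation of the law of the graph at the birth of
    the vertex: it suffices to start at a fixed ring m0 by which the vertex is very likely born.
    From there the conditional expectations of z^d(t) telescope up to a ring M that very likely
    comes after t.

    Generating functions are compared only up to an error z^K, where K is the number of terms kept.
    Convergence of the k-th coefficient follows by induction on k: take K = k+1, divide by z^k and
    let z be small. *)

Lemma integral_density d (T : measurableType d) (R : realType)
    (mu nu : {measure set T -> \bar R}) (h : T -> R) :
  measurable_fun setT h -> (forall x, 0 <= h x) ->
  (forall A, measurable A -> nu A = \int[mu]_(x in A) (h x)%:E)%E ->
  forall f : T -> \bar R, measurable_fun setT f -> (forall x, 0 <= f x)%E ->
  (\int[nu]_x f x = \int[mu]_x (f x * (h x)%:E))%E.
Proof.
move=> mh h0 nuE.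
have mhE : measurable_fun setT (EFin \o h) by exact/measurable_EFinP.
have indicE A : measurable A ->
    (\int[nu]_x (\1_A x)%:E = \int[mu]_x ((\1_A x)%:E * (h x)%:E))%E.
  move=> mA; rewrite integral_indic// setIT nuE// integral_mkcond.
  apply: eq_integral => x _; rewrite patchE indicE.
  by case: (x \in A); rewrite ?mul1e ?mul0e.
have sfunE (f : {nnsfun T >-> R}) :
    (\int[nu]_x (f x)%:E = \int[mu]_x ((f x)%:E * (h x)%:E))%E.
  under [LHS]eq_integral do rewrite fimfunE -fsumEFin//.
  rewrite [LHS]ge0_integral_fsum//; last 2 first.
    - by move=> r; exact/measurable_EFinP/measurableT_comp.
    - by move=> n x _; rewrite EFinM nnfun_muleindic_ge0.
  under [RHS]eq_integral.
    move=> x xD; rewrite fimfunE -fsumEFin// ge0_mule_fsuml; last first.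
      by move=> r; rewrite EFinM nnfun_muleindic_ge0.
    over.
  rewrite [RHS]ge0_integral_fsum//; last 2 first.
    - move=> r; apply: emeasurable_funM => //.
      by apply/measurable_EFinP; apply/measurableT_comp.
    - move=> n x _; rewrite mule_ge0 ?lee_fin//.
      by rewrite -lee_fin EFinM nnfun_muleindic_ge0.
  apply: eq_fsbigr => r /[!inE] -[y _ fyr].
  under [in RHS]eq_integral do rewrite EFinM -muleA.
  rewrite integralZl_indic_nnsfun//.
  rewrite indicE// ge0_integralZl//.
  - apply: emeasurable_funM => //.
    by apply/measurable_EFinP; apply/measurable_indic.
  - by move=> x _; rewrite mule_ge0 ?lee_fin//.
  - by rewrite lee_fin -fyr.
(* Both sides pass to the limit along increasing simple approximations of [f]. *)
move=> f mf f0; pose f_ := nnsfun_approx measurableT mf.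
transitivity (lim (\int[nu]_x (f_ n x)%:E @[n --> \oo])%E).
  rewrite -monotone_convergence//=.
  - apply: eq_integral => ? /[!inE] xD; apply/esym/cvg_lim => //=.
    exact: cvg_nnsfun_approx.
  - by move=> n; exact/measurable_EFinP/measurable_funTS.
  - by move=> n ? _; rewrite lee_fin.
  - by move=> ? _ ? ? mn; rewrite lee_fin; exact/lefP/nd_nnsfun_approx.
transitivity (lim (\int[mu]_x ((f_ n x)%:E * (h x)%:E) @[n --> \oo])%E).
  by under eq_fun do rewrite sfunE.
rewrite -monotone_convergence//=.
- apply: eq_integral => x /[!inE] xD; apply/cvg_lim => //=.
  apply: cvgeZr => //.
  exact: cvg_nnsfun_approx.
- move=> n; apply: emeasurable_funM => //.
  exact/measurable_EFinP/measurable_funTS.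
- by move=> n ? _; rewrite mule_ge0 ?lee_fin//.
- move=> x _ ? ? mn; apply: lee_wpmul2r; rewrite ?lee_fin//.
  exact/lefP/nd_nnsfun_approx.
Qed.

(** Open rays together with the whole line form a pi-system that generates the Borel sets; the whole
    line is included so that it can serve as the cover of finite measure. *)
Lemma measure_unique_ray (R : realType) (m1 m2 : {measure set (measurableTypeR R) -> \bar R}) :
  m1 setT = m2 setT -> (m1 setT < +oo)%E ->
  (forall s : R, m1 `]s, +oo[%classic = m2 `]s, +oo[%classic) ->
  forall A, measurable A -> m1 A = m2 A.
Proof.
move=> mT m1oo mray A mA.
pose G : set (set (measurableTypeR R)) := [set B | B = setT \/ exists x, B = `]x, +oo[%classic].
apply: (@measure_unique _ _ _ G (fun=> setT)) => //.
- transitivity (@RGenOInfty.G R).-sigma.-measurable.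
    exact: RGenOInfty.measurableE.
  rewrite eqEsubset; split => B.
    apply: smallest_sub; first exact: smallest_sigma_algebra.
    by move=> _ /= [x ->]; apply: sub_sigma_algebra; right; exists x.
  apply: smallest_sub; first exact: smallest_sigma_algebra.
  move=> _ /= [->|[x ->]]; first exact: measurableT.
  by apply: sub_sigma_algebra; exists x.
- move=> B C [->|[x ->]] [->|[y ->]]; rewrite ?setIT ?setTI; [left|right|right|right] => //.
  + by exists y.
  + by exists x.
  + exists (Num.max x y); apply/seteqP; split=> z/=; rewrite !in_itv/= !andbT gt_max => /andP //.
- by left.
- by rewrite bigcup_const.
- by move=> B [->//|[x ->]].
Qed.

Lemma ge0_integral_mrestr d (T : measurableType d) (R : realType)
    (mu : {measure set T -> \bar R}) (E : set T) (mE : measurable E)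
    (f : T -> \bar R) : measurable_fun setT f -> (forall x, 0 <= f x)%E ->
  (\int[mrestr mu mE]_x f x = \int[mu]_(x in E) f x)%E.
Proof.
move=> mf f0; rewrite (@integral_density _ _ _ mu _ (\1_E))//.
- rewrite [RHS]integral_mkcond; apply: eq_integral => x _.
  by rewrite patchE indicE; case: ifP => _; rewrite ?mule1 ?mule0.
- by move=> A mA; rewrite integral_indic//= /mrestr setIC.
Qed.

Definition exp_measure (R : realType) (r : R) (r0 : 0 < r) :
    probability (measurableTypeR R) R :=
  exponential_distribution_exponential_prob__canonical__probability_measure_Probability r0.

Lemma integral_exponential (R : realType) (r : R) (r0 : 0 < r)
    (f : R -> \bar R) : measurable_fun setT f -> (forall x, 0 <= f x)%E ->
  (\int[exp_measure r0]_x f x = \int[lebesgue_measure]_(x in `[0%R, +oo[) (f x * (r * expR (- r * x))%:E))%E.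
Proof.
move=> mf f0; rewrite (@integral_density _ _ _ lebesgue_measure _ (exponential_pdf r))//.
- rewrite [RHS]integral_mkcond; apply: eq_integral => x _.
  rewrite patchE /exponential_pdf patchE; case: ifP => _; rewrite ?mule1 ?mule0//.
- exact: measurable_exponential_pdf.
- by move=> x; apply: exponential_pdf_ge0; apply: ltW.
Qed.

Lemma integral_scaled_exponential (R : realType) (r N : R) : 0 < N -> 0 <= r ->
  (\int[lebesgue_measure]_(s in `[0%R, +oo[) (r * expR (- N * s))%:E =
   (r / N)%:E)%E.
Proof.
move=> N0 r0.
have mN : measurable_fun setT (fun s : measurableTypeR R => (N * expR (- N * s))%:E).
  apply/measurable_EFinP; apply: measurable_funM => //; apply: measurableT_comp => //.
rewrite (eq_integral (fun s : measurableTypeR R => (r / N)%:E *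
  (1 * (N * expR (- N * s))%:E))%E); last first.
  by move=> s _; rewrite mul1e -EFinM mulrA divfK// gt_eqF.
rewrite ge0_integralZl//.
- rewrite -(integral_exponential N0 (f := cst 1%E))// integral_cst// mul1e.
  rewrite [X in (_ * X)%E](_ : _ = 1%E) ?mule1//.
  exact: (probability_setT (exp_measure N0)).
- apply: measurable_funTS; under eq_fun do rewrite mul1e; exact: mN.
- by move=> s _; rewrite mul1e lee_fin mulr_ge0 ?expR_ge0// ltW.
- by rewrite lee_fin divr_ge0// ltW.
Qed.

(** The maximum is there because the law has no mass below 0: a ray starting at a negative point has
    probability 1. *)
Lemma exponential_prob_ray (R : realType) (r : R) (s : R) : 0 < r ->
  exponential_prob r `]s, +oo[%classic = (expR (- r * Num.max s 0))%:E.
Proof.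
move=> r0.
have ray0 t : 0 <= t ->
    exponential_prob r `]t, +oo[%classic = (expR (- r * t))%:E.
  move=> t0; rewrite /exponential_prob integral_itv_obnd_cbnd; last first.
    apply/measurable_EFinP; apply: measurable_funTS.
    exact: measurable_exponential_pdf.
  rewrite (@ge0_continuous_FTC2y _ _ (fun x => - (expR (- r * x))) _ 0)//.
  - by rewrite EFinN oppeK add0e.
  - by move=> x _; apply: exponential_pdf_ge0; exact: ltW.
  - apply: (@continuous_subspaceW R^o _ _ [set` `[0, +oo[%R]).
      by move=> x/=; rewrite !in_itv/= !andbT; exact: le_trans.
    exact: within_continuous_exponential_pdf.
  - rewrite -oppr0; apply: cvgN.
    rewrite (_ : (fun x => expR (- r * x)) =
               (fun z => expR (- z)) \o (fun z => r * z)); last first.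
      by apply: eq_fun => x; rewrite mulNr.
    apply: (@cvg_comp _ _ _ _ _ _ (pinfty_nbhs R)); last exact: cvgr_expR.
    exact: gt0_cvgMry.
  - apply: cvgN; apply/cvg_at_right_filter.
    apply: continuous_comp; last exact: continuous_expR.
    by apply: continuousM => //; exact: cst_continuous.
  - move=> x xt; apply: derive1_exponential_pdf.
    by move: xt; rewrite !in_itv/= !andbT; exact: le_lt_trans.
have [s0|s0] := leP s 0; last by rewrite ray0 ?ltW.
rewrite mulr0 expR0; apply/eqP; rewrite eq_le; apply/andP; split.
  exact: (@probability_le1 _ _ _ (exp_measure r0)).
rewrite -(_ : exponential_prob r `]0, +oo[%classic = 1%E).
  apply: (@le_measure _ _ _ (exp_measure r0)); rewrite ?inE//.
  by move=> x/=; rewrite !in_itv/= !andbT; exact: le_lt_trans.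
by rewrite ray0// mulr0 expR0.
Qed.

Lemma integral_exponential_ray (R : realType) (r t : R) : 0 < r -> 0 <= t ->
  (\int[lebesgue_measure]_(a in `]t, +oo[) (r * expR (- r * a))%:E =
   (expR (- r * t))%:E)%E.
Proof.
move=> r0 t0; have := exponential_prob_ray t r0.
rewrite (max_idPl t0) => <-; apply: eq_integral => a; rewrite inE/= in_itv/= andbT => ta.
by rewrite exponential_pdfE// (le_trans t0)// ltW.
Qed.

Lemma measurable_preimage d d' (T : measurableType d) (Y : measurableType d')
    (f : T -> Y) (B : set Y) :
  measurable_fun setT f -> measurable B -> measurable (f @^-1` B).
Proof. by move=> mf mB; rewrite -[_ @^-1` _]setTI; exact: mf. Qed.

Lemma measurable_ltr_set d (T : measurableType d) (R : realType) (f g : T -> R) :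
  measurable_fun setT f -> measurable_fun setT g -> measurable [set x | f x < g x].
Proof.
move=> mf mg; have := measurable_fun_ltr mf mg.
by move=> /measurable_preimage /(_ (I : measurable [set true])).
Qed.

Lemma measurable_ler_set d (T : measurableType d) (R : realType) (f g : T -> R) :
  measurable_fun setT f -> measurable_fun setT g -> measurable [set x | f x <= g x].
Proof.
move=> mf mg; have := measurable_fun_ler mf mg.
by move=> /measurable_preimage /(_ (I : measurable [set true])).
Qed.

(** The endpoint is a null set; this matters where two integrands agree only for positive delays. *)
Lemma eq_integral_itvcy (R : realType) (f g : measurableTypeR R -> \bar R) :
  measurable_fun setT f -> measurable_fun setT g ->
  (forall x, (0 < x)%R -> f x = g x) ->
  (\int[lebesgue_measure]_(x in `[0%R, +oo[) f x =
   \int[lebesgue_measure]_(x in `[0%R, +oo[) g x)%E.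
Proof.
move=> mf mg fg; rewrite -!integral_itv_obnd_cbnd; last 2 first.
- exact: measurable_funTS.
- exact: measurable_funTS.
by apply: eq_integral => x; rewrite inE /= in_itv/= andbT; exact: fg.
Qed.

Section law_on.
Context d (T : measurableType d) (R : realType) (P : probability T R).
Context d' (Y : measurableType d').
Variables (E : set T) (mE : measurable E).
Variables (Z : T -> Y) (mZ : measurable_fun setT Z).

(** A finite measure of mass P(E), so that Fubini can be applied on one event at a time. The
    measurability proofs are arguments so that the measure structure can be inferred from the
    term. *)
Definition law_on (_ : measurable E) (_ : measurable_fun setT Z) :
  set Y -> \bar R := fun B => P (Z @^-1` B `&` E).
Local Notation law := (law_on mE mZ).

Let mpre B : measurable B -> measurable (Z @^-1` B).
Proof. by move=> mB; rewrite -[_ @^-1` _]setTI; apply: mZ. Qed.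

Let law0 : law set0 = 0%E.
Proof. by rewrite /law_on preimage_set0 set0I measure0. Qed.

Let law_ge0 B : (0 <= law B)%E.
Proof. exact: measure_ge0. Qed.

Let law_sigma_additive : semi_sigma_additive law.
Proof.
move=> F mF tF mUF; rewrite /law_on preimage_bigcup setI_bigcupl.
apply: measure_semi_sigma_additive.
- by move=> n; apply: measurableI => //; exact: mpre.
- apply/trivIsetP => i j _ _ ij; rewrite setIACA -preimage_setI.
  by move/trivIsetP : tF => /(_ i j Logic.I Logic.I ij) ->; rewrite preimage_set0 set0I.
- rewrite -setI_bigcupl; apply: measurableI => //.
  by rewrite -preimage_bigcup; exact: mpre.
Qed.

HB.instance Definition _ := isMeasure.Build _ _ _ law law0 law_ge0 law_sigma_additive.

Let law_fin : fin_num_fun law.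
Proof.
by move=> B mB; apply: fin_num_measure; apply: measurableI => //; exact: mpre.
Qed.

HB.instance Definition _ := @Measure_isFinite.Build _ Y R law law_fin.

Lemma ge0_integral_law_on (f : Y -> \bar R) :
  measurable_fun setT f -> (forall y, 0 <= f y)%E ->
  (\int[law]_y f y = \int[P]_(x in E) f (Z x))%E.
Proof.
move=> mf f0; rewrite -(ge0_integral_mrestr P mE); last 2 first.
- exact: measurableT_comp.
- by [].
transitivity (\int[pushforward (mrestr P mE) Z]_y f y)%E.
  by apply: eq_measure_integral.
by rewrite ge0_integral_pushforward.
Qed.

End law_on.

(* On the event E, the variable S is exponential and independent of Z as soon as
   this holds for the tails of S. *)
Lemma integral_indep_exponential d (T : measurableType d) (R : realType)
    (P : probability T R) d' (Y : measurableType d') (E : set T) (Z : T -> Y)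
    (S : T -> measurableTypeR R) (r : R) :
  0 < r -> measurable E -> measurable_fun setT Z -> measurable_fun setT S ->
  (forall B s, measurable B -> (0 <= s)%R ->
    P (E `&` Z @^-1` B `&` [set x | (s < S x)%R]) =
    P (E `&` Z @^-1` B) * (expR (- r * s))%:E :> \bar R)%E ->
  forall f : Y * measurableTypeR R -> \bar R, measurable_fun setT f ->
    (forall z, 0 <= f z)%E ->
  (\int[P]_(x in E) f (Z x, S x) =
   \int[P]_(x in E) \int[lebesgue_measure]_(s in `[0%R, +oo[)
     (f (Z x, s) * (r * expR (- r * s))%:E))%E.
Proof.
move=> r0 mE mZ mS tail f mf f0.
have mZS : measurable_fun setT (fun x => (Z x, S x) : (Y * measurableTypeR R)%type).
  exact/measurable_fun_pairP.
pose m2 := exp_measure r0.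
have mpre B : measurable B -> measurable (Z @^-1` B).
  by move=> mB; rewrite -[_ @^-1` _]setTI; apply: mZ.
(* The joint law of (Z, S) on E is a product measure. It is enough to test rectangles, and for a
   fixed first side [B] both sides are finite measures in the second one, which agree on rays. *)
have lawE A : measurable A -> (law_on P mE mZ \x m2)%E A = law_on P mE mZS A.
  move=> mA; apply: product_measure_unique => // B C mB mC.
  have mE' : measurable (Z @^-1` B `&` E).
    by apply: measurableI => //; exact: mpre.
  have PE'fin : P (Z @^-1` B `&` E) \is a fin_num by exact: fin_num_measure.
  pose c : {nonneg R} := NngNum (fine_ge0 (measure_ge0 P (Z @^-1` B `&` E))).
  transitivity (law_on P mE' mS C).
    rewrite /= /law_on; congr (P _); apply/seteqP.
    by split => x /= [] => [[? ?] ?|? [? ?]].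
  transitivity (mscale c m2 C); last by rewrite /mscale/= fineK.
  apply: measure_unique_ray => //=.
  - rewrite [RHS](_ : _ = c%:num%:E * m2 setT)%E// probability_setT mule1 /=.
    by rewrite fineK// /law_on preimage_setT setTI.
  - by rewrite /law_on ltey_eq fin_num_measure// preimage_setT setTI.
  - move=> s.
    rewrite [RHS](_ : _ = c%:num%:E * m2 `]s, +oo[%classic)%E//=.
    rewrite exponential_prob_ray// fineK//.
    have tl u : 0 <= u -> law_on P mE' mS `]u, +oo[%classic =
        (P (Z @^-1` B `&` E) * (expR (- r * u))%:E)%E.
      move=> u0; rewrite [in RHS]setIC -tail// /law_on; congr (P _).
      apply/seteqP; split=> x /=; rewrite in_itv/= andbT; last by move=> [[? ?] ?].
      by move=> [? [? ?]].
    (* For a negative threshold the probability is squeezed between the total mass and the ray at 0,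
       which already carries all of it. *)
    have [s0|s0] := leP s 0; last by rewrite tl ?ltW.
    apply/eqP; rewrite eq_le; apply/andP; split.
      rewrite mulr0 expR0 mule1; apply: le_measure; rewrite ?inE//.
        by apply: measurableI => //; exact: measurable_preimage.
    rewrite -tl//.
    apply: le_measure; rewrite ?inE//.
    - by move=> x /=; rewrite !in_itv/= !andbT; exact: le_lt_trans.
rewrite -(ge0_integral_law_on P mE mZS)//.
rewrite -(eq_measure_integral _ (fun A mA _ => lawE A mA)).
rewrite fubini_tonelli1// ge0_integral_law_on//; last 2 first.
- exact: measurable_fun_fubini_tonelli_F.
- by move=> y; apply: integral_ge0.
apply: eq_integral => x _; rewrite /fubini_F integral_exponential//.
exact: measurableT_comp.
Qed.

(** * The graph as a function of the sequence of rings *)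

(* A history is the list of the clocks (vertex, kind) in the order in which they
   rang; it determines the graph, but not the ring times. *)
Definition graph_step (g : nat * rel nat) (p : nat * bool) : nat * rel nat :=
  if p.2 then (g.1.+1, duplicate_adj g.1.+1 p.1 g.2)
  else (g.1, delete_adj p.1 g.2).

Definition graph_of (q : seq (nat * bool)) : nat * rel nat :=
  foldl graph_step (0%N, fun _ _ => false) q.

Definition last_vertex (q : seq (nat * bool)) : nat := (graph_of q).1.

Definition edge (q : seq (nat * bool)) : rel nat := (graph_of q).2.

Definition path_degree (q : seq (nat * bool)) (i : nat) : nat :=
  count (edge q i) (iota 0 (last_vertex q).+1).

Definition clocks (q : seq (nat * bool)) : seq (nat * bool) :=
  [seq (v, c) | v <- iota 0 (last_vertex q).+1, c <- [:: true; false]].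

Fixpoint paths (m : nat) : seq (seq (nat * bool)) :=
  if m is m'.+1 then [seq rcons q p | q <- paths m', p <- clocks q]
  else [:: [::]].

Lemma graph_of_rcons q p : graph_of (rcons q p) = graph_step (graph_of q) p.
Proof. by rewrite /graph_of foldl_rcons. Qed.

Lemma last_vertex_rcons q p : last_vertex (rcons q p) = (last_vertex q + p.2)%N.
Proof.
by rewrite /last_vertex graph_of_rcons /graph_step; case: p.2; rewrite /= ?addn1 ?addn0.
Qed.

Lemma mem_clocks q p : (p \in clocks q) = (p.1 <= last_vertex q)%N.
Proof.
rewrite -ltnS -[RHS](mem_iota 0) /clocks.
case: p => v c; move: (iota _ _) => s; apply/allpairsP/idP => /=.
  by move=> [[v' c'] /= [+ _ [-> _]]].
by move=> vq; exists (v, c); split=> //=; case: c.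
Qed.

Lemma clocks_uniq q : uniq (clocks q).
Proof. by apply: allpairs_uniq => //; [exact: iota_uniq|move=> [? ?] [? ?]]. Qed.

Lemma mem_paths_rcons m q p :
  (rcons q p \in paths m.+1) = (q \in paths m) && (p \in clocks q).
Proof.
apply/allpairsPdep/andP => [[q' [p' [q'm p'q' /rcons_inj[-> ->]]]]//|[qm pq]].
by exists q, p.
Qed.

Lemma mem_pathsS m q : q \in paths m.+1 ->
  exists q' p, [/\ q = rcons q' p, q' \in paths m & p \in clocks q'].
Proof. by move=> /allpairsPdep[q' [p [q'm pq ->]]]; exists q', p. Qed.

Lemma size_paths m q : q \in paths m -> size q = m.
Proof.
elim: m q => [|m IH] q; first by rewrite inE => /eqP ->.
by move=> /mem_pathsS[q' [p [-> /IH <- _]]]; rewrite size_rcons.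
Qed.

Lemma last_vertex_paths m q : q \in paths m -> (last_vertex q <= m)%N.
Proof.
elim: m q => [|m IH] q; first by rewrite inE => /eqP ->.
move=> /mem_pathsS[q' [p [-> /IH q'm _]]]; rewrite last_vertex_rcons.
by case: p.2; rewrite ?addn1 ?addn0 // ltnW.
Qed.

Lemma edge_paths m q : q \in paths m ->
  [/\ symmetric (edge q), irreflexive (edge q) &
      forall x y, edge q x y -> (x <= last_vertex q)%N].
Proof.
elim: m q => [|m IH] q; first by rewrite inE => /eqP ->.
move=> /mem_pathsS[q' [[v c] [-> /IH[sq iq bq] vq]]].
move: vq; rewrite mem_clocks/= => vq.
rewrite last_vertex_rcons /edge graph_of_rcons /graph_step/= -/(edge q') -/(last_vertex q').
case: c => /=; last first.
  split=> [x y|x|x y]; rewrite /delete_adj.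
  - by rewrite sq andbCA.
  - by rewrite iq !andbF.
  - by move=> /and3P[_ _ /bq]; rewrite addn0.
have nb x : edge q' (last_vertex q').+1 x = false.
  by apply/negP => /bq; rewrite ltnn.
split=> [x y|x|x y]; rewrite /duplicate_adj.
- rewrite sq; congr (_ || _); rewrite orbC; congr (_ || _); congr (_ && _).
- rewrite iq /=; apply/negP => /orP[] /andP[/eqP -> /orP[/eqP xv|]].
  + by move: vq; rewrite -xv ltnn.
  + by rewrite sq nb.
  + by move: vq; rewrite -xv ltnn.
  + by rewrite sq nb.
- rewrite addn1 => /or3P[/bq /leqW //|/andP[/eqP ->]//|/andP[_ /orP[/eqP ->|]]].
    exact: leqW.
  by rewrite sq => /bq /leqW.
Qed.

Lemma count_neq_uniq (T : eqType) (a : pred T) (v : T) (s : seq T) :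
  uniq s -> v \in s ->
  count (fun y => (y != v) && a y) s = (count a s - a v)%N.
Proof.
move=> us vs; have /permP pvs := perm_to_rem vs.
rewrite !pvs /= eqxx add0n addKn; apply: eq_in_count => y.
by rewrite mem_rem_uniq// inE => /andP[-> _].
Qed.

Lemma path_degree_rcons m q v c i : q \in paths m -> (v <= last_vertex q)%N ->
  (i <= last_vertex q)%N ->
  path_degree (rcons q (v, c)) i =
  if c then (path_degree q i + ((v == i) || edge q i v))%N
  else if v == i then 0%N else (path_degree q i - edge q i v)%N.
Proof.
move=> qm vq iq; have [sq irq bq] := edge_paths qm.
have vs : v \in iota 0 (last_vertex q).+1 by rewrite mem_iota ltnS.
have us := iota_uniq 0 (last_vertex q).+1.
rewrite /path_degree last_vertex_rcons /edge graph_of_rcons /graph_step -/(edge q) -/(last_vertex q) [(v, c).1]/= [(v, c).2]/=.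
case: c; rewrite [X in count X _]/=; last first.
  rewrite addn0 /delete_adj; have [->|vi] := eqVneq v i.
    by rewrite (@eq_count _ _ pred0) ?count_pred0// => y; rewrite eqxx.
  by rewrite -count_neq_uniq//; apply: eq_count => y; rewrite eq_sym vi.
rewrite addn1 -[(last_vertex q).+2]addn1 iotaD count_cat add0n; congr (_ + _)%N.
  apply: eq_in_count => y; rewrite mem_iota add0n ltnS => /andP[_ yq]; rewrite /duplicate_adj.
  have -> : i == (last_vertex q).+1 = false by rewrite ltn_eqF.
  have -> : y == (last_vertex q).+1 = false by rewrite ltn_eqF.
  by rewrite !andFb !orbF.
rewrite /= addn0 /duplicate_adj eqxx (ltn_eqF (_ : i < _)%N) ?ltnS//=.
have -> : edge q i (last_vertex q).+1 = false.
  by rewrite sq; apply/negP => /bq; rewrite ltnn.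
by rewrite eq_sym [edge q v i]sq.
Qed.

Lemma path_degree_edge m q i : q \in paths m -> (i <= last_vertex q)%N ->
  (path_degree q i <= last_vertex q)%N.
Proof.
move=> qm iq; have [sq irq bq] := edge_paths qm.
have is0 : i \in iota 0 (last_vertex q).+1 by rewrite mem_iota ltnS.
have us := iota_uniq 0 (last_vertex q).+1.
have <- : count (fun y => (y != i) && edge q i y) (iota 0 (last_vertex q).+1)
    = path_degree q i by rewrite count_neq_uniq// irq subn0.
apply: (@leq_trans (count (fun y => (y != i) && predT y) (iota 0 (last_vertex q).+1))).
  by apply: sub_count => y /andP[->].
by rewrite count_neq_uniq// count_predT size_iota subn1.
Qed.

(** The clocks fall into three groups: the two of [i], those of its neighbours, and those of the
    other vertices, which leave the degree of [i] unchanged. Only the size of the last group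
    involves the size of the graph, and it will cancel against the total rate. *)
Lemma sum_path_degree (R : comRingType) (a b : R) (f : nat -> R) m q i :
  q \in paths m -> (i <= last_vertex q)%N ->
  let d := path_degree q i in
  \sum_(p <- clocks q)
     (if p.2 then a else b) * f (path_degree (rcons q p) i) =
  a * f d.+1 + b * f 0%N + d%:R * (a * f d.+1 + b * f d.-1)
  + (last_vertex q - d)%:R * ((a + b) * f d).
Proof.
move=> qm iq d; have [sq irq bq] := edge_paths qm.
have is0 : i \in iota 0 (last_vertex q).+1 by rewrite mem_iota ltnS.
have us := iota_uniq 0 (last_vertex q).+1.
rewrite big_allpairs_dep.
pose F v := a * f (d + ((v == i) || edge q i v))%N +
  b * f (if v == i then 0%N else (d - edge q i v)%N).
transitivity (\sum_(v <- iota 0 (last_vertex q).+1) F v).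
  apply: eq_big_seq => v; rewrite mem_iota ltnS => vq.
  rewrite !big_cons big_nil /= addr0.
  by rewrite !(path_degree_rcons _ qm).
rewrite (bigD1_seq i) ?iota_uniq// ?mem_iota ?ltnS//.
rewrite {1}/F eqxx addn1 -[RHS]addrA; congr (_ + _).
have s1 : (\sum_(v <- iota 0 (last_vertex q).+1 | v != i) edge q i v)%N = d.
  rewrite (eq_bigr (fun v => if edge q i v then 1 else 0)%N); last first.
    by move=> v _; case: edge.
  by rewrite -big_mkcondr/= sum1_count count_neq_uniq// irq subn0.
have s2 : (\sum_(v <- iota 0 (last_vertex q).+1 | v != i) ~~ edge q i v)%N = (last_vertex q - d)%N.
  have : (\sum_(v <- iota 0 (last_vertex q).+1 | v != i)
      (edge q i v + ~~ edge q i v))%N = last_vertex q.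
    rewrite (eq_bigr (fun=> 1%N)); last by move=> v _; case: edge.
    rewrite sum1_count (@eq_count _ _ (fun y => (y != i) && predT y)); last first.
      by move=> y /=; rewrite andbT.
    by rewrite count_neq_uniq// count_predT size_iota subn1.
  rewrite big_split s1 => h; apply/eqP.
  by rewrite -(eqn_add2l d) subnKC ?(path_degree_edge qm)//; apply/eqP.
rewrite -[X in X%:R * (_ + _)]s1 -s2 !natr_sum !mulr_suml -big_split; apply: eq_bigr => v vi.
rewrite /F (negbTE vi) /=; case: edge; rewrite /= ?addn1 ?addn0 ?subn0 ?subn1.
  by rewrite mul1r mul0r addr0.
by rewrite mul1r mul0r add0r mulrDl.
Qed.

(** This has the shape of the arg min in [next_clock], so ties are broken in the same way. It takes
    only the comparison of clocks as input, hence ring times may be replaced by residual waits,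
    which differ from them by the current time. *)
Definition choose_clock (n : nat) (t : rel (nat * bool)) : nat * bool :=
  let p := odflt (ord0, true)
    [pick i : 'I_n.+1 * bool |
      [forall j : 'I_n.+1 * bool, t (val i.1, i.2) (val j.1, j.2)]] in
  (val p.1, p.2).

Lemma choose_clock_le n t : ((choose_clock n t).1 <= n)%N.
Proof. by rewrite /choose_clock /= -ltnS. Qed.

Lemma eq_choose_clock n t t' :
  (forall a b, (a.1 <= n)%N -> (b.1 <= n)%N -> t a b = t' a b) ->
  choose_clock n t = choose_clock n t'.
Proof.
move=> tt'; rewrite /choose_clock (@eq_pick _ _ (fun i : 'I_n.+1 * bool =>
  [forall j : 'I_n.+1 * bool, t' (val i.1, i.2) (val j.1, j.2)]))// => i /=.
by apply: eq_forallb => j; apply: tt'; rewrite /= -ltnS.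
Qed.

Section choose_clock_min.
Context (R : realType) (n : nat) (F : nat * bool -> R).
Let t : rel (nat * bool) := fun a b => F a <= F b.

Lemma choose_clock_min b : (b.1 <= n)%N -> F (choose_clock n t) <= F b.
Proof.
move=> bn; rewrite /choose_clock; case: pickP => /= [i /forallP /=|].
  by move=> /(_ (Ordinal (bn : (b.1 < n.+1)%N), b.2))/=; rewrite -surjective_pairing.
have [i _ imin] := @arg_minP _ _ _ (ord0 : 'I_n.+1, true) predT
  (fun i => F (val i.1, i.2)) isT.
by move=> /(_ i) /negP[]; apply/forallP => j; exact: imin.
Qed.

Lemma choose_clock_lt p : (p.1 <= n)%N ->
  (forall b, (b.1 <= n)%N -> b != p -> F p < F b) -> choose_clock n t = p.
Proof.
move=> pn pmin; apply/eqP/negPn/negP => np.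
have := pmin _ (choose_clock_le n t) np.
by rewrite ltNge choose_clock_min.
Qed.

End choose_clock_min.

(** The choice factors through the finite table of all comparisons, so the event is a finite union
    of finite intersections. *)
Lemma measurable_choose_clock d (T : measurableType d) n
    (t : T -> rel (nat * bool)) p :
  (forall a b, measurable [set x | t x a b]) ->
  measurable [set x | choose_clock n (t x) = p].
Proof.
move=> mt.
pose I : finType := ('I_n.+1 * bool)%type.
pose c (a : I) : nat * bool := (val a.1, a.2).
pose tab x : {ffun I * I -> bool} := [ffun ab => t x (c ab.1) (c ab.2)].
pose ch (u : {ffun I * I -> bool}) : nat * bool :=
  c (odflt (ord0, true) [pick i | [forall j, u (i, j)]]).
have chE x : choose_clock n (t x) = ch (tab x).
  rewrite /choose_clock /ch (@eq_pick _ _ (fun i => [forall j, tab x (i, j)]))// => i /=.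
  by apply: eq_forallb => j; rewrite ffunE.
rewrite (_ : [set x | _] = \bigcup_(u in [set u | ch u = p])
   \bigcap_(ab in [set: I * I]) [set x | t x (c ab.1) (c ab.2) = u ab]).
  apply: fin_bigcup_measurable; first exact: finite_finset.
  move=> u _; apply: fin_bigcap_measurable; first exact: finite_finset.
  move=> ab _; case: (u ab); first exact: mt.
  rewrite (_ : [set x | _] = ~` [set x | t x (c ab.1) (c ab.2)]).
    exact/measurableC/mt.
  by apply/seteqP; split => x /=; [move=> ->|move/negP/negbTE].
apply/seteqP; split => x /=.
  by rewrite chE => <-; exists (tab x) => // ab _ /=; rewrite ffunE.
move=> [u /= <- xu]; rewrite chE; congr ch; apply/ffunP => ab.
by rewrite ffunE; exact: xu.
Qed.

(** * Residual waiting times along a history *)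

Section residual_clocks.
Context (R : realType).
Implicit Types (w : waits R) (q : seq (nat * bool)) (p : nat * bool)
  (u : nat * bool * nat) (W : nat * bool * nat -> R).

(* After a ring of clock [p], the wait number [j] of the restarted process is
   the wait number [unshift p _] of the process before the ring; the current
   waits of the clocks of the vertices [0, ..., n] lose the elapsed time. *)
Definition unshift p u : nat * bool * nat :=
  if u.1 == p then (u.1, u.2.+1) else u.

Definition is_current (n : nat) u : bool := (u.2 == 0%N) && (u.1.1 <= n)%N.

Definition restart (n : nat) W p : nat * bool * nat -> R := fun u =>
  W (unshift p u) - (if is_current n (unshift p u) then W (p, 0%N) else 0).

(** The three components are the newest vertex, the residual waits and the time of the last ring.
    The list [q] is prescribed: these are fixed combinations of the waits, and they describe the
    process only where [q] is the history that occurs. *)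
Definition run w q : nat * (nat * bool * nat -> R) * R :=
  foldl (fun a p => ((a.1.1 + p.2)%N, restart a.1.1 a.1.2 p, a.2 + a.1.2 (p, 0%N)))
    (0%N, fun u => w u.1.1 u.1.2 u.2, 0) q.

Definition residual w q := (run w q).1.2.

Definition ring_time w q : R := (run w q).2.

Lemma run_rcons w q p :
  run w (rcons q p) = (((run w q).1.1 + p.2)%N,
    restart (run w q).1.1 (run w q).1.2 p, (run w q).2 + (run w q).1.2 (p, 0%N)).
Proof. by rewrite /run foldl_rcons. Qed.

Lemma run_last_vertex w q : (run w q).1.1 = last_vertex q.
Proof.
elim/last_ind: q => // q p IH.
by rewrite run_rcons /= IH last_vertex_rcons.
Qed.

Lemma residual_rcons w q p u : residual w (rcons q p) u =
  residual w q (unshift p u) -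
  (if is_current (last_vertex q) (unshift p u) then residual w q (p, 0%N) else 0).
Proof. by rewrite /residual run_rcons /= /restart run_last_vertex. Qed.

Lemma ring_time_rcons w q p :
  ring_time w (rcons q p) = ring_time w q + residual w q (p, 0%N).
Proof. by rewrite /ring_time run_rcons. Qed.

Fixpoint choices w (m : nat) : seq (nat * bool) :=
  if m is m'.+1 then
    rcons (choices w m') (choose_clock (last_vertex (choices w m'))
      (fun a b => residual w (choices w m') (a, 0%N) <=
                  residual w (choices w m') (b, 0%N)))
  else [::].

Lemma choices_paths w m : choices w m \in paths m.
Proof.
elim: m => // m IH; rewrite [choices _ _]/= mem_paths_rcons IH/=.
by rewrite mem_clocks choose_clock_le.
Qed.

Lemma next_clockE w (s : state R) :
  (val (next_clock w s).1, (next_clock w s).2) =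
  choose_clock (newest s) (fun a b => next_ring w s a.1 a.2 <= next_ring w s b.1 b.2).
Proof.
rewrite /choose_clock.
suff -> : next_clock w s = odflt (ord0, duplication) [pick i : 'I_(newest s).+1 * bool |
   [forall j : 'I_(newest s).+1 * bool, next_ring w s (val i.1) i.2 <= next_ring w s (val j.1) j.2]] by [].
rewrite /next_clock /Order.arg_min /extremum; congr (odflt _ _).
Qed.

(** The first clause is the one used later; the other three carry the induction. Residuals are the
    waits of the chain seen from the current time, future waits are untouched, and the clocks of
    unborn vertices are fresh, which is what the next birth requires. *)
Lemma chain_choices w m : let s := chain w m in let q := choices w m in
  [/\ newest s = last_vertex q, adj s = edge q & time s = ring_time w q] /\
  [/\ forall v c, (v <= last_vertex q)%N ->
         next_ring w s v c = time s + residual w q ((v, c), 0%N),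
      forall v c j, residual w q ((v, c), j.+1) = w v c (rings s v c + j.+1)%N &
      forall v c, (last_vertex q < v)%N ->
        rings s v c = 0%N /\ residual w q ((v, c), 0%N) = w v c 0%N].
Proof.
elim: m => [|m].
  split; split => //.
  - by move=> v c _; rewrite /next_ring /= big_nat1.
move=> /=; set s := chain w m; set q := choices w m.
move=> [[ns es ts] [ih1 ih2 ih3]].
have : (val (next_clock w s).1, (next_clock w s).2) =
   choose_clock (last_vertex q) (fun a b => residual w q (a, 0%N) <= residual w q (b, 0%N)).
  rewrite next_clockE ns; apply: eq_choose_clock => -[a1 a2] [b1 b2] /= aq bq.
  by rewrite !ih1// lerD2l.
have : (val (next_clock w s).1 <= last_vertex q)%N by rewrite -ns -ltnS; exact: ltn_ord.
rewrite /step; case: (next_clock w s) => -[v' v'lt] c' /= v'q <-.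
move: v' {v'lt} v'q => v0 v0q.
rewrite last_vertex_rcons ring_time_rcons /edge graph_of_rcons /graph_step -/(edge q) -/(last_vertex q).
set p := (v0, c'); set r' := fun x b => if _ then _ else _.
have tE : next_ring w s v0 c' = time s + residual w q (p, 0%N) by exact: ih1.
set s' := if _ then _ else _.
have ns' : newest s' = (last_vertex q + c')%N.
  by rewrite /s' ns; case: (c'); rewrite /= ?addn1 ?addn0.
have ts' : time s' = next_ring w s v0 c' by rewrite /s'; case: ifP.
have rs' : rings s' = r' by rewrite /s'; case: ifP.
have bs' v : (v <= last_vertex q)%N -> birth s' v = birth s v.
  by move=> vq; rewrite /s'; case: ifP => //= _; rewrite ns ltn_eqF.
have resp j : residual w (rcons q p) (p, j) = residual w q (p, j.+1).
  by rewrite residual_rcons /unshift eqxx /is_current /= subr0.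
have resN a j : a != p -> residual w (rcons q p) (a, j) = residual w q (a, j) -
    (if is_current (last_vertex q) (a, j) then residual w q (p, 0%N) else 0).
  by move=> ap; rewrite residual_rcons /unshift (negbTE ap).
split.
  split; rewrite ?ns' ?ts' ?tE ?ts//.
  by rewrite /s' /p ns; case: (c'); rewrite /= es.
split.
- move=> v c vle; have [vcp|vcp] := eqVneq (v, c) p.
    rewrite ts' vcp resp; move: vcp; rewrite /p => -[-> ->].
    rewrite /next_ring rs' /r' !eqxx/= bs'// big_nat_recr//= addrA.
    by rewrite ih2 addn1.
  rewrite resN// ts' tE /is_current/=.
  have rE : rings s' v c = rings s v c.
    by rewrite rs' /r'; move: vcp; rewrite /p xpair_eqE; case: ifP => // ->.
  case: leqP => vq.
    rewrite /next_ring rE bs'// -/(next_ring w s v c) ih1//; ring.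
  (* Here [v] is the vertex just born, so the ring was a duplication and the birth time of [v] is
     the time of this ring. *)
  have c't : c' = true.
    by move: vle; rewrite /p; case: (c') => //=; rewrite addn0 leqNgt vq.
  have vE : v = (last_vertex q).+1.
    by apply/eqP; rewrite eqn_leq vq andbT; move: vle; rewrite /p c't addn1.
  have [r0 ->] := ih3 v c vq.
  rewrite /next_ring rE r0 big_nat1 subr0 -tE; congr (_ + _).
  by rewrite /s' ifT ?c't//= ns vE eqxx.
- move=> v c j; have [vcp|vcp] := eqVneq (v, c) p.
    rewrite vcp resp; move: vcp; rewrite /p => -[-> ->].
    by rewrite ih2 rs' /r' !eqxx /= addSnnS.
  rewrite resN// /is_current/= subr0 ih2; congr (w _ _ (_ + _)%N).
  by rewrite rs' /r'; move: vcp; rewrite /p xpair_eqE; case: ifP => // ->.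
- move=> v c vq.
  have vq' : (last_vertex q < v)%N by rewrite (leq_ltn_trans _ vq)// leq_addr.
  have vcp : (v, c) != p.
    by apply/eqP => -[vv0]; move: vq'; rewrite vv0 ltnNge v0q.
  rewrite resN// /is_current /= leqNgt vq' subr0; have [r0 ->] := ih3 v c vq'.
  by rewrite rs' /r'; move: vcp; rewrite /p xpair_eqE => /negbTE ->.
Qed.

End residual_clocks.

(** * Memorylessness along a history *)

Lemma ge0_integral_law_scale d (T : measurableType d) (R : realType)
    (P : probability T R) d' (Y : measurableType d') (E1 E2 : set T)
    (Z : T -> Y) (c : R) :
  0 <= c -> measurable E1 -> measurable E2 -> measurable_fun setT Z ->
  (forall B, measurable B ->
    P (E1 `&` Z @^-1` B) = P (E2 `&` Z @^-1` B) * c%:E)%E ->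
  forall f : Y -> \bar R, measurable_fun setT f -> (forall y, 0 <= f y)%E ->
  (\int[P]_(x in E1) f (Z x) = c%:E * \int[P]_(x in E2) f (Z x))%E.
Proof.
move=> c0 mE1 mE2 mZ PE f mf f0.
rewrite -(ge0_integral_law_on P mE1 mZ)// -(ge0_integral_law_on P mE2 mZ)//.
rewrite (_ : c = (NngNum c0)%:num)// -ge0_integral_mscale//.
apply: eq_measure_integral => B mB _.
transitivity (c%:E * P (Z @^-1` B `&` E2))%E => //.
by rewrite muleC setIC -PE// setIC.
Qed.

Arguments clocks : simpl never.

Lemma measurable_integral_exponential (R : realType) d (Y : measurableType d)
    (r : R) (f : Y * measurableTypeR R -> \bar R) : 0 < r ->
  measurable_fun setT f -> (forall z, 0 <= f z)%E ->
  measurable_fun setT (fun y => \int[lebesgue_measure]_(s in `[0%R, +oo[)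
    (f (y, s) * (r * expR (- r * s))%:E))%E.
Proof.
move=> r0 mf f0.
rewrite (_ : (fun y => _) = fubini_F (exp_measure r0) f).
  exact: measurable_fun_fubini_tonelli_F.
apply/funext => y; rewrite /fubini_F integral_exponential//.
exact: measurableT_comp.
Qed.

Section clocks_process.
Context d (T : measurableType d) (R : realType) (P : probability T R).
Variables (theta : R) (X : nat -> bool -> nat -> {RV P >-> R}).

Let w (x : T) : waits R := fun v c j => X v c j x.

Definition path_event (q : seq (nat * bool)) : set T :=
  [set x | choices (w x) (size q) = q].

Lemma measurable_run q : measurable_fun setT (fun x => ring_time (w x) q) /\
  (forall u, measurable_fun setT (fun x => residual (w x) q u)).
Proof.
elim/last_ind: q => [|q p [IHt IHr]].
  split; first exact: measurable_cst.
  move=> u; rewrite (_ : (fun x => _) = X u.1.1 u.1.2 u.2)//.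
split.
  under eq_fun do rewrite ring_time_rcons; exact: measurable_funD.
move=> u; under eq_fun do rewrite residual_rcons.
by case: is_current; apply: measurable_funB; try exact: IHr; exact: measurable_cst.
Qed.

Lemma path_event_rcons q p : path_event (rcons q p) = path_event q `&`
  [set x | choose_clock (last_vertex q) (fun a b =>
     residual (w x) q (a, 0%N) <= residual (w x) q (b, 0%N)) = p].
Proof.
apply/seteqP; split => x; rewrite /path_event /= size_rcons /=.
  by move=> /rcons_inj[-> ?].
by move=> [-> ->].
Qed.

Lemma measurable_path_event q : measurable (path_event q).
Proof.
elim/last_ind: q => [|q p IH].
  by rewrite (_ : path_event _ = setT)//; apply/seteqP; split.
rewrite path_event_rcons; apply: measurableI => //.
apply: measurable_choose_clock => a b.
have [_ mr] := measurable_run q.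
exact: measurable_ler_set (mr _) (mr _).
Qed.

Definition rate (c : bool) : R := if c then theta else 1 - theta.

Implicit Type J : seq (nat * bool * nat * R).

(** The exponent for which exp (- [cost J]) is the probability that independent exponential
    variables exceed all the thresholds of [J]. *)
Definition cost J : R := \sum_(uh <- J) rate uh.1.1.2 * uh.2.

Definition exceed q J : set T :=
  [set x | all (fun uh => uh.2 < residual (w x) q uh.1) J].

Lemma exceed_cons q u h J : exceed q ((u, h) :: J) =
  [set x | h < residual (w x) q u] `&` exceed q J.
Proof. by apply/seteqP; split => x /=; [move/andP|move=> [? ?]; apply/andP]. Qed.

Lemma measurable_exceed q J : measurable (exceed q J).
Proof.
elim: J => [|[u h] J IH].
  by rewrite (_ : exceed _ _ = setT)//; apply/seteqP; split.
rewrite exceed_cons; apply: measurableI => //.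
have [_ mr] := measurable_run q.
exact: (measurable_ltr_set (f := cst h)).
Qed.

(* J is a list of pairs (waiting time, threshold). Given that the history is q,
   the residual waiting times are independent exponentials, jointly independent
   of the current ring time. *)
Definition memoryless q := forall (B : set R) J, measurable B ->
  uniq (map fst J) -> all (fun uh => 0 <= uh.2) J ->
  P (path_event q `&` exceed q J `&` (fun x => ring_time (w x) q) @^-1` B) =
  (P (path_event q `&` (fun x => ring_time (w x) q) @^-1` B) *
   (expR (- cost J))%:E)%E.

Hypothesis htheta : 0 < theta < 1.
Hypothesis hX : poisson_clocks theta X.

Let rate_gt0 c : 0 < rate c.
Proof. by move/andP: htheta => [t0 t1]; rewrite /rate; case: c; rewrite ?subr_gt0. Qed.

(** At the start the residuals are the waits themselves, so independence gives a product of
    exponential tails. The ring time is the constant 0, so the condition on [B] is either sure or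
    impossible. *)
Lemma memoryless_nil : memoryless [::].
Proof.
move=> B J mB uJ J0.
have -> : path_event [::] = setT by apply/seteqP; split.
rewrite !setTI.
have exJ : P (exceed [::] J) = (expR (- cost J))%:E.
  have [hd hI] := hX.
  (* Turns the list of thresholds into a function of the wait; it is well defined because no wait
     occurs twice in [J]. *)
  pose h u := (nth (u, 0) J (index u (map fst J))).2.
  have hE uh : uh \in J -> h uh.1 = uh.2.
    move=> uhJ; rewrite /h => {h B mB hd hI J0}; move: uJ; elim: J uhJ => //= -[u0 h0] J IH.
    rewrite inE => /orP[/eqP -> /=|uhJ /andP[u0J uJ]]; first by rewrite eqxx.
    rewrite ifN ?IH//; apply: contraNneq u0J => ->; exact: map_f.
  have -> : exceed [::] J = \bigcap_(u in [set` map fst J]) (X u.1.1 u.1.2 u.2) @^-1` `]h u, +oo[%classic.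
    apply/seteqP; split => x /=.
      move=> /allP xJ u /= /mapP[uh uhJ ->]; rewrite in_itv/= andbT hE//.
      exact: xJ.
    move=> xJ; apply/allP => uh uhJ; have /= := xJ uh.1 (map_f fst uhJ).
    by rewrite in_itv/= andbT hE.
  rewrite (hI (map fst J) (fun u => `]h u, +oo[%classic))// big_map.
  transitivity (\prod_(uh <- J) (expR (- (rate uh.1.1.2 * uh.2)))%:E)%E.
    apply: eq_big_seq => uh uhJ; rewrite hE//.
    have := hd uh.1.1.1 uh.1.1.2 uh.1.2 `]uh.2, +oo[%classic (measurable_itv _).
    rewrite /distribution /pushforward /= => ->.
    rewrite eqb_id -/(rate uh.1.1.2) exponential_prob_ray// mulNr max_l//.
    exact: (allP J0).
  rewrite prodEFin /cost -sumrN -expR_sum//.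
have [Bt|Bt] := pselect (B 0).
  rewrite (_ : _ @^-1` B = setT) ?setIT ?probability_setT ?mul1e//.
  by apply/seteqP; split.
rewrite (_ : _ @^-1` B = set0) ?setI0 ?measure0 ?mul0e//.
by apply/seteqP; split.
Qed.

Lemma sum_rate_clocks q :
  \sum_(b <- clocks q) rate b.2 = (last_vertex q).+1%:R.
Proof.
rewrite big_allpairs_dep (eq_bigr (fun=> 1)).
  by rewrite big_const_seq count_predT size_iota iter_addr_0.
by move=> v _; rewrite !big_cons big_nil /= addr0 /rate addrC subrK.
Qed.

(** * The race between the running clocks after a given history *)

Section one_step.
Variables (q : seq (nat * bool)) (p : nat * bool).
Hypothesis pq : p \in clocks q.
Hypothesis Hq : memoryless q.

Let n := last_vertex q.
Let tau x := ring_time (w x) q.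
Let S x := residual (w x) q (p, 0%N).

(* Thresholds at the current ring time which express that the thresholds J are
   exceeded after a further delay s: only running clocks lose the delay. *)
Definition raise s J : seq (nat * bool * nat * R) :=
  [seq (uh.1, uh.2 + (if is_current n uh.1 then s else 0)) | uh <- J].

(** Thresholds fit for a race won by [p]: every rival clock has one, while the current wait of [p]
    has none, so that it stays free to be the delay of the next ring. *)
Definition covers J := [/\ uniq (map fst J), all (fun uh => 0 <= uh.2) J,
  (p, 0%N) \notin map fst J &
  forall b, b \in clocks q -> b != p -> (b, 0%N) \in map fst J].

Variable J : seq (nat * bool * nat * R).
Hypothesis cJ : covers J.

(** The total rate of the rivals of [p]. *)
Let rho := n.+1%:R - rate p.2.

Let sum_current :
  \sum_(uh <- J | is_current n uh.1) rate uh.1.1.2 = rho.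
Proof.
have [uJ J0 pJ Jc] := cJ.
rewrite -(big_map fst (is_current n) (fun u => rate u.1.2)) -big_filter.
rewrite (perm_big [seq (b, 0%N) | b <- rem p (clocks q)]); last first.
  apply: uniq_perm; first exact: filter_uniq.
    by rewrite map_inj_uniq ?rem_uniq ?clocks_uniq// => ? ? [].
  move: (rem p (clocks q)) (mem_rem_uniq p (clocks_uniq q)) => cs cse.
  move=> -[b j]; rewrite mem_filter /is_current /=.
  apply/idP/mapP => [/andP[/andP[/eqP -> bn] bJ]|[b']].
    exists b => //; rewrite cse inE mem_clocks bn andbT.
    by apply: contraNneq pJ => <-.
  rewrite cse inE => /andP[b'p b'q] [-> ->].
  by rewrite eqxx Jc// andbT; move: b'q; rewrite mem_clocks.
rewrite big_map /=; have /permP := perm_to_rem pq.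
have := sum_rate_clocks q; rewrite (perm_big _ (perm_to_rem pq)) big_cons /rho.
by move=> <- _; rewrite addrC addKr.
Qed.

Let cost_raise s : cost (raise s J) = cost J + rho * s.
Proof.
rewrite /cost big_map /= -sum_current mulr_suml [X in _ + X]big_mkcond -big_split.
by apply: eq_bigr => uh _ /=; case: ifP => _; rewrite ?addr0 ?mulrDr.
Qed.

Let L := [seq uh <- J | is_current n uh.1].

Let margin x (uh : nat * bool * nat * R) := residual (w x) q uh.1 - uh.2.

(** The least margin among the running clocks of [J], that is, the longest delay for which they all
    stay above their thresholds. The margin of the head of [L] only initialises the minimum. *)
Let M x : R := foldr (fun uh acc => Num.min (margin x uh) acc)
  (margin x (head ((p, 0%N), 0) L)) L.

Let M_gt s x : (s < M x) = all (fun uh => s < margin x uh) L.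
Proof.
have : L != [::].
  have [uJ J0 pJ Jc] := cJ.
  (* The other clock of the same vertex always runs, so [p] has at least one rival. *)
  have : ((p.1, ~~ p.2), 0%N) \in map fst J.
    apply: Jc; first by move: pq; rewrite !mem_clocks.
    by case: (p) => ? [] /=; rewrite xpair_eqE andbF.
  move=> /mapP[uh uhJ uhE].
  have : uh \in L.
    rewrite mem_filter uhJ andbT -uhE /is_current/=.
    by move: pq; rewrite mem_clocks.
  by case: L.
rewrite /M; case: L => // a0 L' _ /=.
rewrite lt_min; case: ltP => //= sa0; elim: L' => [|a L' IH] /=; first by rewrite sa0.
by rewrite lt_min IH.
Qed.

Let mM : measurable_fun setT M.
Proof.
rewrite /M; move: (head _ _) => a0; have [_ mr] := measurable_run q.
have mm uh : measurable_fun setT (margin ^~ uh).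
  by apply: measurable_funB => //; exact: mr.
elim: L => [|a L' IH] /=; first exact: mm.
by apply: measurable_minr.
Qed.

Let exceed_raise s x : 0 <= s ->
  exceed q (raise s J) x <-> exceed q J x /\ s < M x.
Proof.
move=> s0; rewrite M_gt /exceed /= all_map; split.
  move=> /allP xJ; split; last first.
    apply/allP => uh; rewrite mem_filter => /andP[cu uhJ].
    by have := xJ _ uhJ; rewrite /= cu /margin ltrBrDl.
  apply/allP => uh uhJ; have /= := xJ _ uhJ; apply: le_lt_trans.
  by rewrite lerDl; case: ifP.
move=> [/allP xJ /allP xM]; apply/allP => uh uhJ /=; case: ifP => cu.
  by have := xM uh; rewrite mem_filter cu uhJ => /(_ isT); rewrite /margin ltrBrDl.
by rewrite addr0; exact: xJ.
Qed.

Let mtau : measurable_fun setT (tau : T -> measurableTypeR R).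
Proof. by have [] := measurable_run q. Qed.

Let mS : measurable_fun setT (S : T -> measurableTypeR R).
Proof. by have [_] := measurable_run q; apply. Qed.

Let mtS : measurable_fun setT
  (fun x => (tau x, S x) : (measurableTypeR R * measurableTypeR R)%type).
Proof. exact/measurable_fun_pairP. Qed.

(** Adding a threshold s for [p] itself to [J1] multiplies the probability by exp (- [rate p.2] s).
    Hence [S] is exponential, independent of the ring time and of the event [exceed q J1]. *)
Let integral_path J1 (f : measurableTypeR R * measurableTypeR R -> \bar R) :
  uniq (map fst J1) -> all (fun uh => 0 <= uh.2) J1 ->
  (p, 0%N) \notin map fst J1 ->
  measurable_fun setT f -> (forall z, 0 <= f z)%E ->
  (\int[P]_(x in path_event q `&` exceed q J1) f (tau x, S x) =
   (expR (- cost J1))%:E *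
   \int[P]_(x in path_event q) \int[lebesgue_measure]_(s in `[0%R, +oo[)
     (f (tau x, s) * (rate p.2 * expR (- rate p.2 * s))%:E))%E.
Proof.
move=> uJ1 J10 pJ1 mf f0.
rewrite (@integral_indep_exponential _ _ _ P _ _ _ tau S (rate p.2))//; first last.
- move=> B s mB s0.
  have /= := @Hq B (((p, 0%N), s) :: J1) mB.
  rewrite pJ1 uJ1 s0 J10 => /(_ isT isT).
  rewrite exceed_cons /cost big_cons/= opprD expRD EFinM muleA -/(cost J1).
  have /= := @Hq B J1 mB uJ1 J10.
  rewrite muleAC => <-; rewrite mulNr => <-; congr (P _).
  by apply/seteqP; split => x /=; rewrite /setI/=; tauto.
- by apply: measurableI; [exact: measurable_path_event|exact: measurable_exceed].
rewrite (@ge0_integral_law_scale _ _ _ P _ _ _ (path_event q) tau (expR (- cost J1))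
  (expR_ge0 _) _ _ _ _ (fun t => \int[lebesgue_measure]_(s in `[0%R, +oo[)
     (f (t, s) * (rate p.2 * expR (- rate p.2 * s))%:E))%E)//.
- by apply: measurableI; [exact: measurable_path_event|exact: measurable_exceed].
- exact: measurable_path_event.
- by move=> B mB; exact: Hq.
- exact: measurable_integral_exponential.
- move=> t; apply: integral_ge0 => s; rewrite /= in_itv/= andbT => s0.
  by rewrite mule_ge0// lee_fin mulr_ge0 ?expR_ge0// ltW.
Qed.

Let raise_path s : uniq (map fst (raise s J)) /\ ((p, 0%N) \notin map fst (raise s J)).
Proof.
have [uJ J0 pJ Jc] := cJ.
by rewrite /raise -map_comp (eq_map (g := fst)).
Qed.

(** Given [exceed q J], the event s < [M] is [exceed] for the raised thresholds, whose cost is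
    larger by [rho] s. So [M] is exponential of rate [rho] and independent of [(tau, S)]. *)
Let margin_tail (B : set (measurableTypeR R * measurableTypeR R)%type) s :
  measurable B -> 0 <= s ->
  P (path_event q `&` exceed q J `&` (fun x => (tau x, S x)) @^-1` B `&` [set x | s < M x]) =
  (P (path_event q `&` exceed q J `&` (fun x => (tau x, S x)) @^-1` B) *
    (expR (- rho * s))%:E)%E.
Proof.
move=> mB s0; have [uJ J0 pJ Jc] := cJ.
have indE J1 : uniq (map fst J1) -> all (fun uh => 0 <= uh.2) J1 ->
    (p, 0%N) \notin map fst J1 ->
    P (path_event q `&` exceed q J1 `&` (fun x => (tau x, S x)) @^-1` B) =
    ((expR (- cost J1))%:E * \int[P]_(x in path_event q)
      \int[lebesgue_measure]_(s in `[0%R, +oo[)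
     ((\1_B (tau x, s))%:E * (rate p.2 * expR (- rate p.2 * s))%:E))%E.
  move=> uJ1 J10 pJ1; rewrite -(@integral_path J1 (EFin \o \1_B))//; last 2 first.
  - exact/measurable_EFinP/measurable_indic.
  - by move=> z; rewrite lee_fin.
  rewrite (eq_integral (fun x => (\1_((fun x => (tau x, S x)) @^-1` B) x)%:E))//.
  rewrite integral_indic//.
  - by rewrite setIC.
  - by apply: measurableI; [exact: measurable_path_event|exact: measurable_exceed].
  - exact: measurable_preimage.
have [ur pr] := raise_path s.
rewrite [in RHS]indE// muleAC -EFinM -expRD.
have -> : - cost J + - rho * s = - cost (raise s J).
  by rewrite cost_raise mulNr -opprD.
rewrite -indE//; last first.
  rewrite /raise all_map; apply/allP => uh uhJ /=.
  by rewrite addr_ge0// ?(allP J0)//; case: ifP.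
congr (P _); apply/seteqP; split => x /=.
  by move=> [[[qx xJ] xB] sM]; split => //; split => //; exact/exceed_raise.
by move=> [[qx /(exceed_raise _ s0)[]]].
Qed.

Definition wins : set T :=
  [set x | [/\ path_event q x, 0 < S x & exceed q (raise (S x) J) x]].

Lemma measurable_wins : measurable wins.
Proof.
rewrite (_ : wins = path_event q `&` exceed q J `&` [set x | 0 < S x] `&` [set x | S x < M x]).
  have m1 : measurable [set x | 0 < S x].
    exact: (measurable_ltr_set (f := cst 0)).
  have m2 : measurable [set x | S x < M x].
    exact: measurable_ltr_set.
  apply: measurableI => //; apply: measurableI => //.
  by apply: measurableI; [exact: measurable_path_event|exact: measurable_exceed].
apply/seteqP; split => x /=.
  by move=> [qx Sx /(exceed_raise _ (ltW Sx))[]].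
by move=> [[[qx Jx] Sx] SM]; split => //; apply/(exceed_raise _ (ltW Sx)).
Qed.

(** Given [S], the rivals hold out long enough with probability exp (- [rho] S). Against the density
    of [S], of rate [rate p.2], the two exponents add up to the total rate, which is the number of
    vertices. *)
Lemma integral_wins (Phi : measurableTypeR R * measurableTypeR R -> \bar R) :
  measurable_fun setT Phi -> (forall z, 0 <= Phi z)%E ->
  (\int[P]_(x in wins) Phi (ring_time (w x) q, residual (w x) q (p, 0%N)) =
   (expR (- cost J))%:E *
   \int[P]_(x in path_event q) \int[lebesgue_measure]_(s in `[0%R, +oo[)
     (Phi (ring_time (w x) q, s) *
      (rate p.2 * expR (- (last_vertex q).+1%:R * s))%:E))%E.
Proof.
move=> mPhi Phi0; have [uJ J0 pJ Jc] := cJ.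
have rho0 : 0 < rho.
  rewrite /rho subr_gt0 -natr1; apply: ltr_wpDl => //.
  by move/andP: htheta => [t0 t1]; rewrite /rate; case: p.2; lra.
have mE : measurable (path_event q `&` exceed q J).
  by apply: measurableI; [exact: measurable_path_event|exact: measurable_exceed].
(* The event [wins] is encoded by the indicators of 0 < [S] and [S] < [M], so that [M] and then [S]
   can be integrated out. *)
pose pos (z : measurableTypeR R * measurableTypeR R) : \bar R :=
  (\1_[set z : measurableTypeR R * measurableTypeR R | 0 < z.2] z)%:E.
pose lt2 (z : measurableTypeR R * measurableTypeR R * measurableTypeR R) : \bar R :=
  (\1_[set z : measurableTypeR R * measurableTypeR R * measurableTypeR R | z.1.2 < z.2] z)%:E.
have mpos : measurable_fun setT pos.
  apply/measurable_EFinP/measurable_indic.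
  exact: (measurable_ltr_set (f := cst 0) (g := snd)).
have mlt2 : measurable_fun setT lt2.
  apply/measurable_EFinP/measurable_indic.
  apply: (measurable_ltr_set (f := snd \o fst) (g := snd)) => //.
  exact: measurableT_comp.
have pos_gt z : 0 < z.2 -> pos z = 1%E.
  by move=> z0; rewrite /pos indicE mem_set.
have pos_le z : ~~ (0 < z.2) -> pos z = 0%E.
  by move=> /negP z0; rewrite /pos indicE memNset.
have lt2_lt z : z.1.2 < z.2 -> lt2 z = 1%E.
  by move=> z0; rewrite /lt2 indicE mem_set.
have lt2_ge z : ~~ (z.1.2 < z.2) -> lt2 z = 0%E.
  by move=> /negP z0; rewrite /lt2 indicE memNset.
have pos0 z : (0 <= pos z)%E by rewrite /pos lee_fin.
have lt20 z : (0 <= lt2 z)%E by rewrite /lt2 lee_fin.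
transitivity (\int[P]_(x in path_event q `&` exceed q J)
   (Phi (tau x, S x) * pos (tau x, S x) * lt2 (tau x, S x, M x)))%E.
  rewrite [LHS]integral_mkcond [RHS]integral_mkcond; apply: eq_integral => x _.
  rewrite !patchE; case: ifPn => [|xw].
    rewrite inE => -[qx Sx /(exceed_raise _ (ltW Sx))[Jx SM]].
    by rewrite mem_set// pos_gt// lt2_lt// !mule1.
  case: ifPn => //; rewrite inE => -[qx Jx].
  case: (boolP (0 < S x)) => Sx; last by rewrite pos_le// mule0 mul0e.
  case: (boolP (S x < M x)) => SM; last by rewrite lt2_ge// mule0.
  move: xw; rewrite notin_setE => -[]; split => //.
  by apply/(exceed_raise _ (ltW Sx)).
rewrite (@integral_indep_exponential _ _ _ P _ _ _ (fun x => (tau x, S x) : (measurableTypeR R * measurableTypeR R)%type) M rho rho0 mE mtS mM _ (fun z => Phi z.1 * pos z.1 * lt2 z)%E); last 3 first.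
- by move=> B s mB s0; exact: margin_tail.
- apply: emeasurable_funM => //; apply: (emeasurable_funM (f := Phi \o fst) (g := pos \o fst)).
    exact: measurableT_comp.
  exact: measurableT_comp.
- by move=> z; rewrite !mule_ge0.
transitivity (\int[P]_(x in path_event q `&` exceed q J)
   (Phi (tau x, S x) * pos (tau x, S x) * (expR (- rho * S x))%:E))%E.
  apply: eq_integral => x _ /=.
  have mlx : measurable [set z : measurableTypeR R | S x < z].
    by apply: (measurable_ltr_set (f := cst (S x)) (g := id)).
  rewrite -(@integral_exponential _ _ rho0 (fun s => Phi (tau x, S x) * pos (tau x, S x) * lt2 (tau x, S x, s))%E); last 2 first.
  - apply: emeasurable_funM; first exact: measurable_cst.
    by apply/measurable_EFinP/measurable_indic.
  - by move=> y; rewrite !mule_ge0.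
  rewrite ge0_integralZl//; last 2 first.
  - by apply/measurable_EFinP/measurable_indic.
  - by rewrite mule_ge0.
  rewrite (eq_integral (fun z => (\1_[set z : measurableTypeR R | S x < z] z)%:E))//.
  rewrite integral_indic// setIT.
  have -> : [set z : measurableTypeR R | S x < z] = `]S x, +oo[%classic.
    by apply/seteqP; split => z /=; rewrite in_itv/= andbT.
  transitivity (Phi (tau x, S x) * pos (tau x, S x) *
      (expR (- rho * Num.max (S x) 0))%:E)%E.
    by congr (_ * _)%E; exact: exponential_prob_ray.
  have [Sx|Sx] := leP (S x) 0; last by [].
  by rewrite pos_le -?leNgt// mule0 !mul0e.
pose F (z : measurableTypeR R * measurableTypeR R) : \bar R :=
  (Phi z * pos z * (expR (- rho * z.2))%:E)%E.
transitivity (\int[P]_(x in path_event q `&` exceed q J) F (tau x, S x))%E; first by [].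
have mF : measurable_fun setT F.
  apply: emeasurable_funM => //; first exact: emeasurable_funM.
  apply/measurable_EFinP; apply: measurableT_comp => //.
  by apply: measurable_funM => //.
have F0 z : (0 <= F z)%E by rewrite /F !mule_ge0// lee_fin expR_ge0.
rewrite (integral_path uJ J0 pJ mF F0).
apply: (congr1 (fun y => (expR (- cost J))%:E * y)%E).
apply: eq_integral => x _.
have mPx : measurable_fun setT (fun s => Phi (tau x, s)) by exact: measurableT_comp.
have mr k r : measurable_fun setT (fun s : measurableTypeR R => (r * expR (k * s))%:E).
  apply/measurable_EFinP; apply: measurable_funM => //; apply: measurableT_comp => //.
have mFx : measurable_fun setT (fun s => F (tau x, s)) by exact: measurableT_comp.
(* [pos] vanishes at delay 0, so the integrands agree only for positive delays. *)
apply: eq_integral_itvcy.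
- exact: (emeasurable_funM mFx (mr _ _)).
- exact: (emeasurable_funM mPx (mr _ _)).
move=> s s0; rewrite /F.
rewrite pos_gt// mule1 -muleA -EFinM; congr (_ * _%:E)%E.
rewrite mulrCA -expRD; congr (_ * expR _).
by rewrite /= /rho -mulrDl opprB addrAC subrr add0r.
Qed.

End one_step.

End clocks_process.

(** * From strict wins to the histories that occur *)

Lemma ge0_integral_partition d (T : measurableType d) (R : realType)
    (mu : {measure set T -> \bar R}) (A : set T) (U : eqType) (f : T -> U)
    (s : seq U) (g : T -> \bar R) :
  measurable A -> (forall b, measurable (A `&` [set x | f x = b])) ->
  (forall x, A x -> f x \in s) -> uniq s ->
  measurable_fun setT g -> (forall x, 0 <= g x)%E ->
  (\int[mu]_(x in A) g x = \sum_(b <- s) \int[mu]_(x in A `&` [set x | f x = b]) g x)%E.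
Proof.
move=> mA mf As us mg g0; elim: s A us mA mf As => [|b s IH] A.
  move=> _ mA mf As; rewrite big_nil (_ : A = set0) ?integral_set0//.
  by apply/seteqP; split => x // /As.
move=> /= /andP[bs us] mA mf As; rewrite big_cons.
have mAb : measurable (A `\` [set x | f x = b]).
  rewrite (_ : _ `\` _ = A `\` (A `&` [set x | f x = b])); first exact: measurableD.
  by apply/seteqP; split => x /= [Ax h]; split => //; [case|move=> fx; apply: h].
rewrite -{1}(setUIDK A [set x | f x = b]) ge0_integral_setU//; last 2 first.
- exact: measurable_funTS.
- by apply/disj_setPS => x [/= [_ fx] [_ /(_ fx)]].
apply: (congr1 (fun y => (_ + y)%E)).
rewrite IH//.
- apply: eq_big_seq => c cs; apply: (congr1 (fun D => \int[mu]_(x in D) g x)%E).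
  apply/seteqP; split => x /= [Ax fx]; first by case: Ax.
  by split => //; split => //; rewrite fx => cb; move: bs; rewrite -cb cs.
- move=> c; rewrite (_ : _ `&` _ = (A `&` [set x | f x = c]) `\` (A `&` [set x | f x = b])).
    exact: measurableD.
  apply/seteqP; split => x /=; first by move=> [[Ax h] fx]; split => // -[].
  by move=> [[Ax fx] h]; split => //; split => // fb; apply: h.
- by move=> x [/As + /= fxb]; rewrite inE => /orP[/eqP//|].
Qed.

Lemma ge0_integral_null_diff d (T : measurableType d) (R : realType)
    (mu : {measure set T -> \bar R}) (A B : set T) (g : T -> \bar R) :
  measurable A -> measurable B -> A `<=` B -> mu (B `\` A) = 0%E ->
  measurable_fun setT g -> (forall x, 0 <= g x)%E ->
  (\int[mu]_(x in B) g x = \int[mu]_(x in A) g x)%E.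
Proof.
move=> mA mB AB BA0 mg g0; rewrite -{1}(setDUK AB) ge0_integral_setU//; last 3 first.
- exact: measurableD.
- exact: measurable_funTS.
- by apply/disj_setPS => x [/= ? []].
rewrite (null_set_integral _ _ BA0) ?adde0//; first exact: measurableD.
exact: measurable_funTS.
Qed.

Lemma measure_null_diff d (T : measurableType d) (R : realType)
    (mu : {measure set T -> \bar R}) (A B C : set T) :
  measurable A -> measurable B -> measurable C -> A `<=` B ->
  mu (B `\` A) = 0%E -> mu (B `&` C) = mu (A `&` C).
Proof.
move=> mA mB mC AB BA0.
have := @ge0_integral_null_diff _ _ _ mu A B (EFin \o \1_C) mA mB AB BA0.
rewrite !integral_indic// setIC [C `&` A]setIC; apply.
- exact/measurable_EFinP/measurable_indic.
- by move=> x; rewrite lee_fin.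
Qed.

Section winning_clock.
Context d (T : measurableType d) (R : realType) (P : probability T R).
Variables (theta : R) (X : nat -> bool -> nat -> {RV P >-> R}).
Hypothesis htheta : 0 < theta < 1.

Let w (x : T) : waits R := fun v c j => X v c j x.

Variables (q : seq (nat * bool)).
Hypothesis Hq : memoryless theta X q.

(* Ties have probability zero, because the probabilities that a given clock
   strictly beats all the others add up to one. *)
Definition rivals p : seq (nat * bool * nat * R) :=
  [seq ((b, 0%N), 0) | b <- rem p (clocks q)].

Let covers_rivals p : covers q p (rivals p).
Proof.
have ucs := clocks_uniq q; rewrite /rivals; split.
- by rewrite -map_comp map_inj_uniq ?rem_uniq// => ? ? [].
- by rewrite all_map; apply/allP => uh _ /=.
- rewrite -map_comp; apply/mapP => -[b + [pb]].
  by rewrite mem_rem_uniq// inE pb eqxx.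
- move=> b bq bp; rewrite -map_comp; apply/mapP; exists b => //.
  by rewrite mem_rem_uniq// inE bp.
Qed.

Let cost_rivals p : cost theta (rivals p) = 0.
Proof. by rewrite /cost big_map big1// => b _; rewrite mulr0. Qed.

Let win p := wins X q p (rivals p).

Let winP p x : win p x <-> [/\ path_event X q x, 0 < residual (w x) q (p, 0%N) &
  forall b, b \in clocks q -> b != p ->
    residual (w x) q (p, 0%N) < residual (w x) q (b, 0%N)].
Proof.
rewrite /win /wins /mkset /raise /rivals /exceed /mkset !all_map; split.
  move=> [qx px /allP xb]; split => // b bq bp.
  have := xb b; rewrite mem_rem_uniq ?clocks_uniq// inE bp bq => /(_ isT)/=.
  by rewrite /is_current/= -mem_clocks bq add0r.
move=> [qx px xb]; split => //; apply/allP => b.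
rewrite mem_rem_uniq ?clocks_uniq// inE => /andP[bp bq].
by rewrite /= /is_current/= -mem_clocks bq add0r; exact: xb.
Qed.

Let win_sub p : p \in clocks q -> win p `<=` path_event X (rcons q p).
Proof.
rewrite mem_clocks => pq x /winP[qx px xb]; rewrite path_event_rcons; split => //=.
by apply: choose_clock_lt => // b bn bp; apply: xb; rewrite ?mem_clocks.
Qed.

Let mwin p : p \in clocks q -> measurable (win p).
Proof. by move=> pq; exact: measurable_wins (covers_rivals p). Qed.

Let measure_win p : p \in clocks q ->
  P (win p) = (P (path_event X q) * (rate theta p.2 / (last_vertex q).+1%:R)%:E)%E.
Proof.
move=> pq.
have := integral_wins htheta pq Hq (covers_rivals p) (Phi := cst 1%E) (measurable_cst _) (fun=> lee01).
rewrite cost_rivals oppr0 expR0 mul1e integral_cst ?mul1e//; last exact: mwin.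
move=> ->.
have N0 : 0 < (last_vertex q).+1%:R :> R by rewrite ltr0n.
have r0 : 0 <= rate theta p.2.
  by apply: ltW; move/andP: htheta => [t0 t1]; rewrite /rate; case: p.2; lra.
rewrite (eq_integral (fun=> (rate theta p.2 / (last_vertex q).+1%:R)%:E)); last first.
  move=> x _; under eq_integral do rewrite mul1e.
  exact: integral_scaled_exponential.
rewrite (integral_cst P (measurable_path_event X q)).
exact: muleC.
Qed.

Let mE := measurable_path_event X.

Lemma integral_path_event (g : T -> \bar R) :
  measurable_fun setT g -> (forall x, 0 <= g x)%E ->
  (\int[P]_(x in path_event X q) g x =
   \sum_(p <- clocks q) \int[P]_(x in path_event X (rcons q p)) g x)%E.
Proof.
move=> mg g0.
rewrite (@ge0_integral_partition _ _ _ P _ _ (fun x => choose_clock (last_vertex q)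
    (fun a b => residual (w x) q (a, 0%N) <= residual (w x) q (b, 0%N))) (clocks q))//.
- by apply: eq_bigr => p _; rewrite path_event_rcons.
- by move=> p; rewrite -path_event_rcons; exact: mE.
- by move=> x _; rewrite mem_clocks choose_clock_le.
- exact: clocks_uniq.
Qed.

Lemma measure_path_event :
  (P (path_event X q) = \sum_(p <- clocks q) P (path_event X (rcons q p)))%E.
Proof.
rewrite -[LHS]mul1e -(integral_cst P (mE q) 1%E) integral_path_event//.
by apply: eq_bigr => p _; rewrite integral_cst ?mul1e.
Qed.

(** The events of the extensions of [q] partition the event of [q]; each contains the corresponding
    strict win, and the two families have the same total probability. The differences are
    nonnegative with sum 0, hence all null. *)
Let lose_null p : p \in clocks q -> P (path_event X (rcons q p) `\` win p) = 0%E.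
Proof.
move=> pq.
have sum_win : (\sum_(p' <- clocks q) P (win p') = P (path_event X q))%E.
  rewrite (eq_big_seq (fun p' => (P (path_event X q) *
    (rate theta p'.2 / (last_vertex q).+1%:R)%:E)%E)); last first.
    by move=> p' p'q; exact: measure_win.
  rewrite -[RHS](fineK (fin_num_measure P _ (mE q))).
  under eq_bigr do rewrite -(fineK (fin_num_measure P _ (mE q))) -EFinM.
  rewrite sumEFin; congr (_%:E).
  by rewrite -mulr_sumr -mulr_suml sum_rate_clocks divff ?mulr1// pnatr_eq0.
have le p' : p' \in clocks q -> (P (win p') <= P (path_event X (rcons q p')))%E.
  by move=> p'q; apply: le_measure; rewrite ?inE; [exact: mwin|exact: mE|exact: win_sub].
have lt_oo A : measurable A -> (P A < +oo)%E by move=> mA; rewrite ltey_eq fin_num_measure.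
have sum0 : \sum_(p' <- clocks q | p' \in clocks q)
    (fine (P (path_event X (rcons q p'))) - fine (P (win p'))) = 0.
  rewrite -big_seq sumrB; apply/eqP; rewrite subr_eq0; apply/eqP/EFin_inj.
  rewrite -!sumEFin.
  rewrite [RHS](eq_big_seq (fun p' => P (win p'))); last first.
    by move=> p' p'q; rewrite fineK// fin_num_measure//; exact: mwin.
  rewrite sum_win measure_path_event; apply: eq_bigr => p' _.
  by rewrite fineK// fin_num_measure//; exact: mE.
have /allP/(_ p pq) : all (fun p' => (p' \in clocks q) ==>
    (fine (P (path_event X (rcons q p'))) - fine (P (win p')) == 0)) (clocks q).
  rewrite -psumr_eq0; first by rewrite sum0.
  move=> p' p'q; rewrite subr_ge0; apply: fine_le; [apply: fin_num_measure;
    exact: mwin|apply: fin_num_measure; exact: mE|exact: le].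
rewrite pq /= => /eqP e0.
rewrite measureD//; last 2 first.
- exact: mwin.
- exact/lt_oo/mE.
rewrite setIidr; last exact: win_sub.
rewrite -(fineK (fin_num_measure P _ (mE (rcons q p)))) -(fineK (fin_num_measure P _ (mwin pq))).
by rewrite -EFinB e0.
Qed.

(** The transition law of the chain: given the history, the next ring is that of [p] with delay
    density [rate p.2] exp (- N s), N being the number of vertices. It is [integral_wins] with
    rivals' thresholds 0, ties being negligible. *)
Lemma integral_step p (Phi : measurableTypeR R * measurableTypeR R -> \bar R) :
  p \in clocks q -> measurable_fun setT Phi -> (forall z, 0 <= Phi z)%E ->
  (\int[P]_(x in path_event X (rcons q p))
      Phi (ring_time (w x) q, residual (w x) q (p, 0%N)) =
   \int[P]_(x in path_event X q) \int[lebesgue_measure]_(s in `[0%R, +oo[)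
     (Phi (ring_time (w x) q, s) *
      (rate theta p.2 * expR (- (last_vertex q).+1%:R * s))%:E))%E.
Proof.
move=> pq mPhi Phi0.
have mtS : measurable_fun setT (fun x => (ring_time (w x) q, residual (w x) q (p, 0%N))
    : (measurableTypeR R * measurableTypeR R)%type).
  by have [mt mr] := measurable_run X q; apply/measurable_fun_pairP; split; [exact: mt|exact: mr].
rewrite (ge0_integral_null_diff (mwin pq) (mE _) (win_sub pq) (lose_null pq)); last 2 first.
- exact: (measurableT_comp mPhi mtS).
- by [].
rewrite (integral_wins htheta pq Hq (covers_rivals p) mPhi Phi0).
by rewrite cost_rivals oppr0 expR0 mul1e.
Qed.

(** Thresholds for the residuals after the ring of [p] are raised thresholds before it. Written in
    that way, the event is a strict win of [p] with thresholds of the same cost, so [integral_wins]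
    produces the factor exp (- [cost]) and [integral_step] identifies the rest. *)
Lemma memoryless_rcons p : p \in clocks q -> memoryless theta X (rcons q p).
Proof.
move=> pq B J mB uJ J0.
have shift1 u : (unshift p u).1 = u.1 by rewrite /unshift; case: ifP.
have shift_inj : injective (unshift p).
  move=> [a i] [b j] e; have := shift1 (a, i); rewrite e shift1 /= => ba.
  by move: e; rewrite /unshift /= ba; case: ifP => _ [->].
(* [J1] pulls the thresholds back to the process before the ring. [J2] gives the missing rivals the
   threshold 0, which costs nothing and makes the list cover all of them. *)
pose J1 := [seq (unshift p uh.1, uh.2) | uh <- J].
pose J2 := [seq uh <- rivals p | uh.1 \notin map fst J1].
have [ur r0 pr rc] := covers_rivals p.
have fJ1 : map fst J1 = map (unshift p) (map fst J) by rewrite -!map_comp.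
have fJ2 : map fst J2 = [seq u <- map fst (rivals p) | u \notin map fst J1].
  by rewrite filter_map.
have cK : covers q p (J1 ++ J2).
  split.
  - rewrite map_cat cat_uniq fJ2 filter_uniq// andbT fJ1 (map_inj_uniq shift_inj) uJ/=.
    by apply/hasPn => u; rewrite mem_filter => /andP[].
  - rewrite all_cat all_map (eq_all (a2 := fun uh => 0 <= uh.2))// J0/=.
    by apply/allP => uh; rewrite mem_filter => /andP[_]; exact: (allP r0).
  - rewrite map_cat mem_cat negb_or fJ2 mem_filter (negbTE pr) andbF andbT fJ1.
    apply/mapP => -[u _]; rewrite /unshift; case: ifPn => [//|up [pu]].
    by move: up; rewrite -pu eqxx.
  - move=> b bq bp; rewrite map_cat mem_cat fJ2 mem_filter rc// andbT.
    exact: orbN.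
have costK : cost theta (J1 ++ J2) = cost theta J.
  rewrite /cost big_cat /= [X in _ + X]big1_seq ?addr0.
    by rewrite big_map; apply: eq_bigr => uh _; rewrite shift1.
  move=> uh /andP[_]; rewrite mem_filter => /andP[_ /mapP[b _ ->]].
  by rewrite mulr0.
have [mt mr] := measurable_run X q.
(* The new ring time is the old one plus the delay, so a condition on it becomes a condition on the
   pair. *)
pose B' : set (measurableTypeR R * measurableTypeR R)%type := [set z | B (z.1 + z.2)].
have mB' : measurable B'.
  have md : measurable_fun setT (fun z : (measurableTypeR R * measurableTypeR R)%type => z.1 + z.2 : R).
    exact: measurable_funD.
  exact: (measurable_preimage md mB).
have m1 : measurable_fun setT (fun z => (\1_B' z)%:E : \bar R).
  exact/measurable_EFinP/measurable_indic.
have i0 z : (0 <= (\1_B' z)%:E :> \bar R)%E by rewrite lee_fin.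
have mS' : measurable_fun setT (fun x => (ring_time (w x) q, residual (w x) q (p, 0%N))
    : (measurableTypeR R * measurableTypeR R)%type).
  by apply/measurable_fun_pairP; split; [exact: mt|exact: mr].
have toB' A : measurable A -> (\int[P]_(x in A) (\1_B' (ring_time (w x) q, residual (w x) q (p, 0%N)))%:E =
    P (A `&` (fun x => ring_time (w x) (rcons q p)) @^-1` B))%E.
  move=> mA; rewrite (eq_integral (fun x => (\1_((fun x => ring_time (w x) (rcons q p)) @^-1` B) x)%:E)).
    rewrite integral_indic//; first by rewrite setIC.
    apply: measurable_preimage => //.
    by have [] := measurable_run X (rcons q p).
  move=> x _; rewrite (_ : _ @^-1` B = (fun x => (ring_time (w x) q, residual (w x) q (p, 0%N))) @^-1` B').
    by rewrite !indicE.
  by apply/seteqP; split => y; rewrite /preimage /mkset ring_time_rcons.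
have mtau' : measurable ((fun x => ring_time (w x) (rcons q p)) @^-1` B).
  by apply: measurable_preimage => //; have [] := measurable_run X (rcons q p).
have mex := measurable_exceed X (rcons q p) J.
rewrite -[in RHS](toB' _ (mE _)).
rewrite (integral_step pq m1 i0).
rewrite -setIA (measure_null_diff (mwin pq) (mE _) _ (win_sub pq) (lose_null pq)); last exact: measurableI.
rewrite (_ : _ `&` (_ `&` _) = wins X q p (J1 ++ J2) `&` (fun x => ring_time (w x) (rcons q p)) @^-1` B).
  have mW : measurable (wins X q p (J1 ++ J2)) by exact: measurable_wins.
  transitivity (\int[P]_(x in wins X q p (J1 ++ J2)) (\1_B' (ring_time (w x) q, residual (w x) q (p, 0%N)))%:E)%E.
    apply/esym; exact: (toB' _ mW).
  rewrite (integral_wins htheta pq Hq cK m1 i0) costK.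
  exact: muleC.
rewrite setIA; congr (_ `&` _); apply/seteqP; split => x.
  move=> [/winP[qx Sx xb] /allP xJ]; split => //; apply/allP => v /mapP[uh + ->].
  rewrite mem_cat => /orP[/mapP[uh' uhJ ->] /=|].
    have := xJ _ uhJ; rewrite residual_rcons ltrBrDr; exact.
  rewrite mem_filter => /andP[_ /mapP[b + ->]] /=.
  rewrite mem_rem_uniq ?clocks_uniq// inE => /andP[bp bq].
  by rewrite /is_current /= -mem_clocks bq add0r; exact: xb.
move=> [qx Sx /allP xK]; split.
  apply/winP; split => // b bq bp.
  have bcur : is_current (last_vertex q) (b, 0%N) by rewrite /is_current /= -mem_clocks.
  have [|bJ1] := boolP ((b, 0%N) \in map fst J1).
    move=> /mapP[uh uhJ1 bE].
    have uhK : uh \in J1 ++ J2 by rewrite mem_cat uhJ1.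
    have := xK _ (map_f _ uhK); rewrite /= -bE bcur; apply: le_lt_trans.
    by rewrite lerDr; move: uhJ1 => /mapP[uh' uh'J ->] /=; exact: (allP J0 _ uh'J).
  have bK : ((b, 0%N), 0) \in J1 ++ J2.
    rewrite mem_cat mem_filter bJ1 /= /rivals; apply/orP; right; apply/mapP.
    by exists b => //; rewrite mem_rem_uniq ?clocks_uniq// inE bp.
  by have := xK _ (map_f _ bK); rewrite /= bcur add0r.
apply/allP => uh uhJ.
have uhK : (unshift p uh.1, uh.2) \in J1 ++ J2.
  by rewrite mem_cat; apply/orP; left; apply/mapP; exists uh.
by have := xK _ (map_f _ uhK); rewrite residual_rcons ltrBrDr; exact.
Qed.

End winning_clock.

Section process.
Context d (T : measurableType d) (R : realType) (P : probability T R).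
Variables (theta : R) (X : nat -> bool -> nat -> {RV P >-> R}).
Hypotheses (htheta : 0 < theta < 1) (hX : poisson_clocks theta X).

Lemma memoryless_paths m q : q \in paths m -> memoryless theta X q.
Proof.
elim: m q => [|m IH] q; first by rewrite inE => /eqP ->; exact: memoryless_nil.
by move=> /mem_pathsS[q' [p [-> /IH mq' pq']]]; exact: memoryless_rcons.
Qed.

End process.

(** * The backward equation *)

Section birth_death.
Context (R : realType) (theta : R).
Hypothesis htheta : 0 < theta < 1.

Let mu := 1 - theta.

Let theta_gt0 : 0 < theta. Proof. by case/andP: htheta. Qed.
Let theta_lt1 : theta < 1. Proof. by case/andP: htheta. Qed.
Let mu_gt0 : 0 < mu. Proof. by rewrite subr_gt0. Qed.

(* [phi a] is the integral of exp (- (1 - 2 theta) s) over 0 <= s <= a. *)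
Definition phi (a : R) : R :=
  if 1 - 2 * theta == 0 then a
  else (1 - expR (- (1 - 2 * theta) * a)) / (1 - 2 * theta).

Lemma expR_phi a : expR (- (1 - 2 * theta) * a) = 1 - (1 - 2 * theta) * phi a.
Proof.
rewrite /phi; case: eqVneq => [->|d0].
  by rewrite oppr0 !mul0r expR0 subr0.
by field.
Qed.

Lemma phi0 : phi 0 = 0.
Proof. by rewrite /phi mulr0 expR0 subrr mul0r if_same. Qed.

Global Instance is_derive_phi (a : R) : is_derive a (1 : R) (phi : R -> R) (expR (- (1 - 2 * theta) * a)).
Proof.
rewrite /phi; case: eqVneq => [->|d0].
  by rewrite oppr0 mul0r expR0; exact: is_derive_id.
apply: is_derive_eq; rewrite /GRing.scale/=.
by field.
Qed.

Lemma phi_ge0 a : 0 <= a -> 0 <= phi a.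
Proof.
move=> a0; rewrite /phi; have [d0|d0|//] := ltgtP (1 - 2 * theta) 0.
  apply: mulr_le0; last by rewrite invr_le0 ltW.
  rewrite subr_le0 -[leLHS]expR0 ler_expR.
  by rewrite mulr_ge0// oppr_ge0 ltW.
apply: mulr_ge0; last by rewrite invr_ge0 ltW.
rewrite subr_ge0 -[leRHS]expR0 ler_expR.
by rewrite mulr_le0_ge0// oppr_le0 ltW.
Qed.

(** Without deletions of the vertex itself, its degree is a linear birth-death process with
    immigration at rate [theta]. Started from 0 it is geometric at time a, and 1 / [geom_den y a] is
    its generating function at 1 - y. *)
Definition geom_den (y a : R) : R := 1 + theta * phi a * y.

(** One minus the generating function at 1 - y for the descendants of one individual in the
    birth-death process without immigration; equivalently, the probability that one of them is
    marked, each being marked with probability y. It solves a logistic equation. *)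
Definition escape (y a : R) : R := expR (- (1 - 2 * theta) * a) * y / geom_den y a.

(* The generating function, at 1 - y, of the degree at time a of a vertex with
   initial degree n, on the event that it has not been deleted until then. *)
Definition trans (y a : R) (n : nat) : R :=
  expR (- (1 - theta) * a) / geom_den y a * (1 - escape y a) ^+ n.

Lemma is_derive_geom_den y (a : R) :
  is_derive a (1 : R) (geom_den y : R -> R) (theta * expR (- (1 - 2 * theta) * a) * y).
Proof.
rewrite /geom_den; apply: is_derive_eq; rewrite /GRing.scale/=; ring.
Qed.

Lemma is_derive_escape y (a : R) : geom_den y a != 0 ->
  is_derive a (1 : R) (escape y : R -> R)
    (- (1 - 2 * theta) * escape y a - theta * escape y a ^+ 2).
Proof.
move=> d0; have dd := is_derive_geom_den y a; rewrite /escape.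
have dV := is_deriveV d0 dd.
apply: is_derive_eq; by rewrite /GRing.scale/=; field.
Qed.

(** The backward equation of the killed process: the restart from 0 is replaced by a loss at rate 1
    - [theta]. For n = 0 the value of [n.-1] is immaterial because of the factor n. *)
Lemma is_derive_trans y (a : R) n : geom_den y a != 0 ->
  is_derive a (1 : R) (fun a => trans y a n : R)
    (theta * n.+1%:R * (trans y a n.+1 - trans y a n)
     + (1 - theta) * n%:R * (trans y a n.-1 - trans y a n)
     - (1 - theta) * trans y a n).
Proof.
move=> d0; have dd := is_derive_geom_den y a; have de := is_derive_escape d0.
have dV : is_derive a (1 : R) (fun a => (geom_den y a)^-1 : R)
    (- theta * escape y a / geom_den y a).
  apply: (is_derive_eq (is_deriveV d0 dd)).
  by rewrite /GRing.scale/= /escape; field.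
have dE : is_derive a (1 : R) (fun a => expR (- (1 - theta) * a) : R)
    (- (1 - theta) * expR (- (1 - theta) * a)).
  by apply: is_derive_eq; rewrite /GRing.scale/=; ring.
have dA := is_deriveM dE dV.
have dB : is_derive a (1 : R) (fun a => 1 - escape y a : R)
    ((1 - 2 * theta) * escape y a + theta * escape y a ^+ 2).
  by apply: is_derive_eq; rewrite /GRing.scale/=; ring.
case: n => [|n].
  rewrite (_ : (fun a => _) = (fun a => expR (- (1 - theta) * a) : R) * (fun a => (geom_den y a)^-1 : R)).
    apply: (is_derive_eq dA).
    by rewrite /GRing.scale/= /trans !expr0 expr1; field.
  by apply/funext => b; rewrite /trans expr0 mulr1.
have dP := is_deriveX n.+1 dB.
rewrite (_ : (fun a => _) = (fun a => expR (- (1 - theta) * a) : R) * (fun a => (geom_den y a)^-1 : R) * (fun a => 1 - escape y a : R) ^+ n.+1).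
  apply: (is_derive_eq (is_deriveM dA dP)).
  rewrite /GRing.scale/= !mulrfctE !exprfctE /trans /= !exprS.
  by field.
by apply/funext => b; rewrite /trans !mulrfctE exprfctE.
Qed.

Section bounds.
Variables (y a : R).
Hypotheses (y01 : 0 <= y <= 1) (a0 : 0 <= a).

Lemma geom_den_ge1 : 1 <= geom_den y a.
Proof.
case/andP: y01 => y0 _.
by rewrite /geom_den lerDl !mulr_ge0// ?phi_ge0// ltW.
Qed.

Lemma escape_ge0 : 0 <= escape y a.
Proof.
case/andP: y01 => y0 _.
by rewrite /escape divr_ge0 ?mulr_ge0 ?expR_ge0// (le_trans ler01 geom_den_ge1).
Qed.

Lemma escape_le1 : escape y a <= 1.
Proof.
case/andP: y01 => y0 y1.
rewrite /escape ler_pdivrMr ?(lt_le_trans ltr01 geom_den_ge1)// mul1r /geom_den expR_phi.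
have := phi_ge0 a0; move: (phi a) => f f0.
have fy0 : 0 <= (1 - theta) * f * y by rewrite !mulr_ge0// ltW.
rewrite -subr_ge0 (_ : _ - _ = (1 - y) + (1 - theta) * f * y); last by ring.
by rewrite addr_ge0// subr_ge0.
Qed.

Lemma trans_ge0 n : 0 <= trans y a n.
Proof.
rewrite /trans mulr_ge0 ?divr_ge0 ?expR_ge0 ?(le_trans ler01 geom_den_ge1)//.
by rewrite exprn_ge0// subr_ge0 escape_le1.
Qed.

Lemma trans_le n : trans y a n <= expR (- (1 - theta) * a).
Proof.
rewrite /trans -mulrA ler_piMr ?expR_ge0// mulr_ile1//.
- by rewrite invr_ge0 (le_trans ler01 geom_den_ge1).
- by rewrite exprn_ge0// subr_ge0 escape_le1.
- by rewrite invf_le1 ?geom_den_ge1// (lt_le_trans ltr01 geom_den_ge1).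
- by rewrite exprn_ile1// ?subr_ge0 ?escape_le1// gerBl escape_ge0.
Qed.

End bounds.

Lemma is_derive_continuous (f : R -> R) (x df : R) :
  is_derive x (1 : R) f df -> {for x, continuous f}.
Proof.
by move=> fx; apply/differentiable_continuous/derivable1_diffP; case: fx.
Qed.

Lemma continuous_comp_max (f : R -> R) :
  (forall x, 0 <= x -> {for x, continuous f}) ->
  continuous (fun x : R => f (Num.max x 0)).
Proof.
move=> fc x.
have cm : {for x, continuous (fun x : R => Num.max x 0)}.
  by apply: continuous_max; [exact: cvg_id|exact: cvg_cst].
apply: (continuous_comp cm).
by apply: fc; rewrite le_max lexx orbT.
Qed.

Section value.
Variable y : R.
Hypothesis y01 : 0 <= y <= 1.

Let den_neq0 a : 0 <= a -> geom_den y a != 0.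
Proof. by move=> a0; rewrite gt_eqF// (lt_le_trans ltr01 (geom_den_ge1 y01 a0)). Qed.

Lemma continuous_trans a n : 0 <= a -> {for a, continuous (fun a => trans y a n)}.
Proof. by move=> a0; apply: is_derive_continuous (is_derive_trans _ (den_neq0 a0)). Qed.

(* The maximum makes the function continuous on the whole line. *)
Definition killed (a : R) : R := (1 - theta) * trans y (Num.max a 0) 0.

Lemma continuous_killed : continuous killed.
Proof.
move=> a; rewrite /killed; apply: cvgM; first exact: cvg_cst.
by apply: (continuous_comp_max (f := fun a => trans y a 0)) => b; exact: continuous_trans.
Qed.

Lemma killed_ge0 a : 0 <= killed a.
Proof. by rewrite /killed mulr_ge0 ?(ltW mu_gt0)// trans_ge0// le_max lexx orbT. Qed.

Lemma killed_le a : 0 <= a -> killed a <= (1 - theta) * expR (- (1 - theta) * a).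
Proof.
move=> a0; rewrite /killed (max_idPl a0) ler_wpM2l ?trans_le//.
exact: ltW.
Qed.

Let integrable_killed b c : lebesgue_measure.-integrable `[b, c] (EFin \o killed).
Proof.
apply: continuous_compact_integrable; first exact: segment_compact.
by apply: continuous_subspaceT; exact: continuous_killed.
Qed.

(* Integrating from -1 makes the primitive differentiable at 0 too. *)
Let ikilled t := \int[lebesgue_measure]_(a in `[(-1 : R), t]) killed a.

Definition restarted (t : R) : R := ikilled t - ikilled 0.

Let is_derive_restarted (t : R) : -1 < t ->
  is_derive t (1 : R) restarted (killed t).
Proof.
move=> t1; have tt : t < t + 1 by rewrite ltrDl.
have [dF F'] := continuous_FTC1_closed tt (integrable_killed _ _) t1 (@continuous_killed t).
rewrite /restarted.
have dI : is_derive t (1 : R) ikilled (killed t).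
  by apply: (DeriveDef dF); rewrite -F' derive1E.
by apply: is_derive_eq; rewrite subr0.
Qed.

(** Decomposition at the last deletion of the vertex: either there was none, or it happened at age a
    in [0, t], with density 1 - [theta], and the degree has evolved from 0 since then without
    another one. *)
Definition value (t : R) (n : nat) : R := trans y t n + restarted t.

(** [restarted] does not depend on n, so it disappears from the differences, and its derivative
    [killed t] supplies the missing restart term. *)
Lemma is_derive_value (t : R) n : 0 <= t ->
  is_derive t (1 : R) (fun t => value t n : R)
    (theta * n.+1%:R * (value t n.+1 - value t n)
     + (1 - theta) * n%:R * (value t n.-1 - value t n)
     + (1 - theta) * (value t 0 - value t n)).
Proof.
move=> t0; rewrite /value.
have d1 := is_derive_trans n (den_neq0 t0).
have d2 : is_derive t (1 : R) restarted (killed t).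
  by apply: is_derive_restarted; lra.
apply: is_derive_eq; rewrite /killed (max_idPl t0); ring.
Qed.

Let measurable_exp : measurable_fun setT
  (fun a : R => (1 - theta) * expR (- (1 - theta) * a)).
Proof.
by apply: measurable_funM => //; apply: measurableT_comp => //; apply: measurable_funM.
Qed.

Let integrable_exp : lebesgue_measure.-integrable `[0 : R, +oo[
  (fun a => ((1 - theta) * expR (- (1 - theta) * a))%:E).
Proof.
apply/integrableP; split.
  by apply/measurable_EFinP; apply: measurable_funTS.
under eq_integral do rewrite gee0_abs ?lee_fin ?mulr_ge0 ?expR_ge0 ?(ltW mu_gt0)//.
by rewrite (integral_scaled_exponential mu_gt0 (ltW mu_gt0)) ltry.
Qed.

Let integrable_killed_y : lebesgue_measure.-integrable `[0 : R, +oo[ (EFin \o killed).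
Proof.
apply: (le_integrable _ _ _ integrable_exp) => //.
  by apply/measurable_EFinP; apply: measurable_funTS; apply: continuous_measurable_fun; exact: continuous_killed.
move=> a /=; rewrite in_itv/= andbT => a0.
rewrite lee_fin !ger0_norm ?killed_ge0 ?killed_le//.
by rewrite mulr_ge0 ?expR_ge0 ?(ltW mu_gt0).
Qed.

Definition limit_value : R := \int[lebesgue_measure]_(a in `[(0 : R), +oo[) killed a.

Lemma limit_value_bounds : 0 <= limit_value <= 1.
Proof.
rewrite /limit_value Rintegral_ge0 => [/=|a _]; last exact: killed_ge0.
have -> : (1 : R) = fine (((1 - theta) / (1 - theta))%:E).
  by rewrite divff// gt_eqF.
rewrite -(integral_scaled_exponential mu_gt0 (ltW mu_gt0)).
apply: le_Rintegral => //; move=> a; rewrite /= in_itv/= andbT => a0.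
exact: killed_le.
Qed.

Lemma restarted_ge0 t : 0 <= t -> 0 <= restarted t.
Proof.
move=> t0; rewrite /restarted /ikilled.
rewrite Rintegral_itvB ?bnd_simp//.
by apply: Rintegral_ge0 => a _; exact: killed_ge0.
Qed.

Lemma limit_value_restarted t : 0 <= t ->
  0 <= limit_value - restarted t <= expR (- (1 - theta) * t).
Proof.
move=> t0.
have -> : limit_value - restarted t = \int[lebesgue_measure]_(a in `]t, +oo[) killed a.
  rewrite -(Rintegral_itvB integrable_killed_y) ?bnd_simp//.
  rewrite /limit_value; congr (_ - _).
  rewrite /restarted /ikilled Rintegral_itvB ?bnd_simp//.
  rewrite Rintegral_itv_obnd_cbnd//.
  by apply: integrableS (integrable_killed 0 t) => //; apply: subset_itvr; rewrite bnd_simp.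
rewrite Rintegral_ge0 => [/=|a _]; last exact: killed_ge0.
have -> : expR (- (1 - theta) * t) = fine (expR (- (1 - theta) * t))%:E by [].
rewrite -(integral_exponential_ray mu_gt0 t0); apply: le_Rintegral => //.
- by apply: integrableS integrable_killed_y => //; apply: subset_itvr; rewrite bnd_simp.
- by apply: integrableS integrable_exp => //; apply: subset_itvr; rewrite bnd_simp.
- move=> a; rewrite /= in_itv/= andbT => ta; apply: killed_le.
  by rewrite (le_trans t0)// ltW.
Qed.

Lemma value_ge0 t n : 0 <= t -> 0 <= value t n.
Proof. by move=> t0; rewrite addr_ge0 ?trans_ge0 ?restarted_ge0. Qed.

(** [trans] and the tail of the integral defining [limit_value] both lie between 0 and the bound,
    and the distance is that of these two numbers. The bound is uniform in n. *)
Lemma value_dist t n : 0 <= t ->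
  `|value t n - limit_value| <= expR (- (1 - theta) * t).
Proof.
move=> t0; have /andP[l1 l2] := limit_value_restarted t0.
have t1 := trans_ge0 y01 t0 n; have t2 := trans_le y01 t0 n.
by rewrite /value ler_norml; apply/andP; split; lra.
Qed.

Lemma value0 n : value 0 n = (1 - y) ^+ n.
Proof.
rewrite /value /restarted subrr addr0 /trans /escape /geom_den phi0 !mulr0 expR0.
by rewrite mul0r addr0 !divr1 !mul1r.
Qed.

Lemma continuous_value t n : 0 <= t -> {for t, continuous (fun t => value t n)}.
Proof. by move=> t0; apply: is_derive_continuous (is_derive_value n t0). Qed.

End value.

(** Variation of constants: - exp (- N s) F(T0 - s) is a primitive of the integrand. The case T0 = 0
    is separate because the fundamental theorem is applied on a nondegenerate segment. *)
Lemma integral_renewal (F S : R -> R) (N T0 : R) : 0 < N -> 0 <= T0 ->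
  (forall t : R, 0 <= t -> is_derive t (1 : R) F (S t - N * F t)) ->
  (forall t : R, 0 <= t -> {for t, continuous S}) ->
  (\int[lebesgue_measure]_(s in `[0%R, T0])
     (S (T0 - s) * expR (- N * s))%:E = (F T0 - expR (- N * T0) * F 0)%:E)%E.
Proof.
move=> N0; rewrite le_eqVlt => /predU1P[<-|T0_gt0] dF cS.
  by rewrite set_itv1 integral_set1 mulr0 expR0 mul1r subrr.
have dH (s : R) : s <= T0 -> is_derive s (1 : R) (fun s => - (expR (- N * s) * F (T0 - s)) : R)
    (S (T0 - s) * expR (- N * s)).
  move=> sT; have dFs := dF (T0 - s) _; rewrite subr_ge0 in dFs.
  have dg : is_derive s (1 : R) (fun s => T0 - s : R) (-1).
    by apply: is_derive_eq; ring.
  have dc := @is_derive1_comp _ F (fun s => T0 - s) s _ _ (dFs sT) dg.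
  have dE : is_derive s (1 : R) (fun s => expR (- N * s) : R) (- N * expR (- N * s)).
    by apply: is_derive_eq; rewrite /GRing.scale/=; ring.
  rewrite (_ : (fun s => _) = - ((fun s => expR (- N * s) : R) * (F \o (fun s => T0 - s)))).
    apply: (is_derive_eq (is_deriveN (is_deriveM dE dc))).
    by rewrite /GRing.scale/=; ring.
  by apply/funext => u.
have H_cont (s : R) : s <= T0 -> {for s, continuous (fun s => - (expR (- N * s) * F (T0 - s)))}.
  by move=> sT; apply: is_derive_continuous (dH s sT).
rewrite (@continuous_FTC2 _ _ (fun s => - (expR (- N * s) * F (T0 - s)))) //.
- by rewrite mulr0 expR0 mul1r subr0 subrr !EFinN oppeK -EFinN -EFinD addrC.
- apply: continuous_in_subspaceT => s /set_mem /=; rewrite in_itv/= => /andP[_ sT].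
  apply: cvgM.
    have cT : {for s, continuous (fun s : R => T0 - s)}.
      by apply: cvgB; [exact: cvg_cst|exact: cvg_id].
    by apply: (continuous_comp cT); apply: cS; rewrite subr_ge0.
  apply: continuous_comp; last exact: continuous_expR.
  by apply: cvgM; [exact: cvg_cst|exact: cvg_id].
- split.
  + by move=> s; rewrite in_itv/= => /andP[_ /ltW/dH[]].
  + by apply: cvg_at_right_filter; exact/H_cont/ltW.
  + by apply: cvg_at_left_filter; exact/H_cont.
- move=> s; rewrite in_itv/= => /andP[_ /ltW/dH dHs].
  by rewrite derive1E derive_val.
Qed.

End birth_death.

(** * The limit law as a mixture of geometric laws *)

Section mixture.
Context (R : realType) (theta : R).
Hypothesis htheta : 0 < theta < 1.

Let theta_gt0 : 0 < theta. Proof. by case/andP: htheta. Qed.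
Let mu_gt0 : 0 < 1 - theta. Proof. by rewrite subr_gt0; case/andP: htheta. Qed.

Notation phi := (phi theta).
Notation geom_den := (geom_den theta).

(** The rho(a) of the mixture: 1 / [geom_den (1 - z) a] = (1 - rho) / (1 - z rho), the generating
    function of a geometric law on 0, 1, 2, ... with ratio rho. *)
Definition geom_ratio (a : R) : R := theta * phi a / geom_den 1 a.

Definition age_density (a : R) : R := (1 - theta) * expR (- (1 - theta) * a).

Let i01 : 0 <= (1 : R) <= 1. Proof. by rewrite ler01 lexx. Qed.

Let den_gt0 a : 0 <= a -> 0 < geom_den 1 a.
Proof. by move=> a0; rewrite (lt_le_trans ltr01 (geom_den_ge1 htheta i01 a0)). Qed.

Lemma geom_ratio_ge0 a : 0 <= a -> 0 <= geom_ratio a.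
Proof.
by move=> a0; rewrite /geom_ratio divr_ge0 ?mulr_ge0 ?phi_ge0 ?(ltW theta_gt0) ?(ltW (den_gt0 a0)).
Qed.

Lemma geom_ratioC a : 0 <= a -> 1 - geom_ratio a = (geom_den 1 a)^-1.
Proof.
move=> a0; have := den_gt0 a0; rewrite /geom_ratio /geom_den mulr1 => d0.
by field; rewrite gt_eqF.
Qed.

Lemma geom_ratio_lt1 a : 0 <= a -> geom_ratio a < 1.
Proof. by move=> a0; rewrite -subr_gt0 geom_ratioC// invr_gt0 den_gt0. Qed.

Lemma continuous_phi : continuous phi.
Proof. by move=> a; apply: is_derive_continuous (is_derive_phi theta a). Qed.

Lemma continuous_geom_den y : continuous (geom_den y).
Proof. by move=> a; apply: is_derive_continuous (is_derive_geom_den theta y a). Qed.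

Lemma continuous_geom_ratio a : 0 <= a -> {for a, continuous geom_ratio}.
Proof.
move=> a0; apply: cvgM.
  by apply: cvgM; [exact: cvg_cst|exact: continuous_phi].
apply: cvgV; first by rewrite gt_eqF ?den_gt0.
exact: continuous_geom_den.
Qed.

Lemma continuous_age_density : continuous age_density.
Proof.
move=> a; apply: cvgM; first exact: cvg_cst.
apply: continuous_comp; last exact: continuous_expR.
by apply: cvgM; [exact: cvg_cst|exact: cvg_id].
Qed.

Lemma age_density_gt0 a : 0 < age_density a.
Proof. by rewrite mulr_gt0 ?expR_gt0. Qed.

Lemma integrable_age_density :
  lebesgue_measure.-integrable `[(0 : R), +oo[ (EFin \o age_density).
Proof.
apply/integrableP; split.
  apply/measurable_EFinP; apply: measurable_funTS; apply: continuous_measurable_fun.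
  exact: continuous_age_density.
under eq_integral do rewrite gee0_abs ?lee_fin ?(ltW (age_density_gt0 _))//.
by rewrite (integral_scaled_exponential mu_gt0 (ltW mu_gt0)) ltry.
Qed.

Lemma integrable_age_densityM (f : R -> R) :
  (forall a, 0 <= a -> {for a, continuous f}) ->
  (forall a, 0 <= a -> 0 <= f a <= 1) ->
  lebesgue_measure.-integrable `[(0 : R), +oo[ (fun a => (age_density a * f a)%:E).
Proof.
move=> fc f01; apply: (le_integrable _ _ _ integrable_age_density) => //.
  apply/measurable_EFinP; apply: subspace_continuous_measurable_fun => //.
  apply: continuous_in_subspaceT => a /set_mem /=; rewrite in_itv/= andbT => a0.
  by apply: cvgM; [exact: continuous_age_density|exact: fc].
move=> a /=; rewrite in_itv/= andbT => /f01 /andP[f0 f1].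
by rewrite /= lee_fin normrM ler_piMr// ger0_norm.
Qed.

Definition mixture (k : nat) : R :=
  \int[lebesgue_measure]_(a in `[(0 : R), +oo[) (age_density a * (geom_ratio a ^+ k / geom_den 1 a)).

(** The remainder of the generating function of [mixture] from index k on, with the geometric series
    summed under the integral. *)
Definition mixture_rest (z : R) (k : nat) : R :=
  \int[lebesgue_measure]_(a in `[(0 : R), +oo[)
    (age_density a * ((z * geom_ratio a) ^+ k / geom_den (1 - z) a)).

Section pgf.
Variable z : R.
Hypothesis z01 : 0 <= z <= 1.

Let z0 : 0 <= z. Proof. by case/andP: z01. Qed.
Let z1 : z <= 1. Proof. by case/andP: z01. Qed.
Let y01 : 0 <= 1 - z <= 1. Proof. by rewrite subr_ge0 z1 gerBl z0. Qed.

Lemma rest_bounds k a : 0 <= a ->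
  0 <= (z * geom_ratio a) ^+ k / geom_den (1 - z) a <= z ^+ k.
Proof.
move=> a0; have d1 := geom_den_ge1 htheta y01 a0.
have d0 := lt_le_trans ltr01 d1.
have zr0 : 0 <= z * geom_ratio a by rewrite mulr_ge0 ?geom_ratio_ge0.
rewrite divr_ge0 ?exprn_ge0 ?(ltW d0)//= ler_pdivrMr//.
apply: (@le_trans _ _ (z ^+ k)); last by rewrite ler_peMr// exprn_ge0.
by apply: lerXn2r; rewrite ?nnegrE// ler_piMr// ltW// geom_ratio_lt1.
Qed.

Lemma rest_continuous k a : 0 <= a ->
  {for a, continuous (fun a => (z * geom_ratio a) ^+ k / geom_den (1 - z) a)}.
Proof.
move=> a0; apply: cvgM.
  apply: (@continuous_comp _ _ _ (fun a => z * geom_ratio a) (fun b => b ^+ k)).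
    by apply: cvgM; [exact: cvg_cst|exact: continuous_geom_ratio].
  exact: exprn_continuous.
apply: cvgV; last exact: continuous_geom_den.
by rewrite gt_eqF// (lt_le_trans ltr01 (geom_den_ge1 htheta y01 a0)).
Qed.

Lemma mixture_rest0 : mixture_rest z 0 = limit_value theta (1 - z).
Proof.
apply: eq_Rintegral => a /set_mem /=; rewrite in_itv/= andbT => a0.
rewrite /killed (max_idPl a0) /trans /age_density !expr0; field.
by rewrite gt_eqF// (lt_le_trans ltr01 (geom_den_ge1 htheta y01 a0)).
Qed.

End pgf.

Let age_weight k a : 0 <= a -> 0 <= geom_ratio a ^+ k / geom_den 1 a <= 1.
Proof.
move=> a0; have d0 := den_gt0 a0.
rewrite divr_ge0 ?exprn_ge0 ?geom_ratio_ge0 ?(ltW d0)//= ler_pdivrMr// mul1r.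
rewrite (le_trans _ (geom_den_ge1 htheta i01 a0))// exprn_ile1 ?geom_ratio_ge0//.
exact/ltW/geom_ratio_lt1.
Qed.

Let age_weight_continuous k a : 0 <= a ->
  {for a, continuous (fun a => geom_ratio a ^+ k / geom_den 1 a)}.
Proof.
move=> a0; apply: cvgM.
  apply: (@continuous_comp _ _ _ geom_ratio (fun b => b ^+ k)).
    exact: continuous_geom_ratio.
  exact: exprn_continuous.
apply: cvgV; last exact: continuous_geom_den.
by rewrite gt_eqF// den_gt0.
Qed.

Lemma integrable_mixture k : lebesgue_measure.-integrable `[(0 : R), +oo[
  (fun a => (age_density a * (geom_ratio a ^+ k / geom_den 1 a))%:E).
Proof. by apply: integrable_age_densityM => a a0; [exact: age_weight_continuous|exact: age_weight]. Qed.

Lemma mixture_restS z k : 0 <= z <= 1 ->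
  mixture_rest z k = z ^+ k * mixture k + mixture_rest z k.+1.
Proof.
move=> z01; have /andP[z0 z1] := z01.
have y01 : 0 <= 1 - z <= 1 by rewrite subr_ge0 z1 gerBl z0.
have ir j : lebesgue_measure.-integrable `[(0 : R), +oo[
    (fun a => (age_density a * ((z * geom_ratio a) ^+ j / geom_den (1 - z) a))%:E).
  apply: integrable_age_densityM => a a0; first exact: (rest_continuous z01).
  have /andP[-> /le_trans->//] := rest_bounds z01 j a0.
  exact: exprn_ile1.
rewrite /mixture -RintegralZl//; last exact: integrable_mixture.
rewrite -RintegralD//; last 2 first.
- rewrite [X in integrable _ _ X](_ : _ = (fun a => (z ^+ k)%:E * (age_density a * (geom_ratio a ^+ k / geom_den 1 a))%:E)%E); last by apply/funext => a /=; rewrite EFinM.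
  by apply: integrableZl => //; exact: integrable_mixture.
- exact: ir.
apply: eq_Rintegral => a /set_mem /=; rewrite in_itv/= andbT => a0.
have d0 := lt_le_trans ltr01 (geom_den_ge1 htheta y01 a0).
have d1 := den_gt0 a0.
rewrite exprS !exprMn /geom_ratio; move: d0 d1; rewrite /geom_den => d0 d1.
move: (_ ^+ k) => u; field.
by rewrite !gt_eqF//; lra.
Qed.

Lemma mixture_rest_bounds z k : 0 <= z <= 1 -> 0 <= mixture_rest z k <= z ^+ k.
Proof.
move=> z01; have /andP[z0 z1] := z01.
have ir : lebesgue_measure.-integrable `[(0 : R), +oo[
    (fun a => (age_density a * ((z * geom_ratio a) ^+ k / geom_den (1 - z) a))%:E).
  apply: integrable_age_densityM => a a0; first exact: (rest_continuous z01).
  have /andP[-> /le_trans->//] := rest_bounds z01 k a0.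
  exact: exprn_ile1.
rewrite /mixture_rest Rintegral_ge0/=; last first.
  move=> a; rewrite in_itv/= andbT => a0; rewrite mulr_ge0 ?(ltW (age_density_gt0 _))//.
  by have /andP[] := rest_bounds z01 k a0.
have -> : z ^+ k = \int[lebesgue_measure]_(a in `[(0 : R), +oo[) (z ^+ k * age_density a).
  rewrite RintegralZl//; last exact: integrable_age_density.
  rewrite /Rintegral (integral_scaled_exponential mu_gt0 (ltW mu_gt0)) divff ?mulr1//.
  by rewrite gt_eqF.
apply: le_Rintegral => //.
  rewrite [X in integrable _ _ X](_ : _ = (fun a => (z ^+ k)%:E * (age_density a)%:E)%E);
    last by apply/funext => a /=; rewrite EFinM.
  by apply: integrableZl => //; exact: integrable_age_density.
move=> a /=; rewrite in_itv/= andbT => a0.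
rewrite mulrC ler_wpM2r ?(ltW (age_density_gt0 _))//.
by have /andP[] := rest_bounds z01 k a0.
Qed.

Lemma limit_value_mixture z K : 0 <= z <= 1 ->
  limit_value theta (1 - z) =
  \sum_(0 <= k < K) z ^+ k * mixture k + mixture_rest z K.
Proof.
move=> z01; elim: K => [|K IH].
  by rewrite big_nil add0r mixture_rest0.
by rewrite big_nat_recr//= -addrA -mixture_restS.
Qed.

Lemma mixture_ge0 k : 0 <= mixture k.
Proof.
apply: Rintegral_ge0 => a /=; rewrite in_itv/= andbT => a0.
rewrite mulr_ge0 ?(ltW (age_density_gt0 _))//.
by have /andP[] := age_weight k a0.
Qed.

Lemma phi_gt0 a : 0 < a -> 0 < phi a.
Proof.
move=> a0; rewrite /phi; have [d0|d0|//] := ltgtP (1 - 2 * theta) 0.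
  rewrite nmulr_lgt0 ?invr_lt0// subr_lt0 -[ltLHS]expR0 ltr_expR.
  by rewrite mulr_gt0// oppr_gt0.
rewrite divr_gt0// subr_gt0 -[ltRHS]expR0 ltr_expR.
by rewrite nmulr_rlt0// oppr_lt0.
Qed.

(** The integrand is positive at every positive age, so a vanishing integral would make ]0, 1[
    negligible. *)
Lemma mixture_gt0 k : 0 < mixture k.
Proof.
rewrite lt_neqAle mixture_ge0 andbT eq_sym; apply/eqP => m0.
have im := integrable_mixture k.
have i0 : (\int[lebesgue_measure]_(a in `[0%R, +oo[) (age_density a * (geom_ratio a ^+ k / geom_den 1 a))%:E = 0)%E.
  by rewrite -[LHS]fineK ?integrable_fin_num// [fine _]m0.
have /integrableP[mm _] := im.
have abs0 : (\int[lebesgue_measure]_(a in `[0%R, +oo[) `|(age_density a * (geom_ratio a ^+ k / geom_den 1 a))%:E| = 0)%E.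
  rewrite -i0; apply: eq_integral => a /set_mem /=; rewrite in_itv/= andbT => a0.
  rewrite ger0_norm// mulr_ge0 ?(ltW (age_density_gt0 _))//.
  by have /andP[] := age_weight k a0.
have ae0 := (ae_eq_integral_abs lebesgue_measure (measurable_itv _) mm).1 abs0.
have : lebesgue_measure.-negligible (`]0, 1[%classic : set R).
  apply: negligibleS ae0 => a /=; rewrite in_itv/= => /andP[a0 _] h.
  have := h _; rewrite in_itv/= andbT (ltW a0) => /(_ isT) [] /eqP.
  apply/negP; rewrite gt_eqF// mulr_gt0 ?age_density_gt0//.
  rewrite divr_gt0 ?den_gt0 ?(ltW a0)// exprn_gt0// divr_gt0 ?den_gt0 ?(ltW a0)//.
  by rewrite mulr_gt0 ?phi_gt0.
move=> /negligibleP -/(_ (measurable_itv _)) l0.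
have := lebesgue_measure_itv (`]0, 1[ : interval R).
by rewrite [LHS]l0 /= lte01 sube0 => /esym/eqP; rewrite onee_eq0.
Qed.

(** At z = 1 the expansion says that 1 is a partial sum plus a remainder. The remainder tends to 0
    by dominated convergence, since rho(a) < 1 at each finite age. *)
Lemma cvg_series_mixture : series mixture @ \oo --> (1 : R).
Proof.
have l1 : limit_value theta (1 - 1) = 1.
  transitivity (\int[lebesgue_measure]_(a in `[(0 : R), +oo[) age_density a); last first.
    rewrite /Rintegral (integral_scaled_exponential mu_gt0 (ltW mu_gt0)) divff//.
    by rewrite gt_eqF.
  apply: eq_Rintegral => a /set_mem /=; rewrite in_itv/= andbT => a0.
  by rewrite /killed (max_idPl a0) /trans /geom_den expr0 subrr mulr0 addr0 divr1 mulr1.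
suff r0 : mixture_rest 1 K @[K --> \oo] --> (0 : R).
  have -> : series mixture = (fun K => 1 - mixture_rest 1 K).
    apply/funext => K; rewrite seriesEnat /=.
    have := limit_value_mixture K i01; rewrite l1 => /eqP; rewrite -subr_eq => /eqP ->.
    apply: eq_bigr => k _; by rewrite expr1n mul1r.
  by rewrite -[X in _ --> X]subr0; apply: cvgB => //; exact: cvg_cst.
have ir k : lebesgue_measure.-integrable `[(0 : R), +oo[
    (fun a => (age_density a * ((1 * geom_ratio a) ^+ k / geom_den (1 - 1) a))%:E).
  apply: integrable_age_densityM => a a0; first exact: (rest_continuous i01).
  by have := rest_bounds i01 k a0; rewrite expr1n.
have [|||||_ _] := @dominated_convergence _ _ _ lebesgue_measure `[(0 : R), +oo[%classic (measurable_itv _)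
  (fun k a => (age_density a * ((1 * geom_ratio a) ^+ k / geom_den (1 - 1) a))%:E) (cst 0%E) (EFin \o age_density).
- by move=> k; have /integrableP[] := ir k.
- exact: measurable_cst.
- apply: aeW => a; rewrite /= in_itv/= andbT => a0.
  apply: cvg_EFin; first by near=> k.
  rewrite -[X in _ --> X](mulr0 (age_density a)); apply: cvgM; first exact: cvg_cst.
  rewrite -[X in _ --> X](mul0r (geom_den (1 - 1) a)^-1); apply: cvgM; last exact: cvg_cst.
  by apply: cvg_expr; rewrite mul1r ger0_norm ?geom_ratio_ge0// geom_ratio_lt1.
- exact: integrable_age_density.
- apply: aeW => a k; rewrite /= in_itv/= andbT => a0.
  have /andP[b0 b1] := rest_bounds i01 k a0.
  rewrite lee_fin ger0_norm; last exact: mulr_ge0 (ltW (age_density_gt0 a)) b0.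
  by rewrite ler_piMr ?(ltW (age_density_gt0 _))//; rewrite expr1n in b1.
rewrite integral0 => /fine_cvgP[_]; exact.
Unshelve. all: by end_near. Qed.

End mixture.

(** * The numbers c_k and q_k *)

Lemma cvg_integral_halfline (R : realType) (h : R -> R) (u : nat -> R) :
  nondecreasing_seq u -> (forall a : R, exists n, a <= u n) ->
  (forall a, 0 <= a -> {for a, continuous h}) ->
  (forall a, 0 <= a -> 0 <= h a) ->
  (\int[lebesgue_measure]_(a in `[0%R, u n]) (h a)%:E @[n --> \oo] -->
    \int[lebesgue_measure]_(a in `[0%R, +oo[) (h a)%:E)%E.
Proof.
move=> ndu uoo ch h0.
have mh : measurable_fun `[(0 : R), +oo[ (EFin \o h).
  apply/measurable_EFinP; apply: subspace_continuous_measurable_fun => //.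
  by apply: continuous_in_subspaceT => a; rewrite inE/= in_itv/= andbT; exact: ch.
rewrite (_ : `[0, +oo[%classic = \bigcup_n `[0%R, u n]%classic).
  apply: ge0_nondecreasing_set_cvg_integral.
  - move=> m n mn; rewrite subsetEset; apply: subset_itvl.
    by rewrite bnd_simp ndu.
  - by move=> n; exact: measurable_itv.
  - move=> n; apply: measurable_funS mh => //; apply: subset_itvl.
    by rewrite bnd_simp.
  - by move=> n a /=; rewrite in_itv/= lee_fin => /andP[a0 _]; exact: h0.
apply/seteqP; split => a /=; first rewrite in_itv/= andbT => a0.
  by have [n an] := uoo a; exists n => //=; rewrite in_itv/= a0.
by move=> [n _] /=; rewrite !in_itv/= => /andP[->].
Qed.

Section substitution.
Context (R : realType) (F f G : R -> R).
Hypothesis dF : forall a : R, 0 <= a -> is_derive a (1 : R) F (f a).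
Hypothesis cf : forall a : R, 0 <= a -> {for a, continuous f}.
Hypothesis F_lt : forall a b : R, 0 <= a -> a < b -> F a < F b.
Hypothesis F0 : F 0 = 0.

Let cF a : 0 <= a -> {for a, continuous F}.
Proof. by move=> a0; exact: is_derive_continuous (dF a0). Qed.

Let F'E (a : R) : 0 <= a -> (F : R -> R)^`()%classic a = f a.
Proof. by move=> a0; rewrite derive1E; have := dF a0 => ?; rewrite derive_val. Qed.

Lemma substitution_segment b : 0 < b ->
  (forall t, 0 <= t <= F b -> {for t, continuous G}) ->
  (\int[lebesgue_measure]_(t in `[0%R, F b]) (G t)%:E =
   \int[lebesgue_measure]_(a in `[0%R, b]) (G (F a) * f a)%:E)%E.
Proof.
move=> b0 cG; rewrite -{1}F0 integration_by_substitution_increasing//.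
- apply: eq_integral => a; rewrite inE/= in_itv/= => /andP[a0 _].
  by rewrite /= -F'E.
- exact: ltW.
- move=> x y; rewrite !in_itv/= => /andP[x0 _] _; exact: F_lt.
- move=> a; rewrite in_itv/= => /andP[a0 _].
  rewrite /continuous_at F'E ?ltW//.
  have ff : \forall x \near a, f x = (F : R -> R)^`()%classic x.
    by near=> x; rewrite F'E// ltW//; near: x; exact: lt_nbhsr.
  by apply: cvg_trans (cf (ltW a0)); apply: near_eq_cvg.
- apply/cvg_ex; exists (f 0).
  have : f x @[x --> 0^'+] --> f 0 by apply: cvg_at_right_filter; exact: cf.
  apply: cvg_trans; apply: near_eq_cvg.
  by near=> x; rewrite F'E.
- apply/cvg_ex; exists (f b).
  have : f x @[x --> b^'-] --> f b by apply: cvg_at_left_filter; apply: cf; exact: ltW.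
  apply: cvg_trans; apply: near_eq_cvg.
  by near=> x; rewrite F'E// ltW//.
- split.
  + move=> x; rewrite in_itv/= => /andP[x0 _]; by case: (dF (ltW x0)).
  + by apply: cvg_at_right_filter; exact: cF.
  + by apply: cvg_at_left_filter; exact/cF/ltW.
- apply: continuous_in_subspaceT => t; rewrite inE/= in_itv/= F0; exact: cG.
Unshelve. all: by end_near. Qed.

(** [G] may blow up at 1, so the interval is exhausted by the segments [0, F(n+1)], which [F] maps
    from [0, n+1], and both sides are limits of the segment version. *)
Lemma substitution_halfline :
  (forall a, 0 <= a -> F a < 1) -> F x @[x --> +oo] --> (1 : R) ->
  (forall a, 0 <= a -> 0 <= f a) ->
  (forall t, 0 <= t < 1 -> {for t, continuous G}) ->
  (forall t, 0 <= t < 1 -> 0 <= G t) ->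
  \int[lebesgue_measure]_(t in `[0, 1]) G t =
  \int[lebesgue_measure]_(a in `[(0 : R), +oo[) (G (F a) * f a).
Proof.
move=> F1 Fy f0 cG G0; rewrite /Rintegral; apply: (congr1 fine).
have mG : measurable_fun `[(0 : R), 1[ (EFin \o G).
  apply/measurable_EFinP; apply: subspace_continuous_measurable_fun => //.
  apply: continuous_in_subspaceT => t; rewrite inE/= in_itv/=; exact: cG.
have F_ge0 a : 0 <= a -> 0 <= F a.
  rewrite le_eqVlt => /predU1P[<-|a0]; first by rewrite F0.
  by rewrite -[leLHS]F0 ltW// F_lt.
rewrite -integral_itv_bndo_bndc//.
have F_le a b : 0 <= a -> a <= b -> F a <= F b.
  by move=> a0; rewrite le_eqVlt => /predU1P[->//|ab]; rewrite ltW// F_lt.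
have l1 : (\int[lebesgue_measure]_(t in `[0%R, F n.+1%:R]) (G t)%:E @[n --> \oo] -->
    \int[lebesgue_measure]_(t in `[0%R, 1%R[) (G t)%:E)%E.
  rewrite (_ : `[0, 1[%classic = \bigcup_n `[0%R, F n.+1%:R]%classic).
    apply: ge0_nondecreasing_set_cvg_integral.
    - apply/nondecreasing_seqP => n; rewrite subsetEset; apply: subset_itvl.
      by rewrite bnd_simp F_le// ler_nat.
    - by move=> n; exact: measurable_itv.
    - move=> n; apply: measurable_funS mG => //; apply: subset_itvl.
      by rewrite bnd_simp F1.
    - move=> n t /=; rewrite in_itv/= => /andP[t0 tF]; rewrite lee_fin G0// t0/=.
      by rewrite (le_lt_trans tF)// F1.
  apply/seteqP; split => t /=; first rewrite in_itv/= => /andP[t0 t1].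
    have : \forall x \near +oo, t < F x by apply: cvgr_gt t1.
    move=> [M [_ FM]].
    exists (Num.truncn `|M|)=> //=; rewrite in_itv/= t0/= ltW// FM//.
    by rewrite (le_lt_trans (ler_norm M))// truncnS_gt.
  move=> [n _] /=; rewrite !in_itv/= => /andP[t0 tF].
  by rewrite t0/= (le_lt_trans tF)// F1.
have GF0 a : 0 <= a -> 0 <= F a < 1 by move=> a0; rewrite F_ge0// F1.
have l2 : (\int[lebesgue_measure]_(a in `[0%R, n.+1%:R]) (G (F a) * f a)%:E @[n --> \oo] -->
    \int[lebesgue_measure]_(a in `[0%R, +oo[) (G (F a) * f a)%:E)%E.
  apply: (cvg_integral_halfline (h := fun a => G (F a) * f a)).
  - by apply/nondecreasing_seqP => n; rewrite ler_nat.
  - by move=> a; exists (Num.truncn a); rewrite ltW// truncnS_gt.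
  - move=> a a0; apply: cvgM; last exact: cf.
    by apply: continuous_comp; [exact: cF|apply/cG/GF0].
  - by move=> a a0; rewrite mulr_ge0 ?f0// G0// GF0.
rewrite -(cvg_lim _ l1)// -(cvg_lim _ l2)//; apply: (congr1 (fun u => lim (u @ \oo))).
apply/funext => n; apply: substitution_segment => // t /andP[t0 tF].
by apply: cG; rewrite t0 (le_lt_trans tF)// F1.
Qed.

End substitution.

Lemma cvg_expRN (R : realType) (c : R) : 0 < c ->
  expR (- c * x) @[x --> +oo] --> (0 : R).
Proof.
move=> c0; rewrite (_ : (fun x => expR (- c * x)) = (fun z => expR (- z)) \o (fun z => c * z)); last first.
  by apply: eq_fun => x; rewrite mulNr.
apply: (@cvg_comp _ _ _ _ _ _ (pinfty_nbhs R)); last exact: cvgr_expR.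
exact: gt0_cvgMry.
Qed.

Section limit_sequence.
Context (R : realType) (theta : R).
Hypothesis htheta : 0 < theta < 1.

Let theta_gt0 : 0 < theta. Proof. by case/andP: htheta. Qed.
Let mu_gt0 : 0 < 1 - theta. Proof. by rewrite subr_gt0; case/andP: htheta. Qed.
Let i01 : 0 <= (1 : R) <= 1. Proof. by rewrite ler01 lexx. Qed.

Notation D := (geom_den theta 1).
Notation rho := (geom_ratio theta).

Let D_gt0 a : 0 <= a -> 0 < D a.
Proof. by move=> a0; rewrite (lt_le_trans ltr01 (geom_den_ge1 htheta i01 a0)). Qed.

Definition geom_ratio' (a : R) : R := theta * expR (- (1 - 2 * theta) * a) / D a ^+ 2.

Lemma geom_ratio'_gt0 a : 0 <= a -> 0 < geom_ratio' a.
Proof. by move=> a0; rewrite divr_gt0 ?mulr_gt0 ?expR_gt0 ?exprn_gt0 ?D_gt0. Qed.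

Lemma is_derive_geom_ratio (a : R) : 0 <= a -> is_derive a (1 : R) rho (geom_ratio' a).
Proof.
move=> a0; have dD := is_derive_geom_den theta 1 a.
have dphi := is_derive_phi theta a.
have dn : D a != 0 by rewrite gt_eqF ?D_gt0.
have dV := is_deriveV dn dD.
have dN : is_derive a (1 : R) (fun a => theta * phi theta a : R) (theta * expR (- (1 - 2 * theta) * a)).
  by apply: is_derive_eq; rewrite /GRing.scale/=; ring.
rewrite /geom_ratio; apply: (is_derive_eq (is_deriveM dN dV)).
rewrite /GRing.scale/= /geom_ratio'; move: dn.
have -> : theta * phi theta a = D a - 1 by rewrite /geom_den; ring.
by move: (D a) (expR _) => u e un; field.
Qed.

Lemma continuous_geom_ratio' a : 0 <= a -> {for a, continuous geom_ratio'}.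
Proof.
move=> a0; apply: cvgM.
  apply: cvgM; first exact: cvg_cst.
  apply: continuous_comp; last exact: continuous_expR.
  by apply: cvgM; [exact: cvg_cst|exact: cvg_id].
apply: cvgV; first by rewrite expf_neq0// gt_eqF ?D_gt0.
apply: (@continuous_comp _ _ _ D (fun b => b ^+ 2)).
  exact: continuous_geom_den.
exact: exprn_continuous.
Qed.

Lemma phi_lt a b : a < b -> phi theta a < phi theta b.
Proof.
move=> ab; rewrite /phi; have [d0|d0|//] := ltgtP (1 - 2 * theta) 0.
  rewrite ltr_nM2r ?invr_lt0// ltrD2l ltrN2 ltr_expR.
  by rewrite ltr_pM2l// oppr_gt0.
rewrite ltr_pM2r ?invr_gt0// ltrD2l ltrN2 ltr_expR.
by rewrite ltr_nM2l// oppr_lt0.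
Qed.

Lemma geom_ratio_lt a b : 0 <= a -> a < b -> rho a < rho b.
Proof.
move=> a0 ab; have b0 := le_trans a0 (ltW ab).
rewrite -[ltLHS](subKr 1) -[ltRHS](subKr 1) !(geom_ratioC htheta)//.
rewrite ltrD2l ltrN2 ltf_pV2 ?posrE ?D_gt0// ltrD2l !mulr1.
by rewrite ltr_pM2l// phi_lt.
Qed.

Lemma geom_ratio_at0 : rho 0 = 0.
Proof. by rewrite /geom_ratio phi0 mulr0 mul0r. Qed.

Lemma cvg_geom_ratio_super : 1 - 2 * theta < 0 -> rho x @[x --> +oo] --> (1 : R).
Proof.
move=> d0; set de := 1 - 2 * theta in d0.
have e0 := cvg_expRN (_ : 0 < - de); rewrite oppr_gt0 in e0.
have {e0} := e0 d0; rewrite opprK => e0.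
(* Numerator and denominator are multiplied by exp ([de] a), which tends to 0, so that both
   converge. *)
rewrite [X in X @ _ --> _](_ : _ = (fun a => (theta * (expR (de * a) - 1) / de) /
   (expR (de * a) * (1 + theta / de) - theta / de))); last first.
  apply/funext => a; rewrite /geom_ratio /geom_den /phi -/de lt_eqF// mulNr expRN.
  have : expR (de * a) != 0 by rewrite gt_eqF ?expR_gt0.
  move: (expR _) => e en.
  have dn : de != 0 by rewrite lt_eqF.
  set N := theta * _; set M := (1 + _).
  have -> : theta * (e - 1) / de = N * e by rewrite /N; field; rewrite en dn.
  have -> : e * (1 + theta / de) - theta / de = M * e.
    by rewrite /M /N; field; rewrite en dn.
  by rewrite -mulf_div divff// mulr1.
have dn : de != 0 by rewrite lt_eqF.
rewrite [X in _ --> X](_ : 1 = (theta * (0 - 1) / de) / (0 * (1 + theta / de) - theta / de) :> R); last first.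
  by field; rewrite dn gt_eqF.
apply: cvgM.
  apply: cvgM; last exact: cvg_cst.
  by apply: cvgM; [exact: cvg_cst|apply: cvgB; [exact: e0|exact: cvg_cst]].
apply: cvgV.
  by rewrite mul0r sub0r oppr_eq0 mulf_eq0 invr_eq0 (negbTE dn) gt_eqF.
apply: cvgB; last exact: cvg_cst.
by apply: cvgM; [exact: e0|exact: cvg_cst].
Qed.

Lemma cvg_geom_ratio_sub : 0 < 1 - 2 * theta ->
  rho x @[x --> +oo] --> (gamma theta)^-1.
Proof.
move=> d0; set de := 1 - 2 * theta in d0.
have e0 := cvg_expRN d0.
have dn : de != 0 by rewrite gt_eqF.
have dt : de + theta != 0 by rewrite gt_eqF// addr_gt0.
have -> : (gamma theta)^-1 = (theta * ((1 - 0) / de)) / (1 + theta * ((1 - 0) / de) * 1).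
  rewrite /gamma invf_div (_ : 1 - theta = de + theta); last by rewrite /de; ring.
  by field; rewrite dn dt.
rewrite /geom_ratio; apply: cvgM.
  rewrite /phi -/de gt_eqF//; apply: cvgM; first exact: cvg_cst.
  by apply: cvgM; [apply: cvgB => //; exact: cvg_cst|exact: cvg_cst].
apply: cvgV.
  by rewrite mulr1 gt_eqF// addr_gt0// mulr_gt0// divr_gt0// subr0.
rewrite /geom_den /phi -/de gt_eqF//.
apply: cvgD; first exact: cvg_cst.
apply: cvgM; last exact: cvg_cst.
apply: cvgM; first exact: cvg_cst.
by apply: cvgM; [apply: cvgB => //; exact: cvg_cst|exact: cvg_cst].
Qed.

Notation gam := (gamma theta).
Notation bet := (beta theta).

Let gam_gt0 : 0 < gam. Proof. by rewrite divr_gt0. Qed.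

Let gam_theta : gam * theta = 1 - theta.
Proof. by rewrite divfK// gt_eqF. Qed.

Lemma geom_ratio_gamma a : 0 <= a ->
  1 - gam * rho a = expR (- (1 - 2 * theta) * a) / D a.
Proof.
move=> a0; have := D_gt0 a0; rewrite expR_phi /gamma /geom_ratio /geom_den !mulr1 => d0.
by field; rewrite gt_eqF//= gt_eqF.
Qed.

(** Every factor is a power of [D a] times an exponential. The powers of [D a] have exponents 1 +
    beta, 1 - beta and -2, which cancel, and beta (1 - 2 [theta]) = - [theta] leaves exp (- [theta]
    a). This is where the exponents in the definition of c_k come from. *)
Lemma powR_geom_ratio a : 0 <= a -> 1 - 2 * theta != 0 ->
  (1 - gam * rho a) `^ (- 1 - bet) * (1 - rho a) `^ (bet - 1) * geom_ratio' a =
  theta * expR (- theta * a).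
Proof.
move=> a0 d0; have Da := D_gt0 a0.
rewrite geom_ratio_gamma// geom_ratioC// /powR !gt_eqF ?invr_gt0 ?divr_gt0 ?expR_gt0//.
rewrite lnV ?posrE// ln_div ?posrE ?expR_gt0// expRK /geom_ratio'.
rewrite -[X in _ / X ^+ 2](lnK (x := D a)) ?posrE//; move: (ln _) => L.
rewrite -expRM_natl -expRN [LHS](_ : _ = theta * (expR ((- 1 - bet) * (- (1 - 2 * theta) * a - L)) *
  expR ((bet - 1) * - L) * expR (- (1 - 2 * theta) * a) * expR (- (2%:R * L)))); last by ring.
rewrite -!expRD; congr (_ * expR _).
by rewrite /beta; field; rewrite -oppr_eq0 opprB.
Qed.

Let integrand (g s1 s2 : R) (k : nat) (t : R) : R :=
  t ^+ k.+1 * (1 - t) `^ s1 / (1 - g * t) `^ s2.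

Let integrand_ge0 g s1 s2 k t : 0 <= t < 1 -> 0 <= integrand g s1 s2 k t.
Proof.
by move=> /andP[t0 t1]; rewrite !mulr_ge0 ?exprn_ge0 ?invr_ge0 ?powR_ge0.
Qed.

Let integrand_continuous g s1 s2 k t : 0 <= g <= 1 -> 0 <= t < 1 ->
  {for t, continuous (integrand g s1 s2 k)}.
Proof.
move=> /andP[g0 g1] /andP[t0 t1].
have pc (x s : R) : 0 < x -> {for x, continuous (fun x => x `^ s)}.
  by move=> x0; exact: is_derive_continuous (is_derive1_powR s x0).
have gt1 : 0 < 1 - g * t by rewrite subr_gt0 (le_lt_trans _ t1)// ler_piMl.
have c1 : {for t, continuous (fun t : R => (1 - t) `^ s1)}.
  apply: (@continuous_comp _ _ _ (fun t : R => 1 - t) (fun x : R => x `^ s1)).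
    by apply: cvgB; [exact: cvg_cst|exact: cvg_id].
  by apply: pc; rewrite subr_gt0.
have c2 : {for t, continuous (fun t : R => (1 - g * t) `^ s2)}.
  apply: (@continuous_comp _ _ _ (fun t : R => 1 - g * t) (fun x : R => x `^ s2)); last exact: pc.
  apply: cvgB; first exact: cvg_cst.
  by apply: cvgM; [exact: cvg_cst|exact: cvg_id].
apply: cvgM; first by apply: cvgM; [exact: exprn_continuous|exact: c1].
by apply: cvgV; [rewrite gt_eqF// powR_gt0|exact: c2].
Qed.

Definition c_density (k : nat) (a : R) : R :=
  (1 - theta) * expR (- theta * a) * rho a ^+ k.+1.

Let integrable_exp : lebesgue_measure.-integrable `[(0 : R), +oo[
  (EFin \o (fun a => (1 - theta) * expR (- theta * a))).
Proof.
apply/integrableP; split.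
  apply/measurable_EFinP; apply: measurable_funTS; apply: measurable_funM => //.
  by apply: measurableT_comp => //; apply: measurable_funM.
under eq_integral do rewrite gee0_abs ?lee_fin ?mulr_ge0 ?expR_ge0 ?(ltW mu_gt0)//.
by rewrite (integral_scaled_exponential theta_gt0 (ltW mu_gt0)) ltry.
Qed.

Lemma continuous_c_density k a : 0 <= a -> {for a, continuous (c_density k)}.
Proof.
move=> a0; apply: cvgM.
  apply: cvgM; first exact: cvg_cst.
  apply: continuous_comp; last exact: continuous_expR.
  by apply: cvgM; [exact: cvg_cst|exact: cvg_id].
apply: (@continuous_comp _ _ _ rho (fun b => b ^+ k.+1)).
  exact: continuous_geom_ratio.
exact: exprn_continuous.
Qed.

Lemma integrable_c_density k :
  lebesgue_measure.-integrable `[(0 : R), +oo[ (EFin \o c_density k).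
Proof.
apply: (le_integrable _ _ _ integrable_exp) => //.
  apply/measurable_EFinP; apply: subspace_continuous_measurable_fun => //.
  apply: continuous_in_subspaceT => a /set_mem /=; rewrite in_itv/= andbT.
  exact: continuous_c_density.
move=> a /=; rewrite in_itv/= andbT => a0.
rewrite lee_fin normrM ler_piMr// ger0_norm ?exprn_ge0 ?geom_ratio_ge0//.
by rewrite exprn_ile1 ?geom_ratio_ge0// ltW// geom_ratio_lt1.
Qed.

(** Common form of the two noncritical cases under t = l rho(a), with l = gamma below 1/2 and l = 1
    above. *)
Let c_E_noncritical (l g s1 s2 : R) k : 0 < l -> 0 <= g <= 1 ->
  (forall a, 0 <= a -> l * rho a < 1) -> l * rho x @[x --> +oo] --> (1 : R) ->
  (forall a, 0 <= a ->
     integrand g s1 s2 k (l * rho a) * (l * geom_ratio' a) = l ^+ k.+2 / gam * c_density k a) ->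
  \int[lebesgue_measure]_(t in `[0, 1]) integrand g s1 s2 k t =
  l ^+ k.+2 / gam * \int[lebesgue_measure]_(a in `[(0 : R), +oo[) c_density k a.
Proof.
move=> l0 g01 l1 ly lE.
have dF (a : R) : 0 <= a -> is_derive a (1 : R) (fun a => l * rho a : R) (l * geom_ratio' a).
  move=> a0; have da := is_derive_geom_ratio a0.
  by apply: is_derive_eq; rewrite /GRing.scale/=; ring.
rewrite (substitution_halfline dF).
- rewrite -RintegralZl//; last exact: integrable_c_density.
  by apply: eq_Rintegral => a /set_mem /=; rewrite in_itv/= andbT; exact: lE.
- by move=> a a0; apply: cvgM; [exact: cvg_cst|exact: continuous_geom_ratio'].
- by move=> a b a0 ab; rewrite ltr_pM2l// geom_ratio_lt.
- by rewrite geom_ratio_at0 mulr0.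
- exact: l1.
- exact: ly.
- by move=> a a0; rewrite mulr_ge0 ?ltW// geom_ratio'_gt0.
- by move=> t; exact: integrand_continuous.
- by move=> t; exact: integrand_ge0.
Qed.

(** At 1/2 the ratio is rho(a) = (a/2) / (1 + a/2). The substitution t = a/2 turns the right-hand
    side into the integral of [A], and A' = (k+1) [B] - [A] with [A] vanishing at both ends equates
    it with that of (k+1) [B]. All is done on [0, n+1] before passing to the limit. *)
Let c_E_critical k : theta = 2^-1 ->
  k.+1%:R * \int[lebesgue_measure]_(t in `[0, +oo[)
      (t ^+ k * expR (- t) / (1 + t) ^+ k.+2) =
  \int[lebesgue_measure]_(a in `[(0 : R), +oo[) c_density k a.
Proof.
move=> tE.
pose A (t : R) := expR (- t) * (t / (1 + t)) ^+ k.+1.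
pose B (t : R) := t ^+ k * expR (- t) / (1 + t) ^+ k.+2.
have t1_gt0 (t : R) : 0 <= t -> 0 < 1 + t by move=> t0; rewrite ltr_pwDl.
have dA (t : R) : 0 <= t -> is_derive t (1 : R) (fun t => - A t : R) (A t - k.+1%:R * B t).
  move=> t0; have tn : 1 + t != 0 by rewrite gt_eqF ?t1_gt0.
  have d1 : is_derive t (1 : R) (fun t => 1 + t : R) 1.
    apply: (is_derive_eq (is_deriveD (is_derive_cst (1 : R) t (1 : R)) (is_derive_id t (1 : R)))).
    by rewrite add0r.
  have dq := is_deriveM (is_derive_id t (1 : R)) (is_deriveV tn d1).
  have dX := is_deriveX k.+1 dq.
  have dE : is_derive t (1 : R) (fun t => expR (- t) : R) (- expR (- t)).
    by apply: is_derive_eq; rewrite /GRing.scale/=; ring.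
  rewrite (_ : (fun t => - A t) = - ((fun t => expR (- t) : R) * ((@id R) * (fun t => (1 + t)^-1)) ^+ k.+1)); last first.
    by apply/funext => u; rewrite !fctE.
  apply: (is_derive_eq (is_deriveN (is_deriveM dE dX))).
  rewrite /GRing.scale/= /A /B !fctE /= !exprMn !exprVn !exprS expr0.
  have : (1 + t) ^+ k != 0 by rewrite expf_neq0.
  by move: (t ^+ k) (_ ^+ k) (k.+1%:R) => x y c y0; field; rewrite y0 tn.
have cE1 (t : R) : {for t, continuous (fun t : R => expR (- t))}.
  by apply: continuous_comp; [apply: cvgN; exact: cvg_id|exact: continuous_expR].
have c1 (t : R) : {for t, continuous (fun t : R => 1 + t)}.
  by apply: cvgD; [exact: cvg_cst|exact: cvg_id].
have cB (t : R) : 0 <= t -> {for t, continuous B}.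
  move=> t0; apply: cvgM; first by apply: cvgM; [exact: exprn_continuous|exact: cE1].
  apply: cvgV; first by rewrite expf_neq0// gt_eqF ?t1_gt0.
  by apply: (@continuous_comp _ _ _ (fun t : R => 1 + t) (fun b : R => b ^+ k.+2)); [exact: c1|exact: exprn_continuous].
have cA (t : R) : 0 <= t -> {for t, continuous A}.
  move=> t0; apply: cvgM; first exact: cE1.
  apply: (@continuous_comp _ _ _ (fun t : R => t / (1 + t)) (fun b : R => b ^+ k.+1)); last exact: exprn_continuous.
  apply: cvgM; first exact: cvg_id.
  by apply: cvgV; [rewrite gt_eqF ?t1_gt0|exact: c1].
have A_ge0 t : 0 <= t -> 0 <= A t.
  by move=> t0; rewrite mulr_ge0 ?expR_ge0 ?exprn_ge0 ?divr_ge0 ?(ltW (t1_gt0 _ t0)).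
have B_ge0 t : 0 <= t -> 0 <= B t.
  by move=> t0; rewrite !mulr_ge0 ?expR_ge0 ?invr_ge0 ?exprn_ge0 ?(ltW (t1_gt0 _ t0)).
have cE n : (\int[lebesgue_measure]_(a in `[0%R, (2 * n.+1%:R)%R]) (c_density k a)%:E =
           \int[lebesgue_measure]_(t in `[0%R, n.+1%:R]) (A t)%:E)%E.
  have dh (a : R) : 0 <= a -> is_derive a (1 : R) (fun a => a / 2 : R) (2^-1).
    by move=> a0; apply: is_derive_eq; rewrite /GRing.scale/=; ring.
  rewrite [X in `[0%R, X]](_ : n.+1%:R = 2 * n.+1%:R / 2); last by rewrite mulrAC divff ?mul1r.
  rewrite (substitution_segment (F := fun a => a / 2) dh).
  - apply: eq_integral => a; rewrite inE/= in_itv/= => /andP[a0 _].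
    have an : 1 + a / 2 != 0 by rewrite gt_eqF// t1_gt0// divr_ge0.
    rewrite /c_density /A /geom_ratio /geom_den /phi tE divff// subrr eqxx mulr1.
    congr (_%:E); rewrite [2^-1 * a]mulrC (_ : 1 - 2^-1 = 2^-1); last by field.
    by rewrite [- 2^-1 * a]mulNr [2^-1 * a]mulrC; ring.
  - by move=> a a0; exact: cvg_cst.
  - by move=> a b _ ab; rewrite ltr_pM2r.
  - by rewrite mul0r.
  - by rewrite mulr_gt0.
  - by move=> t /andP[t0 _]; exact: cA.
have seg n : (\int[lebesgue_measure]_(t in `[0%R, n.+1%:R]) (k.+1%:R * B t)%:E =
    \int[lebesgue_measure]_(t in `[0%R, n.+1%:R]) (A t)%:E + (A n.+1%:R)%:E)%E.
  have cAB (t : R) : 0 <= t -> {for t, continuous (fun t => A t - k.+1%:R * B t)}.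
    by move=> t0; apply: cvgB; [exact: cA|apply: cvgM; [exact: cvg_cst|exact: cB]].
  have : (\int[lebesgue_measure]_(t in `[0%R, n.+1%:R]) (A t - k.+1%:R * B t)%:E = (- A n.+1%:R)%:E - (- A 0)%:E)%E.
    apply: (@continuous_FTC2 _ _ (fun t => - A t)) => //.
    + by apply: continuous_in_subspaceT => t; rewrite inE/= in_itv/= => /andP[t0 _]; exact: cAB.
    + have cNA (t : R) : 0 <= t -> {for t, continuous (fun t => - A t)}.
        by move=> t0; exact: is_derive_continuous (dA t t0).
      split.
      * by move=> t; rewrite in_itv/= => /andP[/ltW/dA[]].
      * by apply: cvg_at_right_filter; exact: cNA.
      * by apply: cvg_at_left_filter; exact: cNA.
    + move=> t; rewrite in_itv/= => /andP[/ltW/dA dAt _].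
      by rewrite derive1E derive_val.
  have A00 : A 0 = 0 by rewrite /A mul0r exprS mul0r mulr0.
  rewrite A00 oppr0 sube0 => AB.
  have iA : lebesgue_measure.-integrable `[(0 : R), n.+1%:R] (EFin \o A).
    apply: continuous_compact_integrable; first exact: segment_compact.
    by apply: continuous_in_subspaceT => t; rewrite inE/= in_itv/= => /andP[t0 _]; exact: cA.
  have iAB : lebesgue_measure.-integrable `[(0 : R), n.+1%:R] (EFin \o (fun t => A t - k.+1%:R * B t)).
    apply: continuous_compact_integrable; first exact: segment_compact.
    by apply: continuous_in_subspaceT => t; rewrite inE/= in_itv/= => /andP[t0 _]; exact: cAB.
  have -> : (A n.+1%:R)%:E = (- (\int[lebesgue_measure]_(t in `[0%R, n.+1%:R]) (A t - k.+1%:R * B t)%:E))%E.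
    by rewrite AB EFinN oppeK.
  rewrite -integralB_EFin//.
  by apply: eq_integral => t _; rewrite /= -EFinB; congr (_%:E); ring.
have A_cvg : (A n.+1%:R)%:E @[n --> \oo] --> 0%E.
  apply: cvg_EFin; first by near=> n.
  have n_cvg : (n.+1%:R : R) @[n --> \oo] --> +oo.
    by rewrite (cvg_shiftS (fun n => n%:R : R)); exact: cvgr_idn.
  have e0 := cvg_comp _ _ n_cvg (cvg_expRN (@ltr01 R)).
  apply: (squeeze_cvgr _ (cvg_cst 0) e0); near=> n.
  rewrite A_ge0//= mulN1r /A ler_piMr ?expR_ge0// exprn_ile1 ?divr_ge0 ?(ltW (t1_gt0 _ _))//.
  by rewrite ler_pdivrMr ?t1_gt0// mul1r lerDr.
have lC : (\int[lebesgue_measure]_(a in `[0%R, (2 * n.+1%:R)%R]) (c_density k a)%:E @[n --> \oo] -->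
    \int[lebesgue_measure]_(a in `[0%R, +oo[) (c_density k a)%:E)%E.
  apply: (cvg_integral_halfline (u := fun n => 2 * n.+1%:R)).
  - by apply/nondecreasing_seqP => n; rewrite ler_pM2l// ler_nat.
  - move=> a; exists (Num.truncn a); rewrite (le_trans (ltW (truncnS_gt _)))//.
    by rewrite ler_peMl// ler1n.
  - exact: continuous_c_density.
  - move=> a a0; rewrite mulr_ge0 ?exprn_ge0 ?geom_ratio_ge0//.
    by rewrite mulr_ge0 ?expR_ge0// ltW.
have lB : (\int[lebesgue_measure]_(a in `[0%R, n.+1%:R]) (k.+1%:R * B a)%:E @[n --> \oo] -->
    \int[lebesgue_measure]_(a in `[0%R, +oo[) (k.+1%:R * B a)%:E)%E.
  apply: (cvg_integral_halfline (u := fun n => n.+1%:R)).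
  - by apply/nondecreasing_seqP => n; rewrite ler_nat.
  - by move=> a; exists (Num.truncn a); rewrite ltW// truncnS_gt.
  - by move=> a a0; apply: cvgM; [exact: cvg_cst|exact: cB].
  - by move=> a a0; rewrite mulr_ge0// B_ge0.
have lB' : (\int[lebesgue_measure]_(a in `[0%R, n.+1%:R]) (k.+1%:R * B a)%:E @[n --> \oo] -->
    \int[lebesgue_measure]_(a in `[0%R, +oo[) (c_density k a)%:E)%E.
  have l : ((\int[lebesgue_measure]_(a in `[0%R, (2 * n.+1%:R)%R]) (c_density k a)%:E + (A n.+1%:R)%:E)%E @[n --> \oo] -->
      (\int[lebesgue_measure]_(a in `[0%R, +oo[) (c_density k a)%:E + 0)%E)%E.
    by apply: cvgeD => //; rewrite fin_num_adde_defl.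
  rewrite adde0 in l; apply: cvg_trans l.
  by apply: near_eq_cvg; near=> n; rewrite seg cE.
have BC : (\int[lebesgue_measure]_(a in `[0%R, +oo[) (k.+1%:R * B a)%:E =
    \int[lebesgue_measure]_(a in `[0%R, +oo[) (c_density k a)%:E)%E.
  by rewrite -(cvg_lim _ lB)// -(cvg_lim _ lB').
rewrite /Rintegral -BC.
under [in RHS]eq_integral do rewrite EFinM.
rewrite ge0_integralZl//; last 2 first.
- apply/measurable_EFinP; apply: subspace_continuous_measurable_fun => //.
  by apply: continuous_in_subspaceT => t; rewrite inE/= in_itv/= andbT; exact: cB.
- by move=> t; rewrite /= in_itv/= andbT lee_fin; exact: B_ge0.
(* If the integral were infinite, [fine] would send both sides to 0. *)
rewrite -/B; case: (integral _ _ _) => [r| |] //=.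
  by rewrite gt0_muley ?lte_fin// mulr0.
by rewrite gt0_muleNy ?lte_fin// mulr0.
Unshelve. all: by end_near. Qed.

Lemma c_E k : c_ theta k = \int[lebesgue_measure]_(a in `[(0 : R), +oo[) c_density k a.
Proof.
rewrite /c_; case: ltP => [t2|t2].
  have d0 : 0 < 1 - 2 * theta by lra.
  have g1 : 1 <= gam by rewrite /gamma ler_pdivlMr// mul1r; lra.
  rewrite (c_E_noncritical (l := gam)).
  - by rewrite [gam ^+ k.+2]exprSr mulfK ?gt_eqF// mulrA mulVf ?mul1r// expf_neq0// gt_eqF.
  - exact: gam_gt0.
  - by rewrite invr_ge0 ltW//= invf_le1.
  - by move=> a a0; rewrite -subr_gt0 geom_ratio_gamma// divr_gt0 ?expR_gt0 ?D_gt0.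
  - rewrite -[X in _ --> X](@divff _ gam) ?gt_eqF//.
    by apply: cvgM; [exact: cvg_cst|exact: cvg_geom_ratio_sub].
  - move=> a a0; rewrite /integrand mulKf ?gt_eqF//.
    have := powR_geom_ratio a0; rewrite gt_eqF// => /(_ isT).
    rewrite -[bet - 1]opprB powRN => e.
    rewrite [LHS](_ : _ = (gam * rho a) ^+ k.+1 * gam * (theta * expR (- theta * a))); last by rewrite -e; ring.
    rewrite /c_density exprMn [gam ^+ k.+2]exprSr mulfK ?gt_eqF// -gam_theta; ring.
case: eqVneq => [t2E|t2E].
  exact: c_E_critical.
have d0 : 1 - 2 * theta < 0 by move: t2; rewrite le_eqVlt eq_sym (negbTE t2E)/=; lra.
have g1 : gam <= 1 by rewrite /gamma ler_pdivrMr// mul1r; lra.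
rewrite (c_E_noncritical (l := 1)).
- by rewrite expr1n mul1r mulrA divff ?mul1r// gt_eqF.
- exact: ltr01.
- by rewrite ltW.
- by move=> a a0; rewrite mul1r geom_ratio_lt1.
- by under eq_fun do rewrite mul1r; exact: cvg_geom_ratio_super.
- move=> a a0; rewrite /integrand !mul1r.
  have := powR_geom_ratio a0; rewrite lt_eqF// => /(_ isT).
  rewrite -opprD powRN => e.
  rewrite [LHS](_ : _ = rho a ^+ k.+1 * (theta * expR (- theta * a))); last by rewrite -e; ring.
  by rewrite /c_density expr1n -gam_theta; field; rewrite gt_eqF.
Qed.

Let integrable_gamma_c k : lebesgue_measure.-integrable `[(0 : R), +oo[
  (EFin \o (fun a => gam * c_density k a)).
Proof.
rewrite [X in integrable _ _ X](_ : _ = (fun a => gam%:E * (c_density k a)%:E)%E); last by apply/funext => a /=; rewrite EFinM.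
by apply: integrableZl => //; exact: integrable_c_density.
Qed.

(** The weight 1 - gamma rho turns the density of c into that of the mixture. For k = 0 the part of
    c_(-1) is played by gamma, the integral of (1 - [theta]) exp (- [theta] a). *)
Lemma q_E k : q_ theta k = mixture theta k.
Proof.
have ageE a : 0 <= a -> (1 - theta) * expR (- theta * a) * (1 - gam * rho a) =
    age_density theta a / D a.
  move=> a0; rewrite geom_ratio_gamma// /age_density !mulrA; congr (_ / _).
  by rewrite -mulrA -expRD; congr (_ * expR _); ring.
case: k => [|k]; rewrite /q_ !c_E.
  have e1 : \int[lebesgue_measure]_(a in `[(0 : R), +oo[) ((1 - theta) * expR (- theta * a)) = gam.
    by rewrite /Rintegral (integral_scaled_exponential theta_gt0 (ltW mu_gt0)).
  rewrite mulrBr mulr1 -{1}e1 -RintegralZl//; last exact: integrable_c_density.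
  rewrite -RintegralB//.
  apply: eq_Rintegral => a /set_mem /=; rewrite in_itv/= andbT => /ageE e.
  by rewrite expr0 mul1r -e /c_density expr1; ring.
rewrite -RintegralZl//; last exact: integrable_c_density.
rewrite -RintegralB//; last exact: integrable_c_density.
apply: eq_Rintegral => a /set_mem /=; rewrite in_itv/= andbT => /ageE e.
rewrite [RHS](_ : _ = rho a ^+ k.+1 * (age_density theta a / D a)); last by ring.
by rewrite -e /c_density [rho a ^+ k.+2]exprSr; ring.
Qed.

End limit_sequence.

(** * Convergence of the degree distribution *)

Section process.
Context d (T : measurableType d) (R : realType) (P : probability T R).
Variables (theta : R) (X : nat -> bool -> nat -> {RV P >-> R}).

Let w (x : T) : waits R := fun v c j => X v c j x.

(** The random history takes finitely many values, so it may be fixed on each piece. *)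
Lemma measurable_choices_set m (A : seq (nat * bool) -> set T) :
  (forall q, measurable (A q)) ->
  measurable [set x | A (choices (w x) m) x].
Proof.
move=> mA; rewrite (_ : [set x | _] =
  \bigcup_(q in [set q | q \in paths m]) (path_event X q `&` A q)).
  apply: fin_bigcup_measurable; first exact: finite_seq.
  by move=> q _; apply: measurableI => //; exact: measurable_path_event.
apply/seteqP; split => x /=.
  move=> Ax; exists (choices (w x) m); first exact: choices_paths.
  by split => //; rewrite /path_event /= (size_paths (choices_paths _ _)).
move=> [q qm [+ Aq]]; rewrite /path_event /= (size_paths qm) => ->.
exact: Aq.
Qed.

Lemma measurable_choices_fun m d' (Y : measurableType d')
    (F : seq (nat * bool) -> T -> Y) :
  (forall q, measurable_fun setT (F q)) ->
  measurable_fun setT (fun x => F (choices (w x) m) x).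
Proof.
move=> mF _ B mB; rewrite setTI.
apply: (@measurable_choices_set m (fun q => F q @^-1` B)) => q.
exact: measurable_preimage.
Qed.

Definition tau m x : R := ring_time (w x) (choices (w x) m).

Lemma measurable_tau m : measurable_fun setT (tau m).
Proof.
apply: (@measurable_choices_fun m _ _ (fun q x => ring_time (w x) q : measurableTypeR R)) => q.
by have [] := measurable_run X q.
Qed.

Lemma path_event_choices m q x : q \in paths m -> path_event X q x ->
  choices (w x) m = q.
Proof. by move=> qm; rewrite /path_event /= (size_paths qm). Qed.

Lemma integral_paths m (g : T -> \bar R) :
  measurable_fun setT g -> (forall x, 0 <= g x)%E ->
  (\int[P]_x g x = \sum_(q <- paths m) \int[P]_(x in path_event X q) g x)%E.
Proof.
move=> mg g0; elim: m => [|m IH].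
  rewrite big_seq1 (_ : path_event X [::] = setT)//.
  by apply/seteqP; split.
rewrite IH big_allpairs_dep; apply: eq_big_seq => q qm.
exact: integral_path_event.
Qed.

Hypotheses (htheta : 0 < theta < 1) (hX : poisson_clocks theta X).

Lemma rate_gt0 c : 0 < rate theta c.
Proof. by move/andP: htheta => [t0 t1]; rewrite /rate; case: c; rewrite ?subr_gt0. Qed.

Section one_step.
Variables (m : nat) (Phi : seq (nat * bool) -> nat * bool ->
  measurableTypeR R * measurableTypeR R -> \bar R).
Hypothesis mPhi : forall q p, measurable_fun setT (Phi q p).
Hypothesis Phi_ge0 : forall q p z, (0 <= Phi q p z)%E.

(* The conditional expectation of [Phi] over the next ring, given the history q
   and the time u of its last ring. *)
Definition drift q (u : R) : \bar R := (\sum_(p <- clocks q)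
  \int[lebesgue_measure]_(s in `[0%R, +oo[)
     (Phi q p (u, s) * (rate theta p.2 * expR (- (last_vertex q).+1%:R * s))%:E))%E.

Let integrand_ge0 q p u s :
  (0 <= Phi q p (u, s) * (rate theta p.2 * expR (- (last_vertex q).+1%:R * s))%:E)%E.
Proof. by rewrite mule_ge0// lee_fin mulr_ge0 ?expR_ge0// ltW// rate_gt0. Qed.

Let measurable_term q p : measurable_fun setT (fun u : measurableTypeR R =>
  \int[lebesgue_measure]_(s in `[0%R, +oo[)
     (Phi q p (u, s) * (rate theta p.2 * expR (- (last_vertex q).+1%:R * s))%:E))%E.
Proof.
set N : R := (last_vertex q).+1%:R; have N0 : 0 < N by rewrite ltr0n.
(* The factor [rate] / N is moved into the integrand, so that the delay is integrated against the
   exponential law of rate N. *)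
have mf : measurable_fun setT (fun z => Phi q p z * (rate theta p.2 / N)%:E)%E.
  by apply: emeasurable_funM => //; exact: measurable_cst.
have f0 z : (0 <= Phi q p z * (rate theta p.2 / N)%:E)%E.
  by rewrite mule_ge0// lee_fin divr_ge0 ?ltW// rate_gt0.
rewrite [X in measurable_fun _ X](_ : _ = (fun u : measurableTypeR R =>
  \int[lebesgue_measure]_(s in `[0%R, +oo[)
     (Phi q p (u, s) * (rate theta p.2 / N)%:E * (N * expR (- N * s))%:E))%E).
  exact: measurable_integral_exponential N0 mf f0.
apply/funext => u; apply: eq_integral => s _.
by rewrite -muleA -EFinM mulrA divfK// gt_eqF.
Qed.

Lemma drift_ge0 q u : (0 <= drift q u)%E.
Proof. by apply: sume_ge0 => p _; apply: integral_ge0. Qed.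

Lemma measurable_drift q : measurable_fun setT (drift q : measurableTypeR R -> \bar R).
Proof. by apply: emeasurable_sum. Qed.

Let measurable_drift_path q : measurable_fun setT (fun x => drift q (ring_time (w x) q)).
Proof.
have mr : measurable_fun setT (fun x => ring_time (w x) q : measurableTypeR R).
  by have [] := measurable_run X q.
exact: measurableT_comp (measurable_drift q) mr.
Qed.

Lemma measurable_drift_choices :
  measurable_fun setT (fun x => drift (choices (w x) m) (tau m x)).
Proof. exact: measurable_choices_fun measurable_drift_path. Qed.

(** One-step conditioning. [G] has to be described only on each history of length m+1, through the
    previous ring time and the last delay. *)
Lemma integral_next (G : T -> \bar R) :
  measurable_fun setT G -> (forall x, 0 <= G x)%E ->
  (forall q p x, q \in paths m -> p \in clocks q -> path_event X (rcons q p) x ->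
    G x = Phi q p (ring_time (w x) q, residual (w x) q (p, 0%N))) ->
  (\int[P]_x G x = \int[P]_x drift (choices (w x) m) (tau m x))%E.
Proof.
move=> mG G0 GE.
rewrite (integral_paths m.+1)// [RHS](integral_paths m); last 2 first.
- exact: measurable_drift_choices.
- by move=> x; exact: drift_ge0.
rewrite big_allpairs_dep; apply: eq_big_seq => q qm.
transitivity (\int[P]_(x in path_event X q) drift q (ring_time (w x) q))%E; last first.
  apply: eq_integral => x /set_mem qx.
  by rewrite /tau (path_event_choices qm qx).
rewrite ge0_integral_sum//; last 3 first.
- exact: measurable_path_event.
- move=> p; apply: measurable_funTS.
  have mr : measurable_fun setT (fun x => ring_time (w x) q : measurableTypeR R).
    by have [] := measurable_run X q.
  exact: (measurableT_comp (measurable_term q p) mr).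
- by move=> p x _; apply: integral_ge0.
apply: eq_big_seq => p pq.
rewrite -(integral_step htheta (memoryless_paths htheta hX qm) pq)//.
by apply: eq_integral => x /set_mem; exact: GE.
Qed.

End one_step.

Lemma tau_next m q p x : q \in paths m -> p \in clocks q ->
  path_event X (rcons q p) x ->
  [/\ choices (w x) m = q, choices (w x) m.+1 = rcons q p, tau m x = ring_time (w x) q &
      tau m.+1 x = ring_time (w x) q + residual (w x) q (p, 0%N)].
Proof.
move=> qm pq qpx.
have qx : choices (w x) m = q.
  by apply: path_event_choices => //; move: qpx; rewrite path_event_rcons => -[].
have qpxE : choices (w x) m.+1 = rcons q p.
  by apply: path_event_choices => //; rewrite mem_paths_rcons qm.
by rewrite /tau qx qpxE ring_time_rcons.
Qed.

(** The waits are nonnegative only almost surely, so the order of the ring times has to be recovered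
    up to a null event. *)
Lemma tau_decrease_null m : P [set x | tau m.+1 x < tau m x] = 0%E.
Proof.
have mA : measurable [set x | tau m.+1 x < tau m x].
  by apply: measurable_ltr_set; exact: measurable_tau.
pose neg := [set z : measurableTypeR R * measurableTypeR R | z.2 < 0].
have mneg : measurable neg.
  rewrite (_ : neg = snd @^-1` (`]-oo, 0[%classic : set (measurableTypeR R))).
    by apply: measurable_preimage => //; exact: measurable_snd.
  by apply/seteqP; split => z /=; rewrite in_itv.
transitivity (\int[P]_x (\1_[set x | tau m.+1 x < tau m x] x)%:E)%E.
  by rewrite integral_indic// setIT.
rewrite (@integral_next m (fun _ _ z => (\1_neg z)%:E)).
- rewrite (eq_integral (cst 0%E)) ?integral0// => x _.
  rewrite /drift big1// => p _; rewrite -[RHS](@integral0 _ _ R lebesgue_measure `[0%R, +oo[%classic).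
  apply: eq_integral => s /set_mem /=; rewrite in_itv/= andbT => s0.
  by rewrite indicE memNset ?mul0e// /neg /= ltNge s0.
- by move=> _ _; exact/measurable_EFinP/measurable_indic.
- by move=> _ _ z; rewrite lee_fin.
- exact/measurable_EFinP/measurable_indic.
- by move=> x; rewrite lee_fin.
- move=> q p x qm pq /(tau_next qm pq)[_ _ t0 t1]; congr (_%:E).
  by rewrite !indicE; congr (nat_of_bool _)%:R; apply/idP/idP; rewrite !inE /neg /= t0 t1 gtrDl.
Qed.

(** With N vertices the delay is exponential of rate N and E exp(-delay) = N / (N+1). After m rings
    N is at most m+1, so the factor is at most (m+1) / (m+2) and the product telescopes. *)
Lemma integral_expR_tau m : (\int[P]_x (expR (- tau m x))%:E <= (m.+1%:R^-1)%:E)%E.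
Proof.
have mE n : measurable_fun setT (fun x => (expR (- tau n x))%:E).
  apply/measurable_EFinP; apply: measurableT_comp => //; apply: measurableT_comp => //.
  exact: measurable_tau.
elim: m => [|m IH].
  rewrite (eq_integral (cst 1%E)); last by move=> x _; rewrite /tau /ring_time /= oppr0 expR0.
  by rewrite integral_cst// mul1e invr1 probability_le1.
have E_ge0 (u : R) : (0 <= (expR u)%:E)%E by rewrite lee_fin expR_ge0.
rewrite (@integral_next m (fun _ _ z => (expR (- (z.1 + z.2)))%:E))//; last 2 first.
- move=> _ _; apply/measurable_EFinP; apply: measurableT_comp => //; apply: measurableT_comp => //.
  exact: measurable_funD.
- by move=> q p x qm pq /(tau_next qm pq)[_ _ _ ->].
have c0 : 0 <= m.+1%:R / m.+2%:R :> R by [].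
apply: (@le_trans _ _ (\int[P]_x ((m.+1%:R / m.+2%:R)%:E * (expR (- tau m x))%:E))%E).
  apply: ge0_le_integral => //.
  - by move=> x _; exact: drift_ge0.
  - apply: measurable_drift_choices => // _ _; apply/measurable_EFinP.
    apply: measurableT_comp => //; apply: measurableT_comp => //.
    exact: measurable_funD.
  - by apply: emeasurable_funM => //; exact: measurable_cst.
  move=> x _; set q := choices _ _; set u := tau m x.
  have qm : (last_vertex q <= m)%N by apply: last_vertex_paths; exact: choices_paths.
  have N0 : 0 < (last_vertex q).+2%:R :> R by rewrite ltr0n.
  rewrite /drift (eq_bigr (fun p => (expR (- u) * rate theta p.2 / (last_vertex q).+2%:R)%:E)); last first.
    move=> p _; rewrite -(integral_scaled_exponential N0); last first.
      by rewrite mulr_ge0 ?expR_ge0// ltW// rate_gt0.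
    apply: eq_integral => s _; rewrite -EFinM /=; congr (_%:E).
    rewrite mulrCA -expRD [RHS]mulrAC -expRD mulrC; congr (expR _ * _).
    by rewrite -[(last_vertex q).+2%:R]natr1; ring.
  rewrite sumEFin -mulr_suml -mulr_sumr sum_rate_clocks -EFinM lee_fin.
  rewrite -mulrA [leRHS]mulrC ler_wpM2l ?expR_ge0// ler_pdivrMr// mulrAC ler_pdivlMr//.
  by rewrite -!natrM ler_nat; lia.
rewrite ge0_integralZl//.
apply: (@le_trans _ _ ((m.+1%:R / m.+2%:R)%:E * (m.+1%:R^-1)%:E)%E).
  by apply: lee_wpmul2l.
by rewrite -EFinM lee_fin mulrAC divff ?mul1r// pnatr_eq0.
Qed.

Lemma measurable_last_vertex m (f : nat -> R) :
  measurable_fun setT (fun x => f (last_vertex (choices (w x) m))).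
Proof. exact: (@measurable_choices_fun m _ _ (fun q x => f (last_vertex q) : measurableTypeR R)). Qed.

(** Whatever the history, the next ring is a duplication with probability [theta], so each ring
    contributes the factor (1 - [theta]) + [theta] / 2. *)
Lemma integral_last_vertex m :
  (\int[P]_x (2^-1 ^+ last_vertex (choices (w x) m))%:E = ((1 - theta / 2) ^+ m)%:E)%E.
Proof.
elim: m => [|m IH].
  rewrite (eq_integral (cst 1%E))// integral_cst// mul1e expr0.
  exact: probability_setT.
have h0 (n : nat) : (0 <= (2^-1 ^+ n : R)%:E)%E by rewrite lee_fin exprn_ge0// invr_ge0.
have c0 : 0 <= 1 - theta / 2 by case/andP: htheta => t0 t1; lra.
rewrite (@integral_next m (fun q p _ => (2^-1 ^+ (last_vertex q + p.2))%:E))//; last 2 first.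
- exact/measurable_EFinP/(measurable_last_vertex m.+1 (fun n => 2^-1 ^+ n)).
- by move=> q p x qm pq /(tau_next qm pq)[_ -> _ _]; rewrite last_vertex_rcons.
rewrite exprS EFinM -IH -ge0_integralZl//; last first.
  exact/measurable_EFinP/(measurable_last_vertex m (fun n => 2^-1 ^+ n)).
apply: eq_integral => x _; set q := choices _ _; set u := tau m x.
have N0 : 0 < (last_vertex q).+1%:R :> R by rewrite ltr0n.
rewrite /drift (eq_bigr (fun p => (2^-1 ^+ last_vertex q / (last_vertex q).+1%:R *
    (2^-1 ^+ (p.2 : bool) * rate theta p.2))%:E)); last first.
  move=> p _.
  transitivity ((2^-1 ^+ (last_vertex q + p.2) * rate theta p.2) / (last_vertex q).+1%:R)%:E; last first.
    by congr (_%:E); rewrite exprD; field; rewrite gt_eqF.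
  rewrite -(integral_scaled_exponential N0); last first.
    by rewrite mulr_ge0 ?exprn_ge0 ?invr_ge0// ltW// rate_gt0.
  by apply: eq_integral => s _; rewrite -EFinM mulrA.
rewrite sumEFin -EFinM -mulr_sumr; congr (_%:E).
rewrite big_allpairs_dep (eq_bigr (fun=> 1 - theta / 2)); last first.
  by move=> v _; rewrite !big_cons big_nil /= addr0 /rate; field.
rewrite big_const_seq count_predT size_iota iter_addr_0 -[(1 - theta / 2) *+ _]mulr_natl.
by rewrite -mulrA mulKf ?gt_eqF// mulrC.
Qed.

End process.

(** * The value function as a conditional expectation *)

Lemma continuous_sum_seq (R : realType) (I : Type) (s : seq I) (f : I -> R -> R) (t : R) :
  (forall i, {for t, continuous (f i)}) ->
  {for t, continuous (fun t => \sum_(i <- s) f i t)}.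
Proof.
move=> cf; elim: s => [|i s IH].
  rewrite (_ : (fun t => _) = (fun=> 0)); first exact: cvg_cst.
  by apply/funext => u; rewrite big_nil.
rewrite (_ : (fun t => _) = (fun t => f i t + \sum_(i <- s) f i t)).
  by apply: cvgD; [exact: cf|exact: IH].
by apply/funext => u; rewrite big_cons.
Qed.

Section drift_value.
Context (R : realType) (theta : R).
Hypothesis htheta : 0 < theta < 1.
Variable z : R.
Hypothesis z01 : 0 <= z <= 1.

Let y01 : 0 <= 1 - z <= 1.
Proof. by case/andP: z01 => z0 z1; rewrite subr_ge0 z1 gerBl z0. Qed.

Definition future_value (t : R) n : R := value theta (1 - z) (Num.max t 0) n.

Lemma future_valueE t n : 0 <= t -> future_value t n = value theta (1 - z) t n.
Proof. by move=> t0; rewrite /future_value (max_idPl t0). Qed.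

Lemma future_value_ge0 t n : 0 <= future_value t n.
Proof. by apply: value_ge0 => //; rewrite le_max lexx orbT. Qed.

Lemma measurable_future_value n : measurable_fun setT (future_value ^~ n).
Proof.
apply: continuous_measurable_fun.
by apply: (continuous_comp_max (f := fun t => value theta (1 - z) t n)) => t; exact: continuous_value.
Qed.

Variables (m : nat) (q : seq (nat * bool)) (i : nat).
Hypotheses (qm : q \in paths m) (iq : (i <= last_vertex q)%N).

Let n := path_degree q i.
Let N : R := (last_vertex q).+1%:R.
Let N0 : 0 < N. Proof. by rewrite ltr0n. Qed.
Let F (t : R) := value theta (1 - z) t n.
Let S (t : R) := \sum_(p <- clocks q) rate theta p.2 * value theta (1 - z) t (path_degree (rcons q p) i).

Let dF (t : R) : 0 <= t -> is_derive t (1 : R) F (S t - N * F t).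
Proof.
move=> t0; apply: (is_derive_eq (is_derive_value htheta y01 n t0)).
rewrite /S /rate (sum_path_degree _ _ (value theta (1 - z) t) qm iq) -/n /N /F.
have nq : (n <= last_vertex q)%N := path_degree_edge qm iq.
rewrite natrB// -[n.+1%:R]natr1 -[(last_vertex q).+1%:R]natr1; ring.
Qed.

Let cS (t : R) : 0 <= t -> {for t, continuous S}.
Proof.
move=> t0; apply: continuous_sum_seq => p.
by apply: cvgM; [exact: cvg_cst|exact: continuous_value].
Qed.

(* With a remaining time T0, the value after a delay s until the next ring, which
   is the ring of the clock p. *)
Definition waiting_value (T0 s : R) (p : nat * bool) : R :=
  if T0 < s then z ^+ n else future_value (T0 - s) (path_degree (rcons q p) i).

Lemma waiting_value_ge0 T0 s p : 0 <= waiting_value T0 s p.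
Proof.
rewrite /waiting_value; case: ifP => _; last exact: future_value_ge0.
by rewrite exprn_ge0//; case/andP: z01.
Qed.

(** Up to T0 the integral is that of [integral_renewal]. The event that no ring comes before T0 adds
    z^n exp (- N T0), which cancels the boundary term there because [value] at time 0 is z^n. *)
Lemma sum_waiting_value T0 : 0 <= T0 ->
  (\sum_(p <- clocks q) \int[lebesgue_measure]_(s in `[0%R, +oo[)
     ((waiting_value T0 s p)%:E * (rate theta p.2 * expR (- N * s))%:E) =
   (value theta (1 - z) T0 n)%:E)%E.
Proof.
move=> T00; have z0 : 0 <= z by case/andP: z01.
have rp c : 0 <= rate theta c by rewrite ltW// rate_gt0.
have mexp r : measurable_fun setT (fun s : R => r * expR (- N * s)).
  by apply: measurable_funM => //; apply: measurableT_comp => //; apply: measurable_funM.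
have mW p : measurable_fun setT (fun s => waiting_value T0 s p).
  apply: measurable_fun_ifT.
  - exact: measurable_fun_ltr.
  - exact: measurable_cst.
  - apply: (measurableT_comp (measurable_future_value _)); exact: measurable_funB.
have mterm p : measurable_fun setT (fun s : R =>
    ((waiting_value T0 s p)%:E * (rate theta p.2 * expR (- N * s))%:E)%E).
  by apply: emeasurable_funM; exact/measurable_EFinP.
have term_ge0 p s : (0 <= (waiting_value T0 s p)%:E * (rate theta p.2 * expR (- N * s))%:E)%E.
  by rewrite mule_ge0// lee_fin ?waiting_value_ge0// mulr_ge0 ?expR_ge0.
rewrite -ge0_integral_sum//; last by move=> p; apply: measurable_funTS; exact: mterm.
have -> : `[0, +oo[%classic = `[0, T0] `|` `]T0, +oo[ :> set R.
  by rewrite -itv_bndbnd_setU// bnd_simp.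
rewrite ge0_integral_setU//; last 3 first.
- by apply: measurable_funTS; apply: emeasurable_sum.
- by move=> s _; apply: sume_ge0.
- by apply/disj_setPS => s [/=]; rewrite !in_itv/= andbT => /andP[_ sT /(le_lt_trans sT)]; rewrite ltxx.
rewrite (eq_integral (fun s : measurableTypeR R => (S (T0 - s) * expR (- N * s))%:E)); last first.
  move=> s; rewrite inE/= in_itv/= => /andP[s0 sT].
  rewrite /S mulr_suml -sumEFin; apply: eq_bigr => p _; rewrite -EFinM; congr (_%:E).
  by rewrite /waiting_value ltNge sT /= future_valueE ?subr_ge0//; ring.
rewrite (integral_renewal N0 T00 dF cS).
rewrite (eq_integral (fun s : measurableTypeR R => (z ^+ n)%:E * (N * expR (- N * s))%:E)%E); last first.
  move=> s; rewrite inE/= in_itv/= andbT => sT.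
  rewrite /N -(sum_rate_clocks theta) mulr_suml -sumEFin ge0_sume_distrr//; last first.
    by move=> p _; rewrite lee_fin mulr_ge0 ?expR_ge0.
  by apply: eq_bigr => p _; rewrite /waiting_value sT.
rewrite ge0_integralZl//; last 3 first.
- by apply/measurable_EFinP; apply: measurable_funTS; exact: mexp.
- by move=> s _; rewrite lee_fin mulr_ge0 ?expR_ge0// ltW.
- by rewrite lee_fin exprn_ge0.
rewrite integral_exponential_ray// -EFinM -EFinD /F value0 subKr; congr (_%:E); ring.
Qed.

End drift_value.

Lemma le_integral_off_null d (T : measurableType d) (R : realType)
    (mu : {measure set T -> \bar R}) (A : set T) (f g : T -> \bar R) :
  measurable A -> mu A = 0%E ->
  measurable_fun setT f -> measurable_fun setT g ->
  (forall x, 0 <= f x)%E -> (forall x, 0 <= g x)%E ->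
  (forall x, ~ A x -> f x <= g x)%E ->
  (\int[mu]_x f x <= \int[mu]_x g x)%E.
Proof.
move=> mA A0 mf mg f0 g0 fg.
have mC := measurableC mA.
have C0 : mu (setT `\` ~` A) = 0%E by rewrite setTD setCK.
rewrite (ge0_integral_null_diff mC measurableT (@subsetT _ _) C0 mf f0).
rewrite (ge0_integral_null_diff mC measurableT (@subsetT _ _) C0 mg g0).
by apply: ge0_le_integral => //; exact: measurable_funTS.
Qed.

Lemma measurable_fun_if_set d (T : measurableType d) (R : realType) (b : T -> bool) (f : T -> R) :
  measurable [set x | b x] -> measurable_fun setT f ->
  measurable_fun setT (fun x => if b x then f x else 0).
Proof.
move=> mb mf; apply: measurable_fun_ifT => //.
apply: (@measurable_fun_bool _ _ _ _ true); rewrite setTI.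
exact: mb.
Qed.

Lemma last_vertex_count q : last_vertex q = count snd q.
Proof.
elim/last_ind: q => // q p IH.
by rewrite last_vertex_rcons IH -cats1 count_cat /= addn0.
Qed.

Lemma last_vertex_take m q : (last_vertex (take m q) <= last_vertex q)%N.
Proof.
by rewrite !last_vertex_count -[X in (_ <= count _ X)%N](cat_take_drop m) count_cat leq_addr.
Qed.

Lemma take_choices (R : realType) (w : waits R) m l : (m <= l)%N ->
  take m (choices w l) = choices w m.
Proof.
have sz n : size (choices w n) = n := size_paths (choices_paths w n).
elim: l => [|l IH]; first by rewrite leqn0 => /eqP ->.
rewrite leq_eqVlt => /predU1P[->|ml].
  by rewrite -{1}(sz l.+1) take_size.
by rewrite /= -cats1 takel_cat ?sz// IH.
Qed.

Section value_process.
Context d (T : measurableType d) (R : realType) (P : probability T R).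
Variables (theta : R) (X : nat -> bool -> nat -> {RV P >-> R}).
Hypotheses (htheta : 0 < theta < 1) (hX : poisson_clocks theta X).

Let w (x : T) : waits R := fun v c j => X v c j x.
Local Notation tau := (tau X).

Variables (z : R) (i m0 : nat) (t : R).
Hypothesis z01 : 0 <= z <= 1.

Definition born x := (i <= last_vertex (choices (w x) m0))%N.

(* [expected l] is the conditional expectation of z^d(t) after the l-th ring if
   that ring occurs before t; [observed l] is z^d(t) if t lies between the l-th
   and the next ring. *)
Definition expected l x : R :=
  if born x && (tau l x <= t) then future_value theta z (t - tau l x) (path_degree (choices (w x) l) i) else 0.

Definition observed l x : R :=
  if born x && (tau l x <= t < tau l.+1 x) then z ^+ path_degree (choices (w x) l) i else 0.

Lemma expected_ge0 l x : 0 <= expected l x.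
Proof. by rewrite /expected; case: ifP => // _; exact: future_value_ge0. Qed.

Lemma observed_ge0 l x : 0 <= observed l x.
Proof. by rewrite /observed; case: ifP => // _; rewrite exprn_ge0//; case/andP: z01. Qed.

Lemma measurable_born : measurable [set x | born x].
Proof.
apply: (@measurable_choices_set _ _ _ _ X m0 (fun q _ => (i <= last_vertex q)%N)) => q.
case: (i <= last_vertex q)%N.
  by rewrite (_ : (fun=> _) = setT)//; apply/seteqP; split.
by rewrite (_ : (fun=> _) = set0)//; apply/seteqP; split.
Qed.

Lemma measurable_path_degree l (f : nat -> R) :
  measurable_fun setT (fun x => f (path_degree (choices (w x) l) i)).
Proof.
exact: (@measurable_choices_fun _ _ _ _ X l _ _ (fun q _ => f (path_degree q i) : measurableTypeR R)).
Qed.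

Lemma measurable_expected l : measurable_fun setT (expected l).
Proof.
apply: measurable_fun_if_set => //.
  rewrite (_ : [set x | _] = [set x | born x] `&` [set x | tau l x <= t]).
    apply: measurableI; first exact: measurable_born.
    by apply: measurable_ler_set => //; exact: measurable_tau.
  by apply/seteqP; split => x /= => [/andP[]|[-> ->]].
apply: (@measurable_choices_fun _ _ _ _ X l _ _ (fun q x =>
  future_value theta z (t - tau l x) (path_degree q i) : measurableTypeR R)) => q.
apply: (measurableT_comp (measurable_future_value htheta z01 _)).
by apply: measurable_funB => //; exact: measurable_tau.
Qed.

Lemma measurable_observed l : measurable_fun setT (observed l).
Proof.
apply: measurable_fun_if_set => //; last exact: (measurable_path_degree l (fun k => z ^+ k)).
rewrite (_ : [set x | _] = [set x | born x] `&` ([set x | tau l x <= t] `&` [set x | t < tau l.+1 x])).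
  apply: measurableI; first exact: measurable_born.
  by apply: measurableI; [apply: measurable_ler_set|apply: measurable_ltr_set] => //; exact: measurable_tau.
by apply/seteqP; split => x /= => [/and3P[]|[-> [-> ->]]].
Qed.

(** After the l-th ring, either t comes before the next ring and the degree at t is already known,
    or the expectation is taken again after that ring. *)
Lemma integral_expected_step l : (m0 <= l)%N ->
  (\int[P]_x (expected l x)%:E = \int[P]_x (observed l x)%:E + \int[P]_x (expected l.+1 x)%:E)%E.
Proof.
move=> ml.
(* Whether the vertex was born by the m0-th ring is read off from the prefix [take m0 q], which
   makes it a function of the history. *)
pose Phi q p (u : measurableTypeR R * measurableTypeR R) : \bar R :=
  (if (i <= last_vertex (take m0 q))%N && (u.1 <= t) then waiting_value theta z q i (t - u.1) u.2 p else 0)%:E.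
(* The condition on the l-th ring, present in [Phi], is imposed on the next term too; this changes
   it only where ring times decrease. *)
pose next x := if tau l x <= t then expected l.+1 x else 0.
have mnext : measurable_fun setT next.
  apply: measurable_fun_if_set => //; last exact: measurable_expected.
  by apply: measurable_ler_set => //; exact: measurable_tau.
have next_ge0 x : 0 <= next x by rewrite /next; case: ifP => // _; exact: expected_ge0.
have mO := measurable_observed l.
have nextE : (\int[P]_x (expected l.+1 x)%:E = \int[P]_x (next x)%:E)%E.
  have mN : measurable [set x | tau l.+1 x < tau l x].
    by apply: measurable_ltr_set; exact: measurable_tau.
  have N0 := tau_decrease_null htheta hX l.
  have mE := measurable_expected l.+1.
  apply/eqP; rewrite eq_le; apply/andP; split.
    apply: (le_integral_off_null mN N0) => //; try exact/measurable_EFinP.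
    - by move=> x; rewrite lee_fin expected_ge0.
    move=> x /negP; rewrite -leNgt => tl; rewrite lee_fin /next.
    case: ifPn => //; rewrite -ltNge /expected => tt.
    by rewrite [_ <= t]leNgt (lt_le_trans tt tl) andbF.
  apply: ge0_le_integral => //.
  - by move=> x _; rewrite lee_fin.
  - exact/measurable_EFinP.
  - exact/measurable_EFinP.
  - by move=> x _; rewrite lee_fin /next; case: ifP => // _; exact: expected_ge0.
rewrite nextE -ge0_integralD//; last 4 first.
- by move=> x _; rewrite lee_fin observed_ge0.
- exact/measurable_EFinP.
- by move=> x _; rewrite lee_fin.
- exact/measurable_EFinP.
have z0 : 0 <= z by case/andP: z01.
have W0 q p T0 s : 0 <= waiting_value theta z q i T0 s p.
  exact: waiting_value_ge0.
rewrite [RHS](@integral_next _ _ _ P theta X htheta hX l Phi).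
- apply: eq_integral => x _; apply/esym; rewrite /expected /born /drift.
  rewrite -(take_choices (w x) ml); set q := choices (w x) l.
  have qm : q \in paths l := choices_paths (w x) l.
  rewrite /Phi; case: ifPn => [/andP[iq ut]|nb]; last first.
    rewrite big1// => p _; rewrite -[RHS](@integral0 _ _ R lebesgue_measure `[0%R, +oo[%classic).
    by apply: eq_integral => s _; rewrite mul0e.
  have iq' := leq_trans iq (last_vertex_take m0 q).
  rewrite future_valueE ?subr_ge0// -(sum_waiting_value htheta z01 qm iq') ?subr_ge0//.
- move=> q p; apply/measurable_EFinP.
  apply: (@measurable_fun_if_set _ (measurableTypeR R * measurableTypeR R)%type).
    case: (i <= _)%N => /=.
      by apply: measurable_ler_set => //; exact: measurable_fst.
    by rewrite (_ : [set _ | _] = set0)//; apply/seteqP; split.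
  apply: measurable_fun_ifT.
  + apply: measurable_fun_ltr; last exact: measurable_snd.
    by apply: measurable_funB => //; exact: measurable_fst.
  + exact: measurable_cst.
  + apply: (measurableT_comp (measurable_future_value htheta z01 _)).
    apply: measurable_funB; last exact: measurable_snd.
    by apply: measurable_funB => //; exact: measurable_fst.
- by move=> q p u; rewrite lee_fin; case: ifP => // _; exact: W0.
- by apply: emeasurable_funD; exact/measurable_EFinP.
- by move=> x; rewrite adde_ge0 ?lee_fin// observed_ge0.
- move=> q p x ql pq qpx; have [q0 q1 t0 t1] := tau_next ql pq qpx.
  rewrite -EFinD /Phi /observed /next /expected /born t0 t1.
  rewrite [choices (w x) l.+1]q1 -(take_choices (w x) ml) [choices (w x) l]q0 /=.
  case: (i <= _)%N => /=; last by case: ifP; rewrite addr0.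
  move: (ring_time _ q) (residual _ q (p, 0%N)) => u s.
  case: (leP u t) => ut /=; last by rewrite addr0.
  rewrite /waiting_value ltrBlDl; rewrite leNgt; case: ltP => ts /=; first by rewrite addr0.
  by rewrite add0r opprD addrA.
Qed.

End value_process.

Section ge0_integral_fin.
Context d (T : measurableType d) (R : realType) (P : probability T R).

Lemma ge0_integral_sum_fin (I : Type) (s : seq I) (f : I -> T -> R) :
  (forall i, measurable_fun setT (f i)) -> (forall i x, 0 <= f i x) ->
  (\int[P]_x (\sum_(i <- s) f i x)%R%:E = \sum_(i <- s) \int[P]_x (f i x)%:E)%E.
Proof.
move=> mf f0; under eq_integral do rewrite -sumEFin.
rewrite ge0_integral_sum//; last by move=> i x _; rewrite lee_fin.
by move=> i; exact/measurable_EFinP.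
Qed.

Lemma ge0_integralD_fin (f g : T -> R) :
  measurable_fun setT f -> measurable_fun setT g ->
  (forall x, 0 <= f x) -> (forall x, 0 <= g x) ->
  (\int[P]_x (f x + g x)%R%:E = \int[P]_x (f x)%:E + \int[P]_x (g x)%:E)%E.
Proof.
move=> mf mg f0 g0; under eq_integral do rewrite EFinD.
by rewrite ge0_integralD//; try (by move=> x _; rewrite lee_fin); exact/measurable_EFinP.
Qed.

Lemma ge0_integralZ_fin (f : T -> R) (c : R) :
  measurable_fun setT f -> (forall x, 0 <= f x) -> 0 <= c ->
  (\int[P]_x (c * f x)%R%:E = c%:E * \int[P]_x (f x)%:E)%E.
Proof.
move=> mf f0 c0; under eq_integral do rewrite EFinM.
by rewrite ge0_integralZl//; try (by move=> x _; rewrite lee_fin); exact/measurable_EFinP.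
Qed.

Lemma integral_indic_setT (A : set T) : measurable A ->
  (\int[P]_x (\1_A x)%:E = P A)%E.
Proof. by move=> mA; rewrite integral_indic// setIT. Qed.

End ge0_integral_fin.

Lemma sum_pow_pred1 (R : pzRingType) (z : R) (b : bool) (n K : nat) :
  \sum_(0 <= k < K) z ^+ k * (b && (n == k))%:R = (if b && (n < K)%N then z ^+ n else 0).
Proof.
case: b => /=; last by rewrite big1// => k _; rewrite mulr0.
elim: K => [|K IH]; first by rewrite big_nil.
rewrite big_nat_recr//= IH ltnS; case: ltngtP => [_|_|->] /=.
- by rewrite mulr0 addr0.
- by rewrite mulr0 addr0.
- by rewrite add0r mulr1.
Qed.

Lemma sum_nat_pred1 (V : nmodType) (a : V) (m n l0 : nat) (F : nat -> V) :
  (forall l, F l = if l == l0 then a else 0) ->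
  \sum_(m <= l < n) F l = if (m <= l0 < n)%N then a else 0.
Proof.
move=> FE; under eq_bigr do rewrite FE.
have [mn|mn] := leqP n m.
  rewrite big_geq//; case: ifP => // /andP[m0 n0].
  by have := leq_ltn_trans m0 n0; rewrite ltnNge mn.
elim: n mn {FE} => // n IH; rewrite ltnS => mn; rewrite big_nat_recr//= ltnS.
move: mn; rewrite leq_eqVlt => /predU1P[<-|mn].
  rewrite big_geq// add0r; by case: ltngtP.
rewrite IH//; case: (ltngtP l0 n) => [_|_|->] /=.
- by rewrite addr0.
- by rewrite addr0.
- by rewrite andbF andbT (ltnW mn) add0r.
Qed.

(** * Comparison of degree events with the telescoping sum *)

Section comparison.
Context d (T : measurableType d) (R : realType) (P : probability T R).
Variables (theta : R) (X : nat -> bool -> nat -> {RV P >-> R}).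
Hypotheses (htheta : 0 < theta < 1) (hX : poisson_clocks theta X).

Let w (x : T) : waits R := fun v c j => X v c j x.
Local Notation tau := (tau X).

Variables (i : nat).

Lemma degree_chain (x : T) l : degree (chain (w x) l) i = path_degree (choices (w x) l) i.
Proof.
have [[nE eE _] _] := chain_choices (w x) l.
rewrite /degree /path_degree -nE -eE cardsE cardE -size_filter.
by rewrite -val_enum_ord filter_map size_map [enum 'I__]enumT /enum_mem.
Qed.

Definition current (t : R) l x : bool := tau l x <= t < tau l.+1 x.

Lemma degree_eventE t k : degree_event X i t k = \bigcup_l [set x |
  [/\ current t l x, (i <= last_vertex (choices (w x) l))%N & path_degree (choices (w x) l) i = k]].
Proof.
have tE l x : time (chain (w x) l) = tau l x.
  by have [[_ _ ->] _] := chain_choices (w x) l.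
have nE l x : newest (chain (w x) l) = last_vertex (choices (w x) l).
  by have [[-> _ _] _] := chain_choices (w x) l.
apply/seteqP; split => x.
  move=> [s [[l [-> tl]] iq dk]]; exists l => //; split.
  - by rewrite /current -!tE.
  - by rewrite -nE.
  - by rewrite -degree_chain.
move=> [l _ [tl iq dk]]; exists (chain (w x) l); split.
- by exists l; split => //; rewrite !tE.
- by rewrite nE.
- by rewrite degree_chain.
Qed.

Lemma measurable_current t l : measurable [set x | current t l x].
Proof.
rewrite (_ : [set x | _] = [set x | tau l x <= t] `&` [set x | t < tau l.+1 x]).
  by apply: measurableI; [apply: measurable_ler_set|apply: measurable_ltr_set] => //; exact: measurable_tau.
by apply/seteqP; split => x /= => [/andP[]|[tl tl1]]; last exact/andP.
Qed.

Lemma measurable_degree_event t k : measurable (degree_event X i t k).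
Proof.
rewrite degree_eventE; apply: bigcup_measurable => l _.
rewrite (_ : [set x | _] = [set x | current t l x] `&` [set x |
  (fun q (_ : T) => (i <= last_vertex q)%N && (path_degree q i == k)) (choices (w x) l) x]); last first.
  apply/seteqP; split => x /= => [[tl iq /eqP dk]|[tl /andP[iq /eqP dk]]]; last by [].
  by split => //; rewrite iq.
apply: measurableI; first exact: measurable_current.
apply: (@measurable_choices_set _ _ _ _ X l (fun q _ => (i <= last_vertex q)%N && (path_degree q i == k))) => q.
case: (_ && _).
  by rewrite (_ : (fun=> _) = setT)//; apply/seteqP; split.
by rewrite (_ : (fun=> _) = set0)//; apply/seteqP; split.
Qed.

Variables (z : R) (m0 M K : nat) (t T1 : R).
Hypotheses (z01 : 0 <= z <= 1) (m0M : (m0 <= M)%N) (T10 : 0 <= T1).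

Local Notation born := (born X i m0).
Local Notation expected := (expected theta X z i m0 t).
Local Notation observed := (observed X z i m0 t).
Local Notation D := (degree_event X i t).

Let z0 : 0 <= z. Proof. by case/andP: z01. Qed.
Let z1 : z <= 1. Proof. by case/andP: z01. Qed.

(* Outside of this event the vertex is born at the m0-th ring, this ring comes at
   least T1 before t, and the M-th ring comes after t. *)
Definition atypical : set T :=
  ~` [set x | born x] `|` [set x | t - T1 < tau m0 x] `|` [set x | tau M x <= t].

Lemma measurable_atypical : measurable atypical.
Proof.
apply: measurableU; first apply: measurableU.
- by apply: measurableC; exact: measurable_born.
- by apply: measurable_ltr_set => //; exact: measurable_tau.
- by apply: measurable_ler_set => //; exact: measurable_tau.
Qed.

Section pointwise.
Variable x : T.
Hypothesis tauS : forall l, tau l x <= tau l.+1 x.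

Let tau_le l l' : (l <= l')%N -> tau l x <= tau l' x.
Proof. by move=> ll; apply: (homo_leq (f := tau ^~ x) (r := <=%O)) ll => //; exact: le_trans. Qed.

Let current_uniq l l' : current t l x -> current t l' x -> l = l'.
Proof.
move=> /andP[a b] /andP[a' b'].
have [ll|ll|//] := ltngtP l l'.
  by have := lt_le_trans b (le_trans (tau_le ll) a'); rewrite ltxx.
by have := lt_le_trans b' (le_trans (tau_le ll) a); rewrite ltxx.
Qed.

Let degrees := \sum_(0 <= k < K) z ^+ k * \1_(D k) x.
Let observations := \sum_(m0 <= l < M) observed l x.

Let no_current : (forall l, ~ current t l x) -> degrees = 0 /\ observations = 0.
Proof.
move=> nc; split; rewrite /degrees /observations big1// => k _.
  rewrite indicE memNset ?mulr0// degree_eventE => -[l _ [/nc]].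
  by [].
rewrite /observed; case: ifP => // /andP[_]; by move=> /nc.
Qed.

Let one_current l : current t l x ->
  degrees = (if (i <= last_vertex (choices (w x) l))%N && (path_degree (choices (w x) l) i < K)%N
    then z ^+ path_degree (choices (w x) l) i else 0) /\
  observations = (if (m0 <= l < M)%N then (if born x then z ^+ path_degree (choices (w x) l) i else 0) else 0).
Proof.
move=> cl; split.
  rewrite /degrees -sum_pow_pred1; apply: eq_bigr => k _; congr (_ * _).
  rewrite indicE; congr (nat_of_bool _)%:R; apply/idP/idP.
    by rewrite inE degree_eventE => -[l' _ [/(current_uniq cl) <- -> ->]]; rewrite eqxx.
  by move=> /andP[iq /eqP dk]; rewrite inE degree_eventE; exists l.
apply: sum_nat_pred1 => l'; rewrite /observed -/(current t l' x).
case: eqVneq => [->|ll]; first by rewrite cl andbT.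
case: ifP => // /andP[_ cl']; by rewrite (current_uniq cl cl') eqxx in ll.
Qed.

Let pow_le1 n : 0 <= z ^+ n <= 1.
Proof. by rewrite exprn_ge0// exprn_ile1. Qed.

Let typical : ~ atypical x -> [/\ born x, tau m0 x <= t & t < tau M x].
Proof.
move=> /not_orP[/not_orP[/contrapT bx /negP] + /negP].
rewrite -leNgt -ltNge => tm tM; split => //.
by rewrite (le_trans tm)// gerBl.
Qed.

Let typical_current l : ~ atypical x -> current t l x ->
  (i <= last_vertex (choices (w x) l))%N /\
  observations = z ^+ path_degree (choices (w x) l) i.
Proof.
move=> /typical[bx tm tM] cl; have /andP[tl tl1] := cl.
have ml : (m0 <= l)%N.
  rewrite leqNgt; apply/negP => lm; have := lt_le_trans tl1 (le_trans (tau_le lm) tm).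
  by rewrite ltxx.
have lM : (l < M)%N.
  rewrite ltnNge; apply/negP => Ml; have := lt_le_trans tM (le_trans (tau_le Ml) tl).
  by rewrite ltxx.
split; last by have [_ ->] := one_current cl; rewrite ml lM bx.
by rewrite (leq_trans bx)// -(take_choices _ ml) last_vertex_take.
Qed.

(** When the ring times are ordered at most one index is current at t, so both sums have at most one
    nonzero term, a power of z in [0, 1]. Off [atypical], [degrees] can only lose that term by the
    truncation at K. *)
Lemma degrees_le : degrees <= observations + \1_atypical x.
Proof.
have [[l cl]|nc] := pselect (exists l, current t l x); last first.
  by have [|-> ->] := no_current; [move=> l cl; apply: nc; exists l|rewrite add0r].
have [dE oE] := one_current cl; set n := path_degree _ _ in dE oE.
have /andP[zn0 zn1] := pow_le1 n.
have [ax|nax] := pselect (atypical x).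
  have /andP[d0 d1] : 0 <= degrees <= 1 by rewrite dE; case: ifP => // _; rewrite lexx ler01.
  have /andP[s0 s1] : 0 <= observations <= 1.
    by rewrite oE; do 2 (case: ifP => _; last by rewrite lexx ler01).
  by rewrite indicE mem_set// (le_trans d1)// lerDr.
have [iq ->] := typical_current nax cl.
by rewrite indicE memNset// addr0 dE iq /=; case: ifP.
Qed.

Lemma observations_le : observations <= degrees + (z ^+ K + \1_atypical x).
Proof.
have zK0 := exprn_ge0 K z0.
have [[l cl]|nc] := pselect (exists l, current t l x); last first.
  by have [|-> ->] := no_current; [move=> l cl; apply: nc; exists l|rewrite add0r addr_ge0].
have [dE oE] := one_current cl; set n := path_degree _ _ in dE oE.
have /andP[zn0 zn1] := pow_le1 n.
have [ax|nax] := pselect (atypical x).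
  have /andP[d0 d1] : 0 <= degrees <= 1 by rewrite dE; case: ifP => // _; rewrite lexx ler01.
  have /andP[s0 s1] : 0 <= observations <= 1.
    by rewrite oE; do 2 (case: ifP => _; last by rewrite lexx ler01).
  by rewrite indicE mem_set// (le_trans s1)// addrA lerDr addr_ge0.
have [iq ->] := typical_current nax cl.
rewrite indicE memNset// addr0 dE iq /=; case: ltnP => Kn; first by rewrite lerDl.
by rewrite add0r -/n -(subnK Kn) exprD ler_piMl// exprn_ile1.
Qed.

End pointwise.

Let y01 : 0 <= 1 - z <= 1.
Proof. by rewrite subr_ge0 z1 gerBl z0. Qed.

(** A crude bound, from a limit at most 1 and a distance to it at most 1; it only multiplies the
    probability of [atypical]. *)
Let future_value_le2 s n : future_value theta z s n <= 2.
Proof.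
have s0 : 0 <= Num.max s 0 by rewrite le_max lexx orbT.
have := value_dist htheta y01 n s0; rewrite -/(future_value theta z s n) ler_norml => /andP[_].
have /andP[_ l1] := limit_value_bounds htheta y01.
have : expR (- (1 - theta) * Num.max s 0) <= 1.
  by rewrite -[leRHS]expR0 ler_expR mulNr oppr_le0 mulr_ge0// subr_ge0; case/andP: htheta => _ /ltW.
lra.
Qed.

Let expected_le2 l x : expected l x <= 2.
Proof. by rewrite /expected; case: ifP. Qed.

Lemma expected_late_le x : expected M x <= 2 * \1_atypical x.
Proof.
rewrite /expected; case: ifP => [/andP[_ tM]|_]; last by rewrite mulr_ge0.
by rewrite indicE mem_set ?mulr1//; right.
Qed.

Let typical_expected x : ~ atypical x ->
  `|expected m0 x - limit_value theta (1 - z)| <= expR (- (1 - theta) * T1).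
Proof.
move=> /not_orP[/not_orP[/contrapT bx /negP] + _]; rewrite -leNgt => tm.
have tT : T1 <= t - tau m0 x by lra.
have t0 : 0 <= t - tau m0 x by exact: le_trans T10 tT.
rewrite /expected bx /= ifT; last by rewrite -subr_ge0.
rewrite future_valueE// (le_trans (value_dist htheta y01 _ t0))//.
by rewrite ler_expR !mulNr lerN2 ler_wpM2l// subr_ge0; case/andP: htheta => _ /ltW.
Qed.

Lemma expected_early_le x :
  expected m0 x <= (limit_value theta (1 - z) + expR (- (1 - theta) * T1)) + 2 * \1_atypical x.
Proof.
have /andP[l0 _] := limit_value_bounds htheta y01.
have e0 := expR_ge0 (- (1 - theta) * T1).
rewrite indicE; have [ax|nax] := pselect (atypical x).
  by rewrite mem_set//= mulr1; have := expected_le2 m0 x; lra.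
rewrite memNset//= mulr0 addr0.
by have := typical_expected nax; rewrite ler_norml => /andP[_]; lra.
Qed.

Lemma expected_early_ge x :
  limit_value theta (1 - z) <= expected m0 x + (expR (- (1 - theta) * T1) + \1_atypical x).
Proof.
have /andP[_ l1] := limit_value_bounds htheta y01.
have e0 := expR_ge0 (- (1 - theta) * T1).
have E0 : 0 <= expected m0 x by exact: expected_ge0.
rewrite indicE; have [ax|nax] := pselect (atypical x).
  by rewrite mem_set//=; lra.
rewrite memNset//= addr0.
by have := typical_expected nax; rewrite ler_norml => /andP[+ _]; lra.
Qed.

End comparison.

(** * From generating functions to degree probabilities *)

Section degree_law.
Context d (T : measurableType d) (R : realType) (P : probability T R).
Variables (theta : R) (X : nat -> bool -> nat -> {RV P >-> R}).
Hypotheses (htheta : 0 < theta < 1) (hX : poisson_clocks theta X).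
Local Notation tau := (tau X).

Variables (i : nat).

Let disorder : set T := \bigcup_l [set x | tau l.+1 x < tau l x].

Let measurable_disorder : measurable disorder.
Proof.
by apply: bigcup_measurable => l _; apply: measurable_ltr_set; exact: measurable_tau.
Qed.

Let disorder_null : P disorder = 0%E.
Proof.
apply/negligibleP => //; apply: negligible_bigcup => l.
apply/negligibleP; first by apply: measurable_ltr_set; exact: measurable_tau.
exact: tau_decrease_null htheta hX l.
Qed.

Let orderly x : ~ disorder x -> forall l, tau l x <= tau l.+1 x.
Proof. by move=> nx l; rewrite leNgt; apply/negP => lx; apply: nx; exists l. Qed.

Section bounds.
Variables (z : R) (m0 M K : nat) (t T1 : R).
Hypotheses (z01 : 0 <= z <= 1) (m0M : (m0 <= M)%N) (T10 : 0 <= T1).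

Local Notation D := (degree_event X i t).
Local Notation A := (atypical X i m0 M t T1).
Local Notation L := (limit_value theta (1 - z)).

Let z0 : 0 <= z. Proof. by case/andP: z01. Qed.

(** The pointwise comparisons are integrated around the telescoped identity from m0 to M. The factor
    4 comes from the lower bound: 1 for the observations, 2 for the expectation left at M, 1 for the
    expectation at m0. *)
Lemma degree_pgf_dist :
  `|\sum_(0 <= k < K) z ^+ k * fine (P (D k)) - L| <=
  z ^+ K + expR (- (1 - theta) * T1) + 4 * fine (P A).
Proof.
have mA : measurable A by exact: measurable_atypical.
have mD k : measurable (D k) by exact: measurable_degree_event.
have mO l : measurable_fun setT (observed X z i m0 t l) by exact: measurable_observed.
have mE l : measurable_fun setT (expected theta X z i m0 t l) by exact: measurable_expected.
have O0 l x : 0 <= observed X z i m0 t l x by exact: observed_ge0.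
have E0 l x : 0 <= expected theta X z i m0 t l x by exact: expected_ge0.
have mI B : measurable B -> measurable_fun setT (\1_B : T -> R) by move=> mB; exact: measurable_indic.
have /andP[L0 _] : 0 <= L <= 1.
  by apply: limit_value_bounds => //; case/andP: z01 => z0' z1'; rewrite subr_ge0 z1' gerBl z0'.
set e := expR _; have e0 : 0 <= e by exact: expR_ge0.
have mS : measurable_fun setT (fun x => \sum_(0 <= k < K) z ^+ k * \1_(D k) x).
  by apply: measurable_sum => k; apply: measurable_funM => //; exact: mI.
have mOs : measurable_fun setT (fun x => \sum_(m0 <= l < M) observed X z i m0 t l x).
  exact: measurable_sum.
have S0 x : 0 <= \sum_(0 <= k < K) z ^+ k * \1_(D k) x.
  by apply: sumr_ge0 => k _; rewrite mulr_ge0 ?exprn_ge0.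
have Os0 x : 0 <= \sum_(m0 <= l < M) observed X z i m0 t l x by exact: sumr_ge0.
have PA := fineK (fin_num_measure P _ mA); move: (fine (P A)) PA => a PA.
have zK0 := exprn_ge0 K z0.
have SE : (\int[P]_x (\sum_(0 <= k < K) z ^+ k * \1_(D k) x)%:E =
    (\sum_(0 <= k < K) z ^+ k * fine (P (D k)))%:E)%E.
  rewrite ge0_integral_sum_fin; last 2 first.
  - by move=> k; apply: measurable_funM => //; exact: mI.
  - by move=> k x; rewrite mulr_ge0 ?exprn_ge0.
  rewrite -sumEFin; apply: eq_bigr => k _.
  rewrite ge0_integralZ_fin ?exprn_ge0//.
  by rewrite integral_indic_setT// EFinM fineK// fin_num_measure.
have tele : (\int[P]_x (\sum_(m0 <= l < M) observed X z i m0 t l x)%:E +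
    \int[P]_x (expected theta X z i m0 t M x)%:E =
    \int[P]_x (expected theta X z i m0 t m0 x)%:E)%E.
  rewrite ge0_integral_sum_fin//; move: m0M; elim: M => [|n IH].
    by rewrite leqn0 => /eqP ->; rewrite big_geq// add0e.
  rewrite leq_eqVlt => /predU1P[->|]; first by rewrite big_geq// add0e.
  rewrite ltnS => mn; rewrite big_nat_recr//= -addeA.
  by rewrite -integral_expected_step// IH.
have intc c : (\int[P]_x c%:E = c%:E)%E.
  by rewrite -[RHS]mule1 -(probability_setT P); exact: integral_cst.
have intA : (\int[P]_x (\1_A x)%:E = a%:E)%E by rewrite integral_indic_setT// PA.
have h1 : (\int[P]_x (\sum_(0 <= k < K) z ^+ k * \1_(D k) x)%:E <=
    \int[P]_x (\sum_(m0 <= l < M) observed X z i m0 t l x)%:E + a%:E)%E.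
  rewrite -intA -ge0_integralD_fin//.
  apply: (le_integral_off_null measurable_disorder disorder_null).
  - exact/measurable_EFinP.
  - by apply/measurable_EFinP; apply: measurable_funD => //; exact: mI.
  - by move=> x; rewrite lee_fin.
  - by move=> x; rewrite lee_fin addr_ge0.
  - by move=> x /orderly nx; rewrite lee_fin; exact: degrees_le.
have h2 : (\int[P]_x (\sum_(m0 <= l < M) observed X z i m0 t l x)%:E <=
    \int[P]_x (\sum_(0 <= k < K) z ^+ k * \1_(D k) x)%:E + (z ^+ K + a)%:E)%E.
  have -> : ((z ^+ K + a)%:E = \int[P]_x (z ^+ K + \1_A x)%:E)%E.
    rewrite ge0_integralD_fin//.
    by rewrite intA intc EFinD.
  rewrite -ge0_integralD_fin//; last 2 first.
  - by apply: measurable_funD => //; exact: mI.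
  - by move=> x; rewrite addr_ge0.
  apply: (le_integral_off_null measurable_disorder disorder_null).
  - exact/measurable_EFinP.
  - by apply/measurable_EFinP; apply: measurable_funD => //; apply: measurable_funD => //; exact: mI.
  - by move=> x; rewrite lee_fin.
  - by move=> x; rewrite lee_fin !addr_ge0.
  - by move=> x /orderly nx; rewrite lee_fin; exact: observations_le.
have h3 : (\int[P]_x (expected theta X z i m0 t M x)%:E <= (2 * a)%:E)%E.
  rewrite EFinM -intA -ge0_integralZ_fin//.
  apply: ge0_le_integral => //; try (by move=> x _; rewrite lee_fin).
  - exact/measurable_EFinP.
  - by apply/measurable_EFinP; apply: measurable_funM => //; exact: mI.
  - by move=> x _; rewrite lee_fin; exact: expected_late_le.
have h4 : (\int[P]_x (expected theta X z i m0 t m0 x)%:E <= (L + e + 2 * a)%:E)%E.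
  have -> : ((L + e + 2 * a)%:E = \int[P]_x ((L + e) + 2 * \1_A x)%:E)%E.
    rewrite ge0_integralD_fin//; last 2 first.
    - by apply: measurable_funM.
    - by move=> _; rewrite addr_ge0.
    rewrite ge0_integralZ_fin//.
    by rewrite intA intc EFinD EFinM.
  apply: ge0_le_integral => //.
  - by move=> x _; rewrite lee_fin.
  - exact/measurable_EFinP.
  - by apply/measurable_EFinP; apply: measurable_funD => //; apply: measurable_funM => //; exact: mI.
  - by move=> x _; rewrite lee_fin; exact: expected_early_le.
have h5 : (L%:E <= \int[P]_x (expected theta X z i m0 t m0 x)%:E + (e + a)%:E)%E.
  have -> : ((e + a)%:E = \int[P]_x (e + \1_A x)%:E)%E.
    rewrite ge0_integralD_fin//.
    by rewrite intA intc EFinD.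
  rewrite -ge0_integralD_fin//; last 2 first.
  - by apply: measurable_funD => //; exact: mI.
  - by move=> x; rewrite addr_ge0.
  have -> : (L%:E = \int[P]_x L%:E)%E by rewrite intc.
  apply: ge0_le_integral => //.
  - by apply/measurable_EFinP; apply: measurable_funD => //; apply: measurable_funD => //; exact: mI.
  - by move=> x _; rewrite lee_fin; exact: expected_early_ge.
have h6 : (0 <= \int[P]_x (expected theta X z i m0 t M x)%:E)%E.
  by apply: integral_ge0 => x _; rewrite lee_fin.
have a0 : 0 <= a by rewrite -lee_fin PA.
rewrite SE in h1 h2.
move: tele h1 h2 h3 h4 h5 h6; move: (\int[P]_x _)%E (\int[P]_x _)%E (\int[P]_x _)%E.
move: (\sum_(0 <= k < K) _) (limit_value _ _) (z ^+ K) L0 e0 zK0 {SE PA mS mOs S0 Os0 intA intc mO mE O0 E0} => s v zK v0 e0 zK0.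
move=> [e1| |] [e2| |] [e3| |] //=.
rewrite -!EFinD !lee_fin => -[<-] h1 h2 h3 h4 h5 h6.
by rewrite ler_norml; apply/andP; split; lra.
Qed.

End bounds.

(** Markov's inequality for 2^(i - V), where V is the label of the newest vertex: an unborn i means
    V < i. *)
Lemma unborn_prob m :
  (P (~` [set x | born X i m x]) <= (2 ^+ i * (1 - theta / 2) ^+ m)%:E)%E.
Proof.
have mB : measurable (~` [set x | born X i m x]).
  by apply: measurableC; exact: measurable_born.
have mL := measurable_last_vertex X m (fun n => 2^-1 ^+ n).
have h0 (n : nat) : 0 <= (2^-1 : R) ^+ n by rewrite exprn_ge0// invr_ge0.
rewrite EFinM -(integral_last_vertex htheta hX) -ge0_integralZ_fin// -integral_indic_setT//.
apply: ge0_le_integral => //.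
- by apply/measurable_EFinP.
- by apply/measurable_EFinP; exact: measurable_funM.
move=> x _; rewrite lee_fin indicE; have [bx|bx] := boolP (born X i m x).
  by rewrite memNset ?mulr_ge0//= => /(_ bx).
rewrite mem_set /=; last exact/negP.
rewrite exprVn ler_pdivlMr ?exprn_gt0// mul1r ler_eXn2l ?ltr1n//.
by rewrite ltnW// ltnNge.
Qed.

(** Markov's inequality for exp (t - [tau m]). *)
Lemma tau_le_prob m (t : R) : (P [set x | (tau m x <= t)%R] <= (expR t / m.+1%:R)%:E)%E.
Proof.
have mB : measurable [set x | tau m x <= t].
  by apply: measurable_ler_set => //; exact: measurable_tau.
have mE : measurable_fun setT (fun x => expR (- tau m x)).
  by apply: measurableT_comp => //; apply: measurableT_comp => //; exact: measurable_tau.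
rewrite EFinM.
apply: (@le_trans _ _ ((expR t)%:E * \int[P]_x (expR (- tau m x))%:E)%E); last first.
  by apply: lee_wpmul2l; [rewrite lee_fin expR_ge0|exact: (integral_expR_tau htheta hX)].
rewrite -ge0_integralZ_fin ?expR_ge0// -integral_indic_setT//.
apply: ge0_le_integral => //.
- by apply/measurable_EFinP.
- by apply/measurable_EFinP; exact: measurable_funM.
move=> x _; rewrite lee_fin indicE -expRD; case: (boolP (tau m x <= t)) => tx.
  by rewrite mem_set// -[leLHS]expR0 ler_expR subr_ge0.
by rewrite memNset ?expR_ge0//= => /(negP tx).
Qed.

Lemma tau_gt_prob m e : 0 < e -> exists u : R, (P [set x | (u < tau m x)%R] <= e%:E)%E.
Proof.
move=> e0; pose F n := [set x | n%:R < tau m x].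
have mF n : measurable (F n) by apply: measurable_ltr_set => //; exact: measurable_tau.
have F0 : \bigcap_n F n = set0.
  apply/seteqP; split => // x /= Fx; have := Fx (Num.truncn (tau m x)).+1 I.
  by rewrite /F /= ltNge ltW// truncnS_gt.
have : (P \o F) n @[n --> \oo] --> 0%E.
  rewrite -(measure0 P) -F0; apply: nonincreasing_cvg_mu => //.
  - by rewrite ltey_eq fin_num_measure.
  - by rewrite F0.
  - apply/nonincreasing_seqP => n; rewrite subsetEset => x; rewrite /F /=.
    by apply: le_lt_trans; rewrite ler_nat.
move=> /fine_cvgP[_] /cvgrPdist_le /(_ _ e0)[N _ /(_ N (leqnn N))] /=.
rewrite sub0r normrN ger0_norm ?fine_ge0// => PN; exists N%:R.
by rewrite -(fineK (fin_num_measure P _ (mF N))) lee_fin.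
Qed.

Let mu_gt0 : 0 < 1 - theta. Proof. by rewrite subr_gt0; case/andP: htheta. Qed.

Let exists_age e : 0 < e -> exists2 T1, 0 <= T1 & expR (- (1 - theta) * T1) <= e.
Proof.
move=> e0; have /cvgrPdist_le /(_ _ e0)[N [_ /(_ (`|N| + 1))]] := cvg_expRN mu_gt0.
rewrite sub0r normrN (ger0_norm (expR_ge0 _)) => h.
by exists (`|N| + 1); rewrite ?addr_ge0// h// (le_lt_trans (ler_norm N))// ltrDl.
Qed.

Let exists_born e : 0 < e -> exists m, (P (~` [set x | born X i m x]) <= e%:E)%E.
Proof.
move=> e0; have c0 : 0 < e / 2 ^+ i by rewrite divr_gt0// exprn_gt0.
have r0 : 0 <= 1 - theta / 2 by case/andP: htheta => t0 t1; lra.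
have r1 : `|1 - theta / 2| < 1 by rewrite ger0_norm//; case/andP: htheta => t0 t1; lra.
have /cvgrPdist_le /(_ _ c0)[N _ /(_ N (leqnn N))] := cvg_expr r1.
rewrite /= sub0r normrN ger0_norm ?exprn_ge0// => h; exists N.
by rewrite (le_trans (unborn_prob N))// lee_fin mulrC -ler_pdivlMr// exprn_gt0.
Qed.

Let exists_late (t e : R) m0 : 0 < e ->
  exists2 M, (m0 <= M)%N & (P [set x | (tau M x <= t)%R] <= e%:E)%E.
Proof.
move=> e0; exists (maxn m0 (Num.truncn (expR t / e))); first exact: leq_maxl.
rewrite (le_trans (tau_le_prob _ _))// lee_fin ler_pdivrMr// mulrC -ler_pdivrMr//.
rewrite (le_trans (ltW (truncnS_gt _)))// ler_nat ltnS leq_maxr//.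
Qed.

Lemma degree_pgf_near (z e : R) K : 0 <= z <= 1 -> 0 < e ->
  \forall t \near +oo,
    `|\sum_(0 <= k < K) z ^+ k * fine (P (degree_event X i t k)) - limit_value theta (1 - z)| <= z ^+ K + e.
Proof.
(* 13 = 1 + 4 * 3: one share for the exponential term, and four times the three parts of
   [atypical]. *)
move=> z01 e0; have e13 : 0 < e / 13 by rewrite divr_gt0.
have [T1 T10 eT] := exists_age e13.
have [m0 bm] := exists_born e13.
have [u um] := tau_gt_prob m0 e13.
have : \forall t \near +oo, u + T1 <= t by apply: nbhs_pinfty_ge; rewrite num_real.
apply: filterS => t ut.
(* [M] may depend on t, since the bound involves it only through the probability of [atypical]; the
   age, m0 and u were fixed before t. *)
have [M m0M tM] := exists_late t m0 e13.
have := degree_pgf_dist K t z01 m0M T10.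
have mB : measurable (~` [set x | born X i m0 x]).
  by apply: measurableC; exact: measurable_born.
have mU v : measurable [set x | v < tau m0 x].
  by apply: measurable_ltr_set => //; exact: measurable_tau.
have mM : measurable [set x | tau M x <= t].
  by apply: measurable_ler_set => //; exact: measurable_tau.
have mA : measurable (atypical X i m0 M t T1) by exact: measurable_atypical.
have : (P (atypical X i m0 M t T1) <= (e / 13 + e / 13 + e / 13)%:E)%E.
  rewrite !EFinD; apply: (le_trans (measureU2 _ _ _)) => //; first exact: measurableU.
  apply: leeD => //; apply: (le_trans (measureU2 _ _ _)) => //.
  apply: leeD => //; apply: le_trans um; apply: le_measure; rewrite ?inE//.
  by move=> x /=; apply: le_lt_trans; rewrite lerBrDr.
rewrite -(fineK (fin_num_measure P _ mA)) lee_fin.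
move: (fine _) (\sum_(0 <= k < K) _ - _) (z ^+ K) (expR _) eT => a s zK ee eT ha /le_trans; apply.
by rewrite /=; lra.
Qed.

(** The terms below k converge by induction and those above k are of order z^(k+1), uniformly in t;
    after division by z^k the k-th term is determined up to an error of order z. *)
Lemma degree_prob_cvg k :
  fine (P (degree_event X i t k)) @[t --> +oo] --> mixture theta k.
Proof.
elim/ltn_ind: k => k IH.
pose S z n t := \sum_(0 <= j < n) z ^+ j * (fine (P (degree_event X i t j)) - mixture theta j).
have head z n : (n <= k)%N -> S z n t @[t --> +oo] --> (0 : R).
  elim: n => [|n IHn] nk.
    rewrite (_ : S z 0%N = cst 0); first exact: cvg_cst.
    by apply/funext => t; rewrite /S big_nil.
  rewrite (_ : S z n.+1 = (fun t => S z n t + z ^+ n * (fine (P (degree_event X i t n)) - mixture theta n))); last first.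
    by apply/funext => t; rewrite /S big_nat_recr.
  rewrite -[X in _ --> X](addr0 0); apply: cvgD; first by apply: IHn; exact: ltnW.
  rewrite -[X in _ --> X](mulr0 (z ^+ n)); apply: cvgM; first exact: cvg_cst.
  rewrite -[X in _ --> X](subrr (mixture theta n)); apply: cvgB; last exact: cvg_cst.
  exact: IH.
(* Four errors of at most z^k e / 4 each: the truncation z^(k+1), the margin in [degree_pgf_near],
   the terms below k, and the remainder of the mixture. *)
apply/cvgrPdist_le => e e0; pose z := Num.min 1 (e / 4).
have z0 : 0 < z by rewrite lt_min ltr01 divr_gt0.
have z1 : z <= 1 by rewrite ge_min lexx.
have ze : z <= e / 4 by rewrite ge_min lexx orbT.
have z01 : 0 <= z <= 1 by rewrite ltW.
have zk0 : 0 < z ^+ k by rewrite exprn_gt0.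
have e'0 : 0 < z ^+ k * (e / 4) by rewrite mulr_gt0// divr_gt0.
have near1 := degree_pgf_near k.+1 z01 e'0.
have /cvgrPdist_le /(_ _ e'0) near2 := head z k (leqnn k).
near=> t.
have h1 : `|\sum_(0 <= j < k.+1) z ^+ j * fine (P (degree_event X i t j)) - limit_value theta (1 - z)| <=
  z ^+ k.+1 + z ^+ k * (e / 4) by near: t.
have h2 : `|0 - S z k t| <= z ^+ k * (e / 4) by near: t.
have /andP[r0 r1] := mixture_rest_bounds htheta k.+1 z01.
move: h1; rewrite (limit_value_mixture htheta k.+1 z01) opprD addrA -sumrB.
under eq_bigr do rewrite -mulrBr.
rewrite big_nat_recr//= -/(S z k t) => h1.
have zS : z ^+ k.+1 <= z ^+ k * (e / 4) by rewrite exprSr ler_wpM2l// ltW.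
rewrite -(ler_pM2l zk0) -[X in X * `|_|](gtr0_norm zk0) -normrM.
move: h1 h2; rewrite !ler_norml.
move: (S z k t) (mixture_rest _ _ _) (fine _) (mixture _ _) (z ^+ k.+1) r0 r1 zS => s r p q zK r0 r1 zS.
rewrite sub0r !mulrBr; move: (z ^+ k * p) (z ^+ k * q) => a b.
have -> : z ^+ k * (e / 4) = z ^+ k * e / 4 by rewrite mulrA.
move=> /andP[h1 h2] /andP[h3 h4]; apply/andP; split; lra.
Unshelve. all: by end_near. Qed.

End degree_law.

Theorem theorem1 (R : realType) (theta : R) (htheta : 0 < theta < 1)
    (d : measure_display) (T : measurableType d) (P : probability T R)
    (X : nat -> bool -> nat -> {RV P >-> R})
    (hX : poisson_clocks theta X) :
  (forall i k : nat,
     P (degree_event X i t k) @[t --> +oo] --> (q_ theta k)%:E) /\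
  (forall k : nat, 0 < q_ theta k) /\
  series (q_ theta) @ \oo --> (1 : R).
Proof.
have qE : q_ theta = mixture theta by apply/funext => k; exact: q_E.
rewrite qE; split; last by split; [exact: mixture_gt0|exact: cvg_series_mixture].
move=> i k; apply: cvg_EFin; last exact: degree_prob_cvg htheta hX i k.
by near=> t; rewrite fin_num_measure//; exact: measurable_degree_event.
Unshelve. all: by end_near. Qed.
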